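(* Let $u\colon\mathbb N\to\mathbb C$ be an arithmetic function taking finitely many values. If $u$ is generic, then $u\perp\mathscr C_{\rm ZE}$ if and only if $$\lim_{m\to\infty}\lim_{N\to\infty}\left|\frac1N\sum_{n\le N}u(n)\,\mathbf 1_{(u(m+n),u(m+n+1),\ldots,u(m+n+\ell-1))\in C}\right|=0$$ uniformly in $\ell\ge1$ and in $C$, a set of blocks of length $\ell$.
   Context: A topological dynamical system $(X,T)$ is a homeomorphism $T$ of a compact metric space $X$. $\mathscr C_{\rm ZE}$ is the class of topological systems of zero topological entropy. $u\perp\mathscr C_{\rm ZE}$ means that $\lim_{N\to\infty}\frac1N\sum_{n\le N}f(T^nx)u(n)=0$ for all $(X,T)\in\mathscr C_{\rm ZE}$, $f\in C(X)$ and $x\in X$. Let $|u|\le L$. Extend $u$ to $\mathbb Z$ by $u(-n)=u(n)$ for $n\in\mathbb N$ and any $u(0)$ with $|u(0)|\le L$. Let $S$ be the left shift on $\{z\in\mathbb C:|z|\le L\}^{\mathbb Z}$. The function $u$ is generic if the probability measures $\frac1N\sum_{n\le N}\delta_{S^nu}$ converge in the weak-$*$ topology as $N\to\infty$ (along the whole sequence of natural numbers). A block of length $\ell$ is an $\ell$-tuple of values of $u$. Uniformity means that the supremum over all $\ell$ and $C$ of the inner limit $\lim_{N\to\infty}|\cdots|$ tends to $0$ as $m\to\infty$. *)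

(* Defs.v *)
(* Complex numbers are R[i], over an arbitrary R : realType. *)
From HB Require Import structures.
From mathcomp Require Export all_boot all_order all_algebra.
From mathcomp Require Export finmap.
From mathcomp Require Export all_classical all_reals all_analysis.
From mathcomp.real_closed Require Export complex.

Set Implicit Arguments.
Unset Strict Implicit.
Unset Printing Implicit Defensive.

Import Order.TTheory GRing.Theory Num.Theory.
Import numFieldNormedType.Exports.

Local Open Scope classical_set_scope.
Local Open Scope ring_scope.

(* The norm topology that every numFieldType carries, made canonical on R[i]. *)
HB.instance Definition _ (R : realType) :=
  PseudoPointedMetric.copy R[i] (R[i] : numFieldType).

Section Dynamics.
Variables (R : realType) (X : metricType R) (T : X -> X).

Definition homeomorphism : Prop :=
  continuous T /\
  exists2 T' : X -> X, continuous T' & cancel T T' /\ cancel T' T.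

(* Topological entropy is Bowen's: E is (n, e)-separated when distinct points
   of E are more than e apart for the metric max_(i < n) d (T^i x) (T^i y). *)
Definition separated (n : nat) (e : R) (E : {fset X}) : Prop :=
  forall x y, x \in E -> y \in E -> x != y ->
    exists2 i, (i < n)%N & e < mdist (iter i T x) (iter i T y).

Definition separated_card (n : nat) (e : R) : \bar R :=
  ereal_sup [set (#|` E|%fset%:R)%:E | E in separated n e].

Definition entropy_at (e : R) : \bar R :=
  limn_esup (fun n => (n%:R^-1)%:E * lne (separated_card n e))%E.

(* entropy_at e is nonincreasing in e, so this supremum is its limit as e
   decreases to 0. *)
Definition topological_entropy : \bar R :=
  ereal_sup [set entropy_at e | e in [set e : R | 0 < e]].

Definition zero_entropy_system : Prop :=
  [/\ compact [set: X], homeomorphism & topological_entropy = 0%E].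

End Dynamics.

(* An arithmetic function on {1, 2, ...} is given as u : nat -> R[i]; the value
   u 0 is never used. *)
Section ArithmeticFunctions.
Variables (R : realType) (u : nat -> R[i]).

Definition mean (a : nat -> R[i]) (N : nat) : R[i] :=
  N%:R^-1 * \sum_(1 <= n < N.+1) a n.

Definition orthogonal_to_zero_entropy : Prop :=
  forall (X : metricType R) (T : X -> X), zero_entropy_system T ->
  forall (f : X -> R[i]) (x : X), continuous f ->
    mean (fun n => f (iter n T x) * u n) @ \oo --> (0 : R[i]).

Definition values : set R[i] := [set u n | n in [set n | (0 < n)%N]].

Definition blocks (l : nat) : set (l.-tuple R[i]) :=
  [set b | forall i, values (tnth b i)].

Definition block_mean (m l : nat) (C : set (l.-tuple R[i])) (N : nat) : R :=
  ComplexField.Normc.normc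
    (mean (fun n => u n * \1_C [tuple u (m + n + i)%N | i < l]) N).

(* The first component asserts that the inner limits exist, limn being
   meaningful only for convergent sequences; the second one is uniformity: the
   supremum over all l and C of the inner limits tends to 0. *)
Definition block_means_vanish_uniformly : Prop :=
  (forall m l (C : set (l.-tuple R[i])), (0 < l)%N -> C `<=` @blocks l ->
     cvgn (block_mean m C)) /\
  (fun m => ereal_sup
     [set v | exists l (C : set (l.-tuple R[i])),
        [/\ (0 < l)%N, C `<=` @blocks l & v = (limn (block_mean m C))%:E]])
    @ \oo --> 0%E.

End ArithmeticFunctions.

Section WeakConvergence.
Variables (R : realType) (X : ptopologicalType).

Definition borel : Type := g_sigma_algebraType (@open X).

HB.instance Definition _ := Measurable.on borel.

Definition weak_cvg (mu : {measure set borel -> \bar R}^nat)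
    (nu : probability borel R) : Prop :=
  forall f : X -> R, continuous f ->
    (fun N => \int[mu N]_x (f x)%:E)%E @ \oo --> (\int[nu]_x (f x)%:E)%E.

End WeakConvergence.

Section ShiftSpace.
Variables (R : realType) (L : {nonneg R}).

Definition disc : set R[i] :=
  [set z | ComplexField.Normc.normc z <= L%:num].

Lemma disc0 : 0 \in disc.
Proof. by rewrite inE /disc /= expr0n /= addr0 Num.Theory.sqrtr0. Qed.

HB.instance Definition _ := isPointed.Build disc (SigSub disc0).

Definition shift_space : Type := {ptws int -> disc}.

HB.instance Definition _ := Topological.on shift_space.
HB.instance Definition _ := Pointed.on shift_space.

Definition shift (z : shift_space) : shift_space := fun k => z (k + 1).

(* Times 1, ..., N, hence the n.+1. *)
Definition empirical_measure (z : shift_space) (N : nat) :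
    {measure set (borel shift_space) -> \bar R} :=
  mscale (N%:R^-1)%:nng
    (msum (fun n => \d_(iter n.+1 shift z : borel shift_space)) N).

Definition generic (z : shift_space) : Prop :=
  exists nu : probability (borel shift_space) R,
    weak_cvg (empirical_measure z) nu.

(* z (0) is left free, as any point of the disc. *)
Definition symmetric_extension (u : nat -> R[i]) (z : shift_space) : Prop :=
  forall n, (0 < n)%N ->
    set_val (z n%:Z) = u n /\ set_val (z (- n%:Z)) = u n.

End ShiftSpace.

(* Main.v *)
From HB Require Import structures.
Require Import Defs.
From mathcomp Require Import ring lra zify measurable_realfun.

(**
Why the theorem is true.

Write u = v o a, where a takes values in a finite alphabet A. Since u is
generic, every word over A has a frequency in a, so each function G of
finitely many coordinates has a mean value E G along a, and E is invariant
under the shift. Thus a behaves like a sample of a stationary process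
x_0, x_1, ... known through its finite-dimensional laws. Let b be the real or
the imaginary part of v. The inner limits of the statement are built from the
numbers E (b(x_0) 1_D(x_m, ..., x_(m+l-1))). By the tower property they are
controlled by the L2 norm of the conditional expectation condE of b(x_0) given
the window [m, m + l) (lemma sqr_E_event), and they control its L1 norm (lemma
E_abs_condE). The block condition therefore says that the far future carries
no information about the mean of b(x_0).

Block condition implies orthogonality. Let phi(k) = f(T^k x) for a real
continuous f. In a system of zero entropy, the windows of length W of phi are,
up to a small error, among exp(d W) patterns (orbit_cover). Choose m such that
b(x_0) is almost unpredictable from what follows time m, and sample at the
times k, k + m, k + 2m, ... For one fixed pattern of weights, the weighted sum
of the samples of b is a sum of martingale differences in reverse time plus a
small predictable part, so its exponential moments are bounded (E_exp_mart). A
union bound over all patterns costs only the logarithm of their number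
(union_bound). Hence phi cannot correlate with b o a, whichever pattern it
follows at each k (decoupling).

Orthogonality implies block condition. Suppose that the energies, that is the
squared L2 norms of the conditional expectations, do not tend to 0. Along
windows [k, k + l_k) of nearly maximal energy, the conditional expectations
converge in L2 to the conditional expectation given the tail. Taking their
signs above a suitable threshold gives codings c_k in three letters which are
Cauchy in probability and satisfy E (b(x_0) c_k) >= g > 0 (exists_codings).
In the limit, such a coding is measurable with respect to the tail, which has
zero entropy for a process with a finite alphabet. The finite form of this
fact, proved with submodularity of entropy (Hent_cword), is that for long
words and large k, all but a small part of the words of c_k belong to a list
of exp(d W) words (few_words).

It remains to produce a deterministic sequence. Take scales W_0, W_1, ..., each
dividing the next, with lists for rates tending to 0 and exceptional
probabilities of small sum. Erase, in a word of scale j, every aligned block of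
scale i <= j that is not in its list. Cleaned words have low complexity at all
scales (good_infix_count), and the cleaning costs at most half of the
correlation g (E_gain). Reading c_k along a, at the best phase, and cleaning
gives arbitrarily long segments that correlate with b o a; their concatenation
(exists_correlated_sequence) has subexponential complexity, hence generates a
subshift of zero entropy (zero_entropy_subshift), and it contradicts
orthogonality.
*)

Set Implicit Arguments.
Unset Strict Implicit.
Unset Printing Implicit Defensive.

Import Order.TTheory GRing.Theory Num.Theory.
Import numFieldNormedType.Exports.

Local Open Scope classical_set_scope.
Local Open Scope ring_scope.

Local Notation normc := ComplexField.Normc.normc.
Local Notation Re := complex.Re.
Local Notation Im := complex.Im.

(** * Entropy of finite random variables *)

Section EntropyFunction.
Variable R : realType.
Implicit Types t : R.

Definition negxlnx t : R := - (t * ln t).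

Lemma negxlnx_ge0 t : t <= 1 -> 0 <= negxlnx t.
Proof.
move=> t1; rewrite /negxlnx; have [t0|t0] := leP t 0; first by rewrite ln0// mulr0 oppr0.
by rewrite -mulrN mulr_ge0 ?(ltW t0)// oppr_ge0 ln_le0.
Qed.

Lemma ln_ge_subV t : 0 < t -> 1 - t^-1 <= ln t.
Proof.
move=> t0; have := @le_ln1Dx R (t^-1 - 1).
rewrite (_ : 1 + (t^-1 - 1) = t^-1) ?lnV//; last by ring.
move=> h.
suff: - ln t <= t^-1 - 1 by lra.
by apply: h; rewrite ltrBrDr addNr invr_gt0.
Qed.

Lemma negxlnx_le t : 0 <= t -> negxlnx t <= 1 - t.
Proof.
rewrite le_eqVlt => /predU1P[<-|t0]; first by rewrite /negxlnx mul0r; lra.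
rewrite /negxlnx -mulrN.
have h := ln_ge_subV t0.
have : t * - ln t <= t * (t^-1 - 1) by rewrite ler_pM2l//; lra.
by rewrite mulrBr mulfV ?gt_eqF// mulr1.
Qed.

(** Writing t = s * s gives -t ln t = 2 s (-s ln s), and -s ln s is at most 1.
    This is the modulus of continuity that makes rare errors cheap in entropy.
    *)
Lemma negxlnx_sqrt t : 0 <= t -> negxlnx t <= 2 * Num.sqrt t.
Proof.
rewrite le_eqVlt => /predU1P[<-|t0]; first by rewrite /negxlnx mul0r sqrtr0; lra.
have s0 : 0 < Num.sqrt t by rewrite sqrtr_gt0.
have tE : t = Num.sqrt t * Num.sqrt t by rewrite -expr2 sqr_sqrtr// ltW.
have lnE : ln t = ln (Num.sqrt t) + ln (Num.sqrt t) by rewrite {1}tE lnM.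
have h := ln_ge_subV s0.
rewrite /negxlnx lnE {1}tE.
have e : Num.sqrt t * - ln (Num.sqrt t) <= 1.
  have : Num.sqrt t * - ln (Num.sqrt t) <= Num.sqrt t * ((Num.sqrt t)^-1 - 1).
    by rewrite ler_pM2l//; lra.
  rewrite mulrBr mulfV ?gt_eqF// mulr1; lra.
nra.
Qed.

End EntropyFunction.

Section FiniteProbability.
Variables (R : realType).

Record fprob (Om : finType) := FProb {
  weight :> Om -> R;
  weight_ge0 : forall w, 0 <= weight w;
  weight_sum1 : \sum_w weight w = 1 }.

Variables (Om : finType) (p : fprob Om).

Definition Ex (F : Om -> R) : R := \sum_w p w * F w.

Definition Pr (B : pred Om) : R := Ex (fun w => (B w)%:R).

Lemma eq_Ex F G : F =1 G -> Ex F = Ex G.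
Proof. by move=> FG; apply: eq_bigr => w _; rewrite FG. Qed.

Lemma ExD F G : Ex (fun w => F w + G w) = Ex F + Ex G.
Proof. by rewrite /Ex -big_split; apply: eq_bigr => w _; rewrite mulrDr. Qed.

Lemma ExZ c F : Ex (fun w => c * F w) = c * Ex F.
Proof. by rewrite /Ex mulr_sumr; apply: eq_bigr => w _; rewrite mulrCA. Qed.

Lemma ExN F : Ex (fun w => - F w) = - Ex F.
Proof. by rewrite /Ex -sumrN; apply: eq_bigr => w _; rewrite mulrN. Qed.

Lemma ExB F G : Ex (fun w => F w - G w) = Ex F - Ex G.
Proof. by rewrite ExD ExN. Qed.

Lemma Ex_cst c : Ex (fun=> c) = c.
Proof. by rewrite /Ex -mulr_suml weight_sum1 mul1r. Qed.

Lemma Ex_sum I (r : seq I) (P : pred I) F :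
  Ex (fun w => \sum_(i <- r | P i) F i w) = \sum_(i <- r | P i) Ex (F i).
Proof.
rewrite /Ex exchange_big; apply: eq_bigr => w _ /=; by rewrite mulr_sumr.
Qed.

Lemma ler_Ex F G : (forall w, F w <= G w) -> Ex F <= Ex G.
Proof. by move=> FG; apply: ler_sum => w _; rewrite ler_wpM2l ?weight_ge0. Qed.

Lemma ler_Ex_pos F G : (forall w, 0 < p w -> F w <= G w) -> Ex F <= Ex G.
Proof.
move=> FG; apply: ler_sum => w _; have := weight_ge0 p w.
by rewrite le_eqVlt => /predU1P[<-|w0]; rewrite ?mul0r// ler_pM2l// FG.
Qed.

Lemma Ex_ge0 F : (forall w, 0 <= F w) -> 0 <= Ex F.
Proof. by move=> F0; apply: sumr_ge0 => w _; rewrite mulr_ge0 ?weight_ge0. Qed.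

Section Law.
Variables (J : finType) (xi : Om -> J).

Definition pmf (j : J) : R := Ex (fun w => (xi w == j)%:R).

Lemma pmf_ge0 j : 0 <= pmf j.
Proof. by apply: Ex_ge0 => w; rewrite ler0n. Qed.

Lemma pmf_le1 j : pmf j <= 1.
Proof. by rewrite -[leRHS](Ex_cst 1); apply: ler_Ex => w; rewrite lern1 leq_b1. Qed.

Lemma pmf_gt0 w : 0 < p w -> 0 < pmf (xi w).
Proof.
move=> w0; rewrite /pmf /Ex (bigD1 w)//= eqxx mulr1 ltr_pwDl//.
by apply: sumr_ge0 => i _; rewrite mulr_ge0 ?weight_ge0.
Qed.

Lemma Ex_law F (G : J -> R) :
  Ex (fun w => F w * G (xi w)) = \sum_j Ex (fun w => (xi w == j)%:R * F w) * G j.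
Proof.
rewrite /Ex; under [RHS]eq_bigr do rewrite mulr_suml.
rewrite exchange_big; apply: eq_bigr => w _ /=.
rewrite (bigD1 (xi w))//= eqxx mul1r big1 ?addr0 ?mulrA// => j /negbTE jw.
by rewrite eq_sym jw !(mul0r, mulr0).
Qed.

Lemma Ex_pmf (G : J -> R) : Ex (fun w => G (xi w)) = \sum_j pmf j * G j.
Proof.
under eq_Ex => w do rewrite -[G _]mul1r.
rewrite (Ex_law (fun=> 1)); apply: eq_bigr => j _; congr (_ * _).
by apply: eq_Ex => w; rewrite mulr1.
Qed.

Lemma pmf_sum1 : \sum_j pmf j = 1.
Proof.
by have := Ex_pmf (fun=> 1); rewrite Ex_cst => ->; apply: eq_bigr => j; rewrite mulr1.
Qed.

(** Dividing by zero puts the value 0 on null events, where the integrated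
    identity cexp_pmf remains true. *)
Definition cexp (F : Om -> R) (j : J) : R :=
  Ex (fun w => (xi w == j)%:R * F w) / pmf j.

Lemma cexp_pmf F j : cexp F j * pmf j = Ex (fun w => (xi w == j)%:R * F w).
Proof.
rewrite /cexp; have [pj|pj] := eqVneq (pmf j) 0; last by rewrite divfK.
rewrite pj mulr0; apply/esym/big1 => w _.
move/eqP: pj; rewrite psumr_eq0 => [/allP/(_ w)|]; last first.
  by move=> i _; rewrite mulr_ge0 ?weight_ge0.
rewrite mem_index_enum => /(_ isT)/eqP; case: eqP => _; rewrite ?mulr1 => e.
  by rewrite e mul0r.
by rewrite mul0r mulr0.
Qed.

Lemma tower F (G : J -> R) :
  Ex (fun w => F w * G (xi w)) = Ex (fun w => cexp F (xi w) * G (xi w)).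
Proof.
rewrite Ex_law (Ex_pmf (fun j => cexp F j * G j)); apply: eq_bigr => j _.
by rewrite -cexp_pmf mulrAC [in LHS]mulrC [pmf j * _]mulrC -!mulrA.
Qed.

Lemma cexp_le F (B : R) j : 0 <= B -> (forall w, `|F w| <= B) -> `|cexp F j| <= B.
Proof.
move=> B0 FB; rewrite /cexp; have [->|pj] := eqVneq (pmf j) 0.
  by rewrite invr0 mulr0 normr0.
have pj0 : 0 < pmf j by rewrite lt_def pj pmf_ge0.
rewrite normrM normfV (gtr0_norm pj0) ler_pdivrMr//.
rewrite /pmf -ExZ (le_trans (ler_norm_sum _ _ _))//; apply: ler_sum => w _.
rewrite normrM ger0_norm ?weight_ge0// ler_wpM2l ?weight_ge0// normrM ger0_norm ?ler0n//.
by rewrite mulrC ler_wpM2r// ler0n.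
Qed.

Definition entropy : R := \sum_j negxlnx (pmf j).

Lemma entropyE : entropy = Ex (fun w => - ln (pmf (xi w))).
Proof.
rewrite (Ex_pmf (fun j => - ln (pmf j))); apply: eq_bigr => j _.
by rewrite /negxlnx mulrN.
Qed.

Lemma entropy_ge0 : 0 <= entropy.
Proof. by apply: sumr_ge0 => j _; rewrite negxlnx_ge0 ?pmf_le1. Qed.

Lemma entropy_le_card : entropy <= #|J|%:R.
Proof.
rewrite /entropy (le_trans (ler_sum (G := fun=> 1) _ _))//.
  by move=> j _; rewrite (le_trans (negxlnx_le (pmf_ge0 j)))//; have := pmf_ge0 j; lra.
by rewrite sumr_const -[_ *+ _]/(_%:R).
Qed.

End Law.

(** Conditioning on pi o xi after conditioning on xi is an orthogonal
    projection, so the squared distance is the loss of squared norm. *)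
Lemma cexp_pythagoras (J K : finType) (xi : Om -> J) (pi : J -> K) F :
  Ex (fun w => (cexp xi F (xi w) - cexp (pi \o xi) F (pi (xi w))) ^+ 2) =
  Ex (fun w => (cexp xi F (xi w)) ^+ 2) -
  Ex (fun w => (cexp (pi \o xi) F (pi (xi w))) ^+ 2).
Proof.
set f := cexp xi F; set g := cexp _ F.
have e1 : Ex (fun w => f (xi w) * g (pi (xi w))) = Ex (fun w => g (pi (xi w)) ^+ 2).
  rewrite -(tower xi F (g \o pi)) (tower (pi \o xi) F g).
  by apply: eq_Ex => w /=; rewrite expr2.
rewrite -[X in X - _]addr0 -(subrr (Ex (fun w => f (xi w) * g (pi (xi w))))).
rewrite -[in RHS]e1 -!ExB -ExD -ExB.
rewrite (_ : Ex (fun w => (f (xi w) - g (pi (xi w))) ^+ 2) =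
  Ex (fun w => f (xi w) ^+ 2) - 2 * Ex (fun w => f (xi w) * g (pi (xi w))) +
  Ex (fun w => g (pi (xi w)) ^+ 2)); last first.
  by rewrite -ExZ -ExB -ExD; apply: eq_Ex => w; ring.
by rewrite -e1 -ExZ -ExB -ExD; apply: eq_Ex => w; ring.
Qed.

Lemma sqr_Ex F : (Ex F) ^+ 2 <= Ex (fun w => F w ^+ 2).
Proof.
set m := Ex F.
have : 0 <= Ex (fun w => (F w - m) ^+ 2) by apply: Ex_ge0 => w; rewrite sqr_ge0.
rewrite (_ : Ex _ = Ex (fun w => F w ^+ 2) - 2 * m * Ex F + Ex (fun=> m ^+ 2)).
  by rewrite Ex_cst -/m; lra.
by rewrite -ExZ -ExB -ExD; apply: eq_Ex => w; ring.
Qed.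

Lemma markov_Ex (F : Om -> R) (c : R) : (forall w, 0 <= F w) -> 0 < c ->
  Pr (fun w => c <= F w) <= Ex F / c.
Proof.
move=> F0 c0; rewrite ler_pdivlMr// mulrC -ExZ; apply: ler_Ex => w.
by case: (leP c (F w)) => h; rewrite ?mulr1 ?mulr0 ?F0.
Qed.

Lemma entropy_det (J K : finType) (xi : Om -> J) (eta : Om -> K) :
  (forall w w', xi w = xi w' -> eta w = eta w') -> entropy eta <= entropy xi.
Proof.
move=> det; rewrite !entropyE; apply: ler_Ex_pos => w w0.
rewrite lerN2 ler_ln ?posrE ?pmf_gt0//.
by apply: ler_Ex => w'; rewrite ler_nat; case: (xi w' =P xi w) => // /det ->; rewrite eqxx.
Qed.

Lemma eq_entropy_det (J K : finType) (xi : Om -> J) (eta : Om -> K) :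
  (forall w w', xi w = xi w' <-> eta w = eta w') -> entropy eta = entropy xi.
Proof.
by move=> det; apply/eqP; rewrite eq_le !entropy_det// => w w' /det.
Qed.

Lemma pmf_pair1 (J K : finType) (xi : Om -> J) (eta : Om -> K) k :
  \sum_j pmf (fun w => (xi w, eta w)) (j, k) = pmf eta k.
Proof.
rewrite /pmf -Ex_sum; apply: eq_Ex => w.
rewrite (bigD1 (xi w))//= xpair_eqE eqxx/= big1 ?addr0// => j /negbTE jw.
by rewrite xpair_eqE eq_sym jw.
Qed.

(** In conditional form, H(xi | eta, zeta) <= H(xi | zeta). The inequality 1 -
    1 / s <= ln s turns it into the statement that the coupling of xi and eta
    that is independent given zeta has total mass at most 1. *)
Lemma entropy_submod (J K L : finType) (xi : Om -> J) (eta : Om -> K) (zeta : Om -> L) :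
  entropy (fun w => (xi w, eta w, zeta w)) + entropy zeta <=
  entropy (fun w => (xi w, zeta w)) + entropy (fun w => (eta w, zeta w)).
Proof.
set xz := fun w => (xi w, zeta w); set ez := fun w => (eta w, zeta w).
set xez := fun w => (xi w, eta w, zeta w).
pose a x z := pmf xz (x, z); pose b y z := pmf ez (y, z).
pose c x y z := pmf xez (x, y, z); pose d z := pmf zeta z.
rewrite -subr_ge0 !entropyE -!ExD -ExB.
(* The density of that conditionally independent coupling with respect to the
   joint law. *)
pose r (t : J * K * L) := a t.1.1 t.2 * b t.1.2 t.2 / (c t.1.1 t.1.2 t.2 * d t.2).
have : Ex (fun w => 1 - r (xez w)) <= Ex (fun w =>
   - ln (pmf xz (xz w)) - ln (pmf ez (ez w)) - (- ln (pmf xez (xez w)) - ln (pmf zeta (zeta w)))).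
  apply: ler_Ex_pos => w w0; rewrite /r /=.
  have a0 : 0 < a (xi w) (zeta w) by exact: pmf_gt0.
  have b0 : 0 < b (eta w) (zeta w) by exact: pmf_gt0.
  have c0 : 0 < c (xi w) (eta w) (zeta w) by exact: pmf_gt0.
  have d0 : 0 < d (zeta w) by exact: pmf_gt0.
  have := @ln_ge_subV R (c (xi w) (eta w) (zeta w) * d (zeta w) / (a (xi w) (zeta w) * b (eta w) (zeta w))).
  rewrite divr_gt0 ?mulr_gt0// => /(_ isT).
  rewrite invf_div ln_div ?posrE ?mulr_gt0// !lnM//.
  rewrite /a /b /c /d /xz /ez /xez; lra.
apply: le_trans; rewrite ExB Ex_cst subr_ge0 Ex_pmf.
rewrite (le_trans (ler_sum (G := fun t => a t.1.1 t.2 * b t.1.2 t.2 / d t.2) _ _))//.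
  move=> [[x y] z] _; rewrite /r/= -/(c x y z).
  have [->|c0] := eqVneq (c x y z) 0.
    by rewrite mul0r divr_ge0 ?mulr_ge0 ?pmf_ge0.
  by rewrite invfM mulrCA mulVKf.
rewrite -(pair_bigA _ (fun jk z => a jk.1 z * b jk.2 z / d z))/=.
rewrite -(pair_bigA _ (fun j k => \sum_z a j z * b k z / d z))/=.
rewrite (eq_bigr (fun i => \sum_z \sum_j a i z * b j z / d z)); last by move=> i _; rewrite exchange_big.
rewrite exchange_big/=.
rewrite (le_trans (ler_sum (G := d) _ _)) ?pmf_sum1//.
move=> z _.
under eq_bigr => i _ do (under eq_bigr do rewrite -mulrA; rewrite -mulr_sumr -mulr_suml).
rewrite -mulr_suml !pmf_pair1 -/(d z).
have [->|d0] := eqVneq (d z) 0; first by rewrite mul0r.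
by rewrite mulrA mulfK.
Qed.

Lemma entropy_pair_le (J K : finType) (xi : Om -> J) (eta : Om -> K) :
  entropy (fun w => (xi w, eta w)) <= entropy xi + entropy eta.
Proof.
have := entropy_submod xi eta (fun=> tt).
rewrite (_ : entropy (fun=> tt) = 0); last first.
  rewrite entropyE; under eq_Ex => w do rewrite /pmf eqxx Ex_cst ln1 oppr0.
  exact: Ex_cst.
rewrite addr0 (@eq_entropy_det _ _ (fun w => (xi w, eta w))); last first.
  by move=> w w'; split=> -[-> ->].
rewrite (@eq_entropy_det _ _ xi (fun w => (xi w, tt))); last by move=> w w'; split=> [|-[]] ->.
by rewrite (@eq_entropy_det _ _ eta (fun w => (eta w, tt)))// => w w'; split=> [|-[]] ->.
Qed.

Lemma entropy_tuple_le (J : finType) (D : nat -> Om -> J) n :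
  entropy (fun w => [tuple D i w | i < n]) <= \sum_(i < n) entropy (D i).
Proof.
elim: n => [|n IH].
  rewrite big_ord0 /entropy big1// => j _.
  rewrite /pmf (@eq_Ex _ (fun=> 1)) ?Ex_cst; first by rewrite /negxlnx ln1 mulr0 oppr0.
  by move=> w; rewrite tuple0 [j]tuple0 eqxx.
rewrite big_ord_recr/=.
apply: le_trans (lerD IH (lexx _)); apply: le_trans (entropy_pair_le _ _).
apply: entropy_det => w w' [e1 e2]; apply: eq_from_tnth => i.
rewrite !tnth_mktuple; have [lt|ge] := ltnP i n.
  have e : [tuple D i w | i < n] = [tuple D i w' | i < n] by exact: val_inj.
  by have := congr1 (fun t => tnth t (Ordinal lt)) e; rewrite !tnth_mktuple.
by have -> : nat_of_ord i = n by apply/eqP; rewrite eqn_leq ge -ltnS ltn_ord.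
Qed.

Lemma card_large_pmf (J : finType) (xi : Om -> J) (c : R) : 0 < c ->
  #|[pred j | c <= pmf xi j]|%:R <= c^-1.
Proof.
move=> c0; rewrite -[leRHS]mul1r ler_pdivlMr//.
rewrite -[leRHS](pmf_sum1 xi).
rewrite (bigID [pred j | c <= pmf xi j])/= ler_wpDr//.
  by apply: sumr_ge0 => j _; exact: pmf_ge0.
rewrite mulr_natl -sumr_const; apply: ler_sum => j; by rewrite inE.
Qed.

(** Markov inequality for the information - ln p(xi), whose mean is the
    entropy. *)
Lemma mass_small_pmf (J : finType) (xi : Om -> J) (d : R) : 0 < d ->
  Pr (fun w => pmf xi (xi w) < expR (- d)) <= entropy xi / d.
Proof.
move=> d0; rewrite entropyE.
apply: (@le_trans _ _ (Pr (fun w => d <= - ln (pmf xi (xi w))))); last first.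
  by apply: markov_Ex => // w; rewrite oppr_ge0 ln_le0// pmf_le1.
apply: ler_Ex_pos => w w0; rewrite ler_nat.
case: ltP => // h; rewrite (_ : (_ <= _)%R = true)//.
by rewrite lerNr -ler_expR lnK ?posrE ?pmf_gt0// ltW.
Qed.

End FiniteProbability.

(** * Word frequencies and the mean value they define *)

Section Windows.
Variable A : Type.
Implicit Types x y : nat -> A.

Definition suffix_from (i : nat) x : nat -> A := fun j => x (i + j)%N.

Definition win (i n : nat) x : n.-tuple A := [tuple x (i + j)%N | j < n].

Definition agree (M : nat) x y := forall i, (i < M)%N -> x i = y i.

(** These are the functions whose means along a sequence are finite
    combinations of word frequencies; all limits below are taken for such
    functions. *)
Definition local (B : Type) (M : nat) (G : (nat -> A) -> B) :=
  forall x y, agree M x y -> G x = G y.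

Lemma agree_le M N x y : (M <= N)%N -> agree N x y -> agree M x y.
Proof. by move=> MN xy i iM; apply: xy; apply: leq_trans MN. Qed.

Lemma local_le B M N (G : (nat -> A) -> B) : (M <= N)%N -> local M G -> local N G.
Proof. by move=> MN G_ x y xy; apply: G_; apply: agree_le xy. Qed.

Lemma win_agree M i n x y : agree M x y -> (i + n <= M)%N -> win i n x = win i n y.
Proof.
move=> xy le; apply: eq_from_tnth => j; rewrite !tnth_mktuple; apply: xy.
by apply: leq_trans le; rewrite ltn_add2l.
Qed.

Lemma nth_win (x0 : A) i n x j : (j < n)%N -> nth x0 (win i n x) j = x (i + j)%N.
Proof. by move=> jn; rewrite -(tnth_nth x0 _ (Ordinal jn)) tnth_mktuple. Qed.

Lemma local_suffix B M k (G : (nat -> A) -> B) :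
  local M G -> local (k + M) (fun x => G (suffix_from k x)).
Proof. by move=> G_ x y xy; apply: G_ => i iM; apply: xy; rewrite ltn_add2l. Qed.

Lemma suffix_fromD i k x : suffix_from i (suffix_from k x) = suffix_from (k + i) x.
Proof. by apply/funext => j; rewrite /suffix_from addnA. Qed.

Definition subword (x0 : A) (i l n : nat) (t : n.-tuple A) : l.-tuple A :=
  [tuple nth x0 t (i + j)%N | j < l].

Lemma subword_win (x0 : A) i l m n x : (i + l <= n)%N ->
  subword x0 i l (win m n x) = win (m + i) l x.
Proof.
move=> le; apply: eq_from_tnth => j; rewrite !tnth_mktuple nth_win ?addnA//.
by apply: leq_trans le; rewrite ltn_add2l.
Qed.

End Windows.

Section Frequencies.
Variables (R : realType) (A : finType) (a : nat -> A).

Definition avg (G : (nat -> A) -> R) (N : nat) : R :=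
  N%:R^-1 * \sum_(1 <= n < N.+1) G (suffix_from n a).

Definition has_frequencies :=
  forall M (w : M.-tuple A), cvgn (avg (fun x => (win 0 M x == w)%:R)).

Hypothesis freq : has_frequencies.

(** On local functions this is integration against the shift-invariant measure
    for which a is generic. Only its finite-dimensional laws (see law below)
    are constructed. *)
Definition freq_mean (G : (nat -> A) -> R) : R := limn (avg G).

Local Notation E := freq_mean.

(** The completion of a finite word is arbitrary, since a local function does
    not see it. *)
Definition pad M (w : M.-tuple A) : nat -> A := nth (a 0%N) w.

Lemma pad_win M x : agree M (pad (win 0 M x)) x.
Proof. by move=> i iM; rewrite /pad nth_win. Qed.

Lemma avg_law M G N : local M G ->
  avg G N = \sum_(w : M.-tuple A) avg (fun x => (win 0 M x == w)%:R) N * G (pad w).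
Proof.
move=> GM; rewrite /avg; under [RHS]eq_bigr do rewrite -mulrA.
rewrite -mulr_sumr; congr (_ * _).
under [RHS]eq_bigr do rewrite mulr_suml.
rewrite exchange_big; apply: eq_bigr => n _ /=.
rewrite (bigD1 (win 0 M (suffix_from n a)))//= eqxx mul1r big1 ?addr0.
  by apply: GM => i iM; rewrite pad_win.
by move=> w /negbTE wn; rewrite eq_sym wn mul0r.
Qed.

Lemma law_ge0 M (w : M.-tuple A) : 0 <= E (fun x => (win 0 M x == w)%:R).
Proof.
apply: limr_ge; first exact: freq.
by apply: nearW => N; rewrite mulr_ge0 ?invr_ge0 ?ler0n// sumr_ge0// => i _; rewrite ler0n.
Qed.

Lemma avg_cvg_law M G : local M G -> avg G @ \oo -->
  \sum_(w : M.-tuple A) E (fun x => (win 0 M x == w)%:R) * G (pad w).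
Proof.
move=> GM; rewrite (_ : avg G = (fun N => \sum_(w : M.-tuple A)
   avg (fun x => (win 0 M x == w)%:R) N * G (pad w))); last first.
  by apply/funext => N; exact: avg_law.
apply: cvg_big => [|w _]; first exact: add_continuous.
by apply: cvgMr_tmp; exact: freq.
Qed.

Lemma avg_cst c : avg (fun=> c) @ \oo --> c.
Proof.
apply: cvg_near_cst; near=> N.
rewrite /avg sumr_const_nat subSS subn0 -[c *+ N]mulr_natl mulKf// pnatr_eq0 -lt0n.
near: N; exact: nbhs_infty_gt.
Unshelve. all: by end_near. Qed.

Lemma law_sum1 M : \sum_(w : M.-tuple A) E (fun x => (win 0 M x == w)%:R) = 1.
Proof.
have h : local M (fun _ : nat -> A => 1 : R) by [].
rewrite -[RHS](cvg_lim (@Rhausdorff R) (avg_cst (c := 1))).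
rewrite (cvg_lim (@Rhausdorff R) (avg_cvg_law h)).
by apply: eq_bigr => w _; rewrite mulr1.
Qed.

Definition law M : fprob R (M.-tuple A) := FProb (@law_ge0 M) (law_sum1 M).

Lemma E_cvg M G : local M G -> avg G @ \oo --> E G.
Proof. by move=> GM; apply/cvg_ex; exists (Ex (law M) (G \o @pad M)); exact: avg_cvg_law. Qed.

Lemma E_law M G : local M G -> E G = Ex (law M) (fun w => G (pad w)).
Proof. by move=> GM; apply/cvg_lim => //; exact: avg_cvg_law. Qed.

(** Shifting the argument by one changes only the two end terms of an average
    over [1, N]. *)
Lemma E_shift M G i : local M G -> E (fun x => G (suffix_from i x)) = E G.
Proof.
move=> GM; elim: i => [//|i IH]; rewrite -{}IH.
set H := fun x => G (suffix_from i x).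
have HM : local (i + M) H by exact: local_suffix.
rewrite (_ : (fun x => _) = (fun x => H (suffix_from 1 x))); last first.
  by apply/funext => x; rewrite /H suffix_fromD.
have HM1 : local (1 + (i + M)) (fun x => H (suffix_from 1 x)) by exact: local_suffix.
have [B HB] : exists B : R, forall x, `|H x| <= B.
  exists (\sum_(w : (i + M).-tuple A) `|H (pad w)|) => x.
  rewrite (HM x (pad (win 0 (i + M) x))); last by move=> j jM; rewrite pad_win.
  by rewrite (bigD1 (win 0 (i + M) x))//= ler_wpDr// sumr_ge0.
have B0 : 0 <= B by apply: le_trans (HB a).
apply/cvg_lim => //; apply/cvgrPdist_le => e e0.
have /cvgrPdist_le/(_ (e / 2)) := E_cvg HM.
rewrite divr_gt0// => /(_ isT) cv.
near=> N.
have N0 : (0 < N)%N by near: N; exists 1%N.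
have -> : avg (fun x => H (suffix_from 1 x)) N = avg H N +
   N%:R^-1 * (H (suffix_from N.+1 a) - H (suffix_from 1 a)).
  rewrite /avg -mulrDr; congr (_ * _).
  rewrite -(telescope_sumr (fun n => H (suffix_from n a)))// sumrB.
  rewrite addrC subrK; apply: eq_bigr => n _; by rewrite suffix_fromD addn1.
rewrite opprD addrA (le_trans (ler_normB _ _))// [leRHS]splitr lerD//.
  by near: N; exact: cv.
rewrite normrM normfV (ger0_norm (ler0n _ N)) mulrC ler_pdivrMr ?ltr0n//.
rewrite (le_trans (ler_normB _ _))// (le_trans (lerD (HB _) (HB _)))//.
rewrite -ler_pdivrMl ?divr_gt0//.
near: N; exact: nbhs_infty_ger.
Unshelve. all: by end_near. Qed.

Lemma ED M F G : local M F -> local M G -> E (fun x => F x + G x) = E F + E G.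
Proof.
move=> FM GM; rewrite (E_law FM) (E_law GM) -ExD; apply: E_law.
by move=> x y xy; rewrite (FM _ _ xy) (GM _ _ xy).
Qed.

Lemma EZ M c F : local M F -> E (fun x => c * F x) = c * E F.
Proof.
move=> FM; rewrite (E_law FM) -ExZ; apply: E_law.
by move=> x y xy; rewrite (FM _ _ xy).
Qed.

Lemma EB M F G : local M F -> local M G -> E (fun x => F x - G x) = E F - E G.
Proof.
move=> FM GM; rewrite (E_law FM) (E_law GM) -ExB; apply: E_law.
by move=> x y xy; rewrite (FM _ _ xy) (GM _ _ xy).
Qed.

Lemma E_sum M I (r : seq I) (P : pred I) F : (forall i, P i -> local M (F i)) ->
  E (fun x => \sum_(i <- r | P i) F i x) = \sum_(i <- r | P i) E (F i).
Proof.
move=> FM; rewrite (eq_bigr (fun i => Ex (law M) (fun w => F i (pad w)))).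
  rewrite -Ex_sum; apply: E_law => x y xy.
  by apply: eq_bigr => i /FM/(_ _ _ xy).
by move=> i /FM/E_law.
Qed.

Lemma ler_E M F G : local M F -> local M G -> (forall x, F x <= G x) -> E F <= E G.
Proof. by move=> FM GM FG; rewrite (E_law FM) (E_law GM); apply: ler_Ex. Qed.

Lemma E_cst c : E (fun=> c) = c.
Proof. by rewrite (@E_law 0)// Ex_cst. Qed.

Lemma E_ge0 M F : local M F -> (forall x, 0 <= F x) -> 0 <= E F.
Proof. by move=> FM F0; rewrite (E_law FM); apply: Ex_ge0. Qed.

Lemma local_win (B : Type) m l M (g : l.-tuple A -> B) : (m + l <= M)%N ->
  local M (fun x => g (win m l x)).
Proof. by move=> le x y xy; rewrite (win_agree xy). Qed.

Section ConditionalExpectation.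
Variable b : A -> R.

(** The conditional expectation of b(x_0), knowing that the window [m, m + l)
    of x reads v. *)
Definition condE m l (v : l.-tuple A) : R :=
  E (fun x => (win m l x == v)%:R * b (x 0%N)) / E (fun x => (win m l x == v)%:R).

Lemma condE_cexp m l M : (0 < M)%N -> (m + l <= M)%N ->
  @condE m l = cexp (law M) (fun w => win m l (pad w)) (fun w => b (pad w 0%N)).
Proof.
move=> M0 le; apply/funext => v; rewrite /condE /cexp /pmf.
congr (_ / _); apply: E_law => x y xy; rewrite (win_agree xy)//.
by rewrite (xy 0%N).
Qed.

Lemma E_tower m l (g : l.-tuple A -> R) :
  E (fun x => b (x 0%N) * g (win m l x)) =
  E (fun x => condE m (win m l x) * g (win m l x)).
Proof.
have h := leqnSn (m + l).
rewrite (@E_law (m + l).+1) ?(@E_law (m + l).+1).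
- by rewrite (@condE_cexp m l (m + l).+1)// -tower.
- exact: (@local_win _ m l _ (fun v => condE m v * g v)).
- by move=> x y xy; rewrite (win_agree xy)// (xy 0%N).
Qed.

Lemma condE_le (B : R) m l (v : l.-tuple A) : 0 <= B -> (forall c, `|b c| <= B) ->
  `|condE m v| <= B.
Proof. by move=> B0 bB; rewrite (@condE_cexp m l (m + l).+1)//; apply: cexp_le. Qed.

(** The squared L2 norm of the conditional expectation: the part of b(x_0) that
    can be predicted from the window [m, m + l). *)
Definition energy m l : R := E (fun x => condE m (win m l x) ^+ 2).

Lemma E_condE_pythagoras m l m' l' : (m <= m')%N -> (m' + l' <= m + l)%N ->
  E (fun x => (condE m (win m l x) - condE m' (win m' l' x)) ^+ 2) =
  energy m l - energy m' l'.
Proof.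
move=> mm' le; set M := (m + l).+1.
have h := leqnSn (m + l); have h' : (m' + l' <= M)%N by exact: leq_trans le h.
rewrite /energy !(@E_law M); last first.
- by move=> x y xy; rewrite !(win_agree xy).
- exact: (@local_win _ m l _ (fun v => condE m v ^+ 2)).
- exact: (@local_win _ m' l' _ (fun v => condE m' v ^+ 2)).
rewrite (@condE_cexp m l M)// (@condE_cexp m' l' M)//.
pose pi (t : l.-tuple A) := subword (a 0%N) (m' - m) l' t.
have piw (w : M.-tuple A) : pi (win m l (pad w)) = win m' l' (pad w).
  by rewrite /pi subword_win ?subnKC//; lia.
have := cexp_pythagoras (law M) (fun w => win m l (pad w)) pi (fun w => b (pad w 0%N)).
rewrite (_ : pi \o _ = (fun w => win m' l' (pad w))); last exact/funext.
move=> key; apply: (etrans (etrans _ key)); first by apply: eq_Ex => w; rewrite piw.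
by congr (_ - _); apply: eq_Ex => w; rewrite piw.
Qed.

Lemma energy_le m l m' l' : (m <= m')%N -> (m' + l' <= m + l)%N -> energy m' l' <= energy m l.
Proof.
move=> mm' le; rewrite -subr_ge0 -E_condE_pythagoras//.
apply: (@E_ge0 (m + l)) => [x y xy|x]; last exact: sqr_ge0.
by rewrite !(win_agree xy).
Qed.

Lemma energy_bound (B : R) m l : 0 <= B -> (forall c, `|b c| <= B) -> energy m l <= B ^+ 2.
Proof.
move=> B0 bB; rewrite -[leRHS]E_cst; apply: (@ler_E (m + l)) => //.
  exact: (@local_win _ m l _ (fun v => condE m v ^+ 2)).
by move=> x; rewrite -ler_sqrt ?sqr_ge0// !sqrtr_sqr (ger0_norm B0) condE_le.
Qed.

(** Conditioning on the window replaces b(x_0) by its conditional expectation;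
    the inequality of Cauchy and Schwarz then gives the L2 norm. *)
Lemma sqr_E_event m l (C : pred (l.-tuple A)) :
  (E (fun x => b (x 0%N) * (C (win m l x))%:R)) ^+ 2 <= energy m l.
Proof.
rewrite (E_tower m (fun v => (C v)%:R)) /energy.
rewrite !(@E_law (m + l)).
- apply: le_trans (sqr_Ex _ _) _; apply: ler_Ex => w.
  by case: (C _); rewrite ?mulr1// mulr0 expr0n/= sqr_ge0.
- exact: (@local_win _ m l _ (fun v => condE m v ^+ 2)).
- exact: (@local_win _ m l _ (fun v => condE m v * (C v)%:R)).
Qed.

(** The conditional expectation keeps its sign on each of the two events condE
    >= 0 and condE < 0, which together recover its L1 norm. *)
Lemma E_abs_condE m l (e : R) :
  (forall C : pred (l.-tuple A), `|E (fun x => b (x 0%N) * (C (win m l x))%:R)| <= e) ->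
  E (fun x => `|condE m (win m l x)|) <= 2 * e.
Proof.
move=> h; pose C (v : l.-tuple A) := 0 <= condE m v.
have := lerD (h C) (h (predC C)); rewrite mulr2n mulrDl mul1r.
apply: le_trans.
rewrite (E_tower m (fun v => (C v)%:R)) (E_tower m (fun v => (predC C v)%:R)).
apply: le_trans (ler_normB _ _); apply: le_trans (ler_norm _).
rewrite -(@EB (m + l)).
- apply: (@ler_E (m + l)).
  + exact: (@local_win _ m l _ (fun v => `|condE m v|)).
  + exact: (@local_win _ m l _ (fun v => condE m v * (C v)%:R - condE m v * (predC C v)%:R)).
  + move=> x; rewrite /C /=; case: (leP 0 (condE m (win m l x))) => t0.
      by rewrite ger0_norm// mulr1 mulr0 subr0.
    by rewrite ltr0_norm// mulr1 mulr0 sub0r.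
- exact: (@local_win _ m l _ (fun v => condE m v * (C v)%:R)).
- exact: (@local_win _ m l _ (fun v => condE m v * (predC C v)%:R)).
Qed.

End ConditionalExpectation.

End Frequencies.

(** * Block entropies and the words of a coding *)

Section WordsComplexity.
Variables (R : realType) (A : finType) (a : nat -> A).
Hypothesis freq : has_frequencies R a.
Local Notation E := (freq_mean a).
Local Notation law := (law freq).

Lemma win_eqP i n (x y : nat -> A) :
  win i n x = win i n y <-> forall j, (i <= j < i + n)%N -> x j = y j.
Proof.
split=> [e j /andP[ij jn]|e].
  have jn' : (j - i < n)%N by lia.
  have := congr1 (fun t => tnth t (Ordinal jn')) e.
  by rewrite !tnth_mktuple/= subnKC.
apply: eq_from_tnth => j; rewrite !tnth_mktuple; apply: e.
by apply/andP; split; [exact: leq_addr|rewrite ltn_add2l].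
Qed.

Definition Prob (B : pred (nat -> A)) : R := E (fun x => (B x)%:R).

Definition Hent (J : finType) (xi : (nat -> A) -> J) : R :=
  \sum_j negxlnx (Prob (fun x => xi x == j)).

Lemma local_comp B C M (g : B -> C) (xi : (nat -> A) -> B) :
  local M xi -> local M (fun x => g (xi x)).
Proof. by move=> l x y /l ->. Qed.

Lemma local_ind M (B : pred (nat -> A)) : local M B -> local M (fun x => (B x)%:R : R).
Proof. by move=> l x y /l ->. Qed.

Lemma Hent_law (J : finType) M (xi : (nat -> A) -> J) : local M xi ->
  Hent xi = entropy (law M) (fun w => xi (pad a w)).
Proof.
move=> l; apply: eq_bigr => j _; congr (negxlnx _); rewrite /Prob (@E_law _ _ _ freq M)//.
exact: (local_comp (fun v => (v == j)%:R) l).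
Qed.

Lemma Hent_suffix (J : finType) M i (xi : (nat -> A) -> J) : local M xi ->
  Hent (fun x => xi (suffix_from i x)) = Hent xi.
Proof.
move=> l; apply: eq_bigr => j _; congr (negxlnx _).
exact: (E_shift freq i (local_comp (fun v => (v == j)%:R) l)).
Qed.

Lemma Prob_ge0 M (B : pred (nat -> A)) : local M B -> 0 <= Prob B.
Proof. by move=> l; apply: (@E_ge0 _ _ _ freq M) => //; exact: local_ind. Qed.

Lemma ler_Prob M (B C : pred (nat -> A)) : local M B -> local M C ->
  (forall x, B x -> C x) -> Prob B <= Prob C.
Proof.
move=> lB lC BC; apply: (@ler_E _ _ _ freq M); [exact: local_ind|exact: local_ind|].
by move=> x; rewrite ler_nat; case: (B x) (BC x) => // ->.
Qed.

Lemma Prob_compl M (B : pred (nat -> A)) : local M B ->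
  Prob (fun x => ~~ B x) = 1 - Prob B.
Proof.
move=> l; rewrite -[X in X - _](E_cst freq 1) -(@EB _ _ _ freq M)//; last exact: local_ind.
by congr E; apply/funext => x; case: (B x); rewrite ?subrr ?subr0.
Qed.

Lemma Prob_union M (B C : pred (nat -> A)) : local M B -> local M C ->
  Prob (fun x => B x || C x) <= Prob B + Prob C.
Proof.
move=> lB lC; rewrite -(@ED _ _ _ freq M); try exact: local_ind.
apply: (@ler_E _ _ _ freq M).
- by move=> x y xy; rewrite (lB _ _ xy) (lC _ _ xy).
- by move=> x y xy; rewrite (lB _ _ xy) (lC _ _ xy).
- by move=> x; rewrite -natrD ler_nat; case: (B x); case: (C x).
Qed.

Lemma Prob_exists M n (B : 'I_n -> pred (nat -> A)) : (forall i, local M (B i)) ->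
  Prob (fun x => [exists i, B i x]) <= \sum_(i < n) Prob (B i).
Proof.
move=> l; rewrite -(@E_sum _ _ _ freq M); last by move=> i _; exact: local_ind.
apply: (@ler_E _ _ _ freq M).
- by move=> x y xy; congr (nat_of_bool _)%:R; apply: eq_existsb => i; exact: l.
- by move=> x y xy; apply: eq_bigr => i _; rewrite (l i _ _ xy).
- move=> x; case: existsP => [[i Bi]|_]; last by rewrite sumr_ge0// => i _; rewrite ler0n.
  by rewrite (bigD1 i)//= Bi ler_wpDr// sumr_ge0// => j _; rewrite ler0n.
Qed.

Lemma Prob_suffix M i (B : pred (nat -> A)) : local M B ->
  Prob (fun x => B (suffix_from i x)) = Prob B.
Proof. by move=> l; rewrite /Prob (E_shift freq i (local_ind l)). Qed.

Lemma local_win0 M i n : (i + n <= M)%N -> local M (@win A i n).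
Proof. by move=> le x y xy; rewrite (win_agree xy). Qed.

Definition Hblock n : R := Hent (@win A 0 n).

Lemma Hent_win i n : Hent (@win A i n) = Hblock n.
Proof.
rewrite /Hblock -(@Hent_suffix _ n i (@win A 0 n) (local_win0 (leqnn n : (0 + n <= n)%N))).
congr Hent.
Qed.

Lemma Hblock_mono n : Hblock n <= Hblock n.+1.
Proof.
rewrite /Hblock !(@Hent_law _ n.+1); try exact: local_win0.
by apply: entropy_det => w w' /win_eqP e; apply/win_eqP => j jn; apply: e; lia.
Qed.

(** Submodularity for the first letter, the last letter and the n letters
    between them, combined with stationarity. *)
Lemma Hblock_concave n : Hblock n.+2 + Hblock n <= Hblock n.+1 + Hblock n.+1.
Proof.
rewrite -{1}(Hent_win 1 n) -{1}(Hent_win 0 n.+1) -{1}(Hent_win 1 n.+1) /Hblock.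
rewrite !(@Hent_law _ n.+2); try (apply: local_win0; lia).
have := entropy_submod (law n.+2) (fun w => win 0 1 (pad a w))
  (fun w => win n.+1 1 (pad a w)) (fun w => win 1 n (pad a w)).
rewrite (@eq_entropy_det _ _ _ _ _ (fun w => win 0 n.+2 (pad a w))
  (fun w => (win 0 1 (pad a w), win n.+1 1 (pad a w), win 1 n (pad a w)))); last first.
  move=> w w' /=; split=> [/win_eqP e|/pair_equal_spec[/pair_equal_spec[/win_eqP e1 /win_eqP e2] /win_eqP e3]].
    by congr (_, _, _); apply/win_eqP => j jn; apply: e; lia.
  apply/win_eqP => j jn; have [->|j0] := eqVneq j 0%N; first by apply: e1; lia.
  by have [->|jn1] := eqVneq j n.+1; [apply: e2; lia|apply: e3; lia].
rewrite (@eq_entropy_det _ _ _ _ _ (fun w => win 0 n.+1 (pad a w))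
  (fun w => (win 0 1 (pad a w), win 1 n (pad a w)))); last first.
  move=> w w' /=; split=> [/win_eqP e|/pair_equal_spec[/win_eqP e1 /win_eqP e3]].
    by congr (_, _); apply/win_eqP => j jn; apply: e; lia.
  apply/win_eqP => j jn; have [->|j0] := eqVneq j 0%N; first by apply: e1; lia.
  by apply: e3; lia.
rewrite (@eq_entropy_det _ _ _ _ _ (fun w => win 1 n.+1 (pad a w)) (fun w => (win n.+1 1 (pad a w), win 1 n (pad a w))))//.
move=> w w' /=; split=> [/win_eqP e|/pair_equal_spec[/win_eqP e1 /win_eqP e3]].
  by congr (_, _); apply/win_eqP => j jn; apply: e; lia.
apply/win_eqP => j jn.
by have [->|jn1] := eqVneq j n.+1; [apply: e1; lia|apply: e3; lia].
Qed.

Definition Hincr n := Hblock n.+1 - Hblock n.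

(** The increments of the block entropies decrease by concavity, so this
    infimum is their limit. *)
Definition Hrate := inf [set Hincr n | n in [set: nat]].

Lemma Hincr_ge0 n : 0 <= Hincr n.
Proof. by rewrite subr_ge0 Hblock_mono. Qed.

Lemma Hincr_le m n : (m <= n)%N -> Hincr n <= Hincr m.
Proof.
elim: n => [|n IH]; first by rewrite leqn0 => /eqP ->.
rewrite leq_eqVlt => /predU1P[->//|/IH]; apply: le_trans.
have := Hblock_concave n; rewrite /Hincr; lra.
Qed.

Lemma Hrate_has_inf : has_inf [set Hincr n | n in [set: nat]].
Proof.
split; first by exists (Hincr 0), 0%N.
by exists 0 => _ [n _ <-]; exact: Hincr_ge0.
Qed.

Lemma Hrate_le n : Hrate <= Hincr n.
Proof. by apply: ge_inf; [case: Hrate_has_inf|exists n]. Qed.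

Lemma Hblock_lower W Q : Hblock Q + W%:R * Hrate <= Hblock (Q + W).
Proof.
elim: W => [|W IH]; first by rewrite mul0r addr0 addn0.
have := Hrate_le (Q + W); rewrite /Hincr addnS -nat1r mulrDl mul1r; lra.
Qed.

Lemma Hblock_upper (e : R) : 0 < e ->
  exists B, forall W, Hblock W <= B + W%:R * (Hrate + e).
Proof.
move=> e0; have [_ [n0 _ <-] h0] := inf_adherent e0 Hrate_has_inf.
exists (Hblock n0) => W; have [Wn0|n0W] := leqP W n0.
  have : Hblock W <= Hblock n0.
    rewrite -(subnKC Wn0); elim: (n0 - W)%N => [|k IH]; first by rewrite addn0.
    by rewrite addnS; apply: le_trans IH (Hblock_mono _).
  have r0 : 0 <= Hrate by apply: lb_le_inf => [|_ [n _ <-]]; [by exists (Hincr 0), 0%N|exact: Hincr_ge0].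
  have : 0 <= W%:R * (Hrate + e) by rewrite mulr_ge0 ?ler0n//; lra.
  lra.
have : Hblock (n0 + (W - n0)) <= Hblock n0 + (W - n0)%:R * (Hrate + e).
  elim: (W - n0)%N => [|k IH]; first by rewrite addn0 mul0r addr0.
  have := Hincr_le (leq_addr k n0); rewrite /Hincr addnS -nat1r mulrDl mul1r.
  have : Hincr n0 < Hrate + e by [].
  rewrite /Hincr; lra.
rewrite subnKC ?(ltnW n0W)// => h; apply: le_trans h _; rewrite lerD2l ler_wpM2r ?ler_nat ?leq_subr//.
have := Hincr_ge0 n0; rewrite -/Hrate in h0; lra.
Qed.

End WordsComplexity.

Section FewWords.
Variables (R : realType) (A : finType) (a : nat -> A).
Hypothesis freq : has_frequencies R a.
Local Notation E := (freq_mean a).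
Local Notation law := (law freq).
Local Notation Prob := (@Prob R A a).
Local Notation Hent := (@Hent R A a).
Local Notation Hblock := (@Hblock R A a).
Local Notation Hrate := (@Hrate R A a).

Variables (V : finType) (m_ l_ : nat -> nat) (col : forall k, (l_ k).-tuple A -> V).

(** When m_ k tends to infinity and the codings form a Cauchy sequence in
    probability, they stand for a variable measurable with respect to the tail
    of the process. *)
Definition coding k (x : nat -> A) : V := col (win (m_ k) (l_ k) x).

Definition cword k W (x : nat -> A) : W.-tuple V := [tuple coding k (suffix_from i x) | i < W].

Hypothesis far : forall W, exists K, forall k, (K <= k)%N -> (W <= m_ k)%N.
Hypothesis cauchy : forall e : R, 0 < e -> exists K, forall k k', (K <= k)%N -> (K <= k')%N ->
  Prob (fun x => coding k x != coding k' x) <= e.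

Lemma local_coding k : local (m_ k + l_ k) (coding k).
Proof. exact: (@local_win _ _ _ _ _ (@col k)). Qed.

Lemma local_coding_suffix k i M : (i + (m_ k + l_ k) <= M)%N ->
  local M (fun x => coding k (suffix_from i x)).
Proof. by move=> le; apply: local_le le _; apply: local_suffix; exact: local_coding. Qed.

Lemma local_cword k W : local (W + (m_ k + l_ k)) (@cword k W).
Proof.
move=> x y xy; apply: eq_from_tnth => i; rewrite !tnth_mktuple.
by apply: (@local_coding_suffix k i (W + (m_ k + l_ k))) => //; rewrite leq_add2r ltnW.
Qed.

(** Together with v', this determines v; its entropy is small when v = v' with
    high probability. *)
Definition discrepancy (v v' : V) : option V := if v == v' then None else Some v.

Lemma Hent_discrepancy k k' (p : R) :
  Prob (fun x => coding k x != coding k' x) <= p ->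
  Hent (fun x => discrepancy (coding k x) (coding k' x)) <= p + #|V|%:R * (2 * Num.sqrt p).
Proof.
set M := (m_ k + l_ k + (m_ k' + l_ k'))%N.
have lk : local M (coding k) by refine (local_le _ (@local_coding k)); rewrite /M; lia.
have lk' : local M (coding k') by refine (local_le _ (@local_coding k')); rewrite /M; lia.
have ld v : local M (fun x => discrepancy (coding k x) (coding k' x) == v).
  by move=> x y xy; rewrite (lk _ _ xy) (lk' _ _ xy).
have lne : local M (fun x => coding k x != coding k' x).
  by move=> x y xy; rewrite (lk _ _ xy) (lk' _ _ xy).
move=> hp; rewrite /Hent.
have p0 : 0 <= p by apply: le_trans hp; exact: (Prob_ge0 freq lne).
rewrite (bigD1 None)//= lerD//.
  apply: le_trans (negxlnx_le (Prob_ge0 freq (ld _))) _.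
  rewrite -(Prob_compl freq (ld None)); apply: le_trans hp; apply: (@ler_Prob _ _ _ freq M).
  - exact: local_comp (ld None).
  - exact: lne.
  - by move=> x; apply: contraNN => /eqP ->; rewrite /discrepancy eqxx.
rewrite (le_trans (ler_sum (G := fun=> 2 * Num.sqrt p) _ _))//.
  case=> // v _; apply: le_trans (negxlnx_sqrt (Prob_ge0 freq (ld _))) _.
  rewrite ler_pM2l//; apply: ler_wsqrtr; apply: le_trans hp; apply: (@ler_Prob _ _ _ freq M); [exact: ld|exact: lne|].
  by move=> x; apply: contraTN => /eqP ->; rewrite /discrepancy eqxx.
rewrite sumr_const -[leLHS]mulr_natl ler_wpM2r ?mulr_ge0 ?sqrtr_ge0// ler_nat.
rewrite -[leqRHS]/(#|V|.+1.-1) -card_option -(cardC1 (None : option V)).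
by apply/eq_leq/eq_card => v; rewrite !inE.
Qed.

Lemma Hent_le_card (J : finType) M (xi : (nat -> A) -> J) : local M xi -> Hent xi <= #|J|%:R.
Proof. by move=> l; rewrite (Hent_law freq l); exact: entropy_le_card. Qed.

(** A finite form of the fact that the tail of a process has zero entropy. Let
    P be the block [0, W), F the future after W and w the word of W letters of
    the coding k. As W <= m_ k, the word w is a function of F, and
    submodularity gives H(w) <= H(P, w) - H(P | F), where H(P | F) >= W *
    Hrate. On the other side, the coding k0 reads windows of bounded length,
    most of which lie in P, so P determines w up to one discrepancy per letter:
    H(P, w) <= H(P) + W * e, plus a boundary term that does not depend on W. *)
Lemma Hent_cword k k0 W (e : R) : (W <= m_ k)%N ->
  Hent (fun x => discrepancy (coding k x) (coding k0 x)) <= e ->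
  Hent (@cword k W) <= Hblock W - W%:R * Hrate + W%:R * e + ((m_ k0 + l_ k0) * #|V|.+1)%:R.
Proof.
move=> Wk he; pose d0 := (m_ k0 + l_ k0)%N; set Q := (m_ k + l_ k - W + W)%N.
pose M := (W + (m_ k + l_ k) + (W + d0))%N.
have lc : local M (@cword k W) by refine (local_le _ (local_cword (k := k) (W := W))); rewrite /M; lia.
(* Where the window of the coding k0 leaves the block, the letter of the coding
   k is recorded instead of a discrepancy. *)
pose D (i : nat) (x : nat -> A) := if (i + d0 <= W)%N
  then discrepancy (coding k (suffix_from i x)) (coding k0 (suffix_from i x))
  else Some (coding k (suffix_from i x)).
have lD i : (i < W)%N -> local M (D i).
  move=> iW x y xy; rewrite /D; case: ifP => h.
    rewrite (local_coding_suffix (k := k) (i := i) (M := M) _ xy); last by rewrite /M; lia.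
    by rewrite (local_coding_suffix (k := k0) (i := i) (M := M) _ xy)// /M -/d0; lia.
  by rewrite (local_coding_suffix (k := k) (i := i) (M := M) _ xy)// /M; lia.
(* The part of the future after W that the word of the coding k reads. *)
pose F := @win A W Q.
have := entropy_submod (law M) (fun w => win 0 W (pad a w)) (fun w => F (pad a w))
  (fun w => @cword k W (pad a w)).
have detF x y : F x = F y -> @cword k W x = @cword k W y.
  move=> /win_eqP ea; apply: eq_from_tnth => i; rewrite !tnth_mktuple /coding.
  congr (col _); apply/win_eqP => j jm; rewrite /suffix_from; apply: ea.
  by have := ltn_ord i; rewrite /Q; lia.
rewrite (@eq_entropy_det _ _ _ _ _ (fun w => win 0 (Q + W) (pad a w))
  (fun w => (win 0 W (pad a w), F (pad a w), cword k W (pad a w)))); last first.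
  move=> w w' /=; split=> [/win_eqP ea|/pair_equal_spec[/pair_equal_spec[/win_eqP e1 /win_eqP e3] _]].
    have eF : F (pad a w) = F (pad a w') by apply/win_eqP => j jn; apply: ea; lia.
    by congr (_, _, _) => //; [apply/win_eqP => j jn; apply: ea; lia|exact: detF].
  apply/win_eqP => j jn; have [jW|jW] := ltnP j W; [by apply: e1; lia|by apply: e3; lia].
rewrite (@eq_entropy_det _ _ _ _ _ (fun w => F (pad a w)) (fun w => (F (pad a w), cword k W (pad a w)))); last first.
  by move=> w w' /=; split=> [ea|/pair_equal_spec[//]]; congr (_, _) => //; exact: detF.
rewrite -!(Hent_law freq (M := M)); try (apply: local_win0; rewrite /M /Q /=; lia); try exact: lc.
- rewrite (Hent_win freq 0) (Hent_win freq W) => hsub.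
  have hl := Hblock_lower freq W Q.
  have : entropy (law M) (fun w => (win 0 W (pad a w), cword k W (pad a w))) <=
    Hblock W + \sum_(i < W) entropy (law M) (fun w => D i (pad a w)).
    rewrite /Hblock (@Hent_law _ _ _ freq _ M); last by apply: local_win0; rewrite /M; lia.
    rewrite -lerBlDl; apply: le_trans (entropy_tuple_le _ (fun i w => D i (pad a w)) W).
    rewrite lerBlDl; apply: le_trans (entropy_pair_le _ _ _); apply: entropy_det => w w' /pair_equal_spec[/win_eqP e1 e2].
    congr (_, _); first exact/win_eqP.
    apply: eq_from_tnth => i; rewrite !tnth_mktuple.
    have := congr1 (fun t => tnth t i) e2.
    rewrite !tnth_mktuple /D; case: ifP => h; last by case.
    have -> : coding k0 (suffix_from i (pad a w)) = coding k0 (suffix_from i (pad a w')).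
      by apply: local_coding => j jd; apply: e1; move: h jd; rewrite /d0; lia.
    rewrite /discrepancy; case: eqP => [->|_]; case: eqP => [->|_]//; by case.
  have : \sum_(i < W) entropy (law M) (fun w => D i (pad a w)) <= W%:R * e + (d0 * #|V|.+1)%:R.
    have e0 : 0 <= e.
      apply: le_trans he; rewrite (Hent_law freq (M := M)); first exact: entropy_ge0.
      move=> x y xy; have := @local_coding_suffix k 0 M; rewrite /M => h.
      rewrite (@local_coding k x y); last by apply: agree_le xy; rewrite /M; lia.
      by rewrite (@local_coding k0 x y)//; apply: agree_le xy; rewrite /M; lia.
    rewrite (le_trans (ler_sum (G := fun i : 'I_W => e + (if (i + d0 <= W)%N then 0 else #|V|.+1%:R)) _ _))//.
      move=> i _; rewrite -(Hent_law freq (lD i (ltn_ord i))) /D.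
      case: ifP => h; last first.
        rewrite -[leLHS]add0r lerD// -card_option; apply: (@Hent_le_card _ M).
        by apply: local_comp; apply: local_coding_suffix; have := ltn_ord i; rewrite /M; lia.
      rewrite addr0; apply: le_trans he.
      rewrite -(@Hent_suffix _ _ _ freq _ M i (fun x => discrepancy (coding k x) (coding k0 x)))//.
      move=> x y xy; rewrite (@local_coding k x y); last by apply: agree_le xy; rewrite /M; lia.
      by rewrite (@local_coding k0 x y)//; apply: agree_le xy; rewrite /M; lia.
    rewrite big_split/= sumr_const card_ord -[e *+ W]mulr_natl lerD2l.
    rewrite (eq_bigr (fun i : 'I_W => ((W < i + d0)%N * #|V|.+1)%:R)); last first.
      by move=> i _; rewrite ltnNge; case: (_ <= _)%N; rewrite ?mul1n ?mul0n.
    rewrite -natr_sum ler_nat -big_distrl/= leq_mul2r; apply/orP; right.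
    suff h n : (\sum_(i < n) (W < i + d0) <= n + d0 - W)%N by have := h W; rewrite addKn.
    elim: n => [|n IH]; first by rewrite big_ord0.
    rewrite big_ord_recr; apply: leq_trans (leq_add IH (leqnn _)) _ => /=.
    by case En : (W < n + d0)%N; move: En; lia.
  rewrite -/d0; lra.
Qed.

(** Fix one coding K with W <= m_ K: the entropy of its words is at most a
    small multiple of W, since Hblock W is close to W * Hrate. The words of
    probability at least exp (- d W) are at most exp (d W) in number and carry
    all but eta / 2 of the mass; for k >= K, the words of the codings k and K
    differ with probability at most eta / 2. *)
Theorem few_words (d eta : R) : 0 < d -> 0 < eta ->
  exists W1, forall W, (W1 <= W)%N -> exists P : pred (W.-tuple V),
    #|P|%:R <= expR (d * W%:R) /\
    exists K, forall k, (K <= k)%N -> Prob (fun x => ~~ P (@cword k W x)) <= eta.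
Proof.
(* With this choice, an entropy of 3 e W divided by d W is eta / 2 in the
   Markov inequality. *)
move=> d0 eta0; pose e := d * eta / 6; have e0 : 0 < e by rewrite divr_gt0// mulr_gt0.
pose s := Num.min 1 (e / (1 + 2 * #|V|%:R)).
have V0 : 0 <= #|V|%:R :> R by rewrite ler0n.
have D0 : 0 < 1 + 2 * #|V|%:R :> R by rewrite ltr_pwDl// mulr_ge0.
have s0 : 0 < s by rewrite lt_min ltr01 divr_gt0.
have s1 : s <= 1 by rewrite ge_min lexx.
have se : s * (1 + 2 * #|V|%:R) <= e by rewrite -ler_pdivlMr// ge_min lexx orbT.
have [k0 hk0] := cauchy (exprn_gt0 2 s0).
pose D := (((m_ k0 + l_ k0) * #|V|.+1)%:R : R).
have [B hB] := Hblock_upper freq e0.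
have [W1 hW1] : exists W1 : nat, (B + D) / e <= W1%:R.
  by have [n _ h] := nbhs_infty_ger ((B + D) / e); exists n; exact: h (leqnn n).
exists W1.+1 => W W1W; have W0 : (0 < W)%N by exact: leq_trans W1W.
have WR : 0 < W%:R :> R by rewrite ltr0n.
have [K1 hK1] := far W.
have tol0 : 0 < eta / 2 / W%:R by rewrite !divr_gt0.
have [K2 hK2] := cauchy tol0.
pose K := maxn (maxn K1 K2) k0.
have [K1K K2K k0K] : [/\ K1 <= K, K2 <= K & k0 <= K]%N by rewrite /K !leq_max !leqnn !orbT.
have HK : Hent (@cword K W) <= 3 * e * W%:R.
  have := @Hent_cword K k0 W e; rewrite -/D.
  have -> : (W <= m_ K)%N by exact: hK1.
  have he : Hent (fun x => discrepancy (coding K x) (coding k0 x)) <= e.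
    apply: le_trans (Hent_discrepancy (hk0 K k0 _ _)) _ => //.
    rewrite sqrtr_sqr (ger0_norm (ltW s0)); apply: le_trans se.
    have : s ^+ 2 <= s by rewrite expr2 ler_piMl ?(ltW s0).
    lra.
  move=> /(_ isT he).
  have : B + D <= e * W%:R.
    rewrite mulrC -ler_pdivrMr//; apply: le_trans hW1 _; by rewrite ler_nat ltnW.
  have := hB W; lra.
pose M := (W + (m_ K + l_ K))%N.
have lc : local M (@cword K W) by exact: local_cword.
pose P := [pred v : W.-tuple V | expR (- (d * W%:R)) <= Prob (fun x => @cword K W x == v)].
exists P; split.
  have PE v : Prob (fun x => @cword K W x == v) = pmf (law M) (fun w => @cword K W (pad a w)) v.
    rewrite /Prob (@E_law _ _ _ freq M)// => x y xy; by rewrite (lc _ _ xy).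
  have := card_large_pmf (law M) (fun w => @cword K W (pad a w)) (expR_gt0 (- (d * W%:R))).
  rewrite expRN invrK; apply: le_trans; rewrite ler_nat; apply/eq_leq/eq_card => v.
  by rewrite !unfold_in /= -PE expRN.
exists K => k Kk.
have hdiff : Prob (fun x => @cword k W x != @cword K W x) <= eta / 2.
  pose M' := (W + (m_ K + l_ K + (m_ k + l_ k)))%N.
  have ldi (i : 'I_W) : local M' (fun x => coding k (suffix_from i x) != coding K (suffix_from i x)).
    move=> x y xy; have := ltn_ord i => iW.
    rewrite (local_coding_suffix (k := k) (i := i) (M := M') _ xy); last by rewrite /M'; clear -iW; lia.
    by rewrite (local_coding_suffix (k := K) (i := i) (M := M') _ xy)// /M'; clear -iW; lia.
  apply: (@le_trans _ _ (Prob (fun x => [exists i : 'I_W, coding k (suffix_from i x) != coding K (suffix_from i x)]))).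
    apply: (@ler_Prob _ _ _ freq M').
    - move=> x y xy; have lck : local M' (@cword k W).
        by refine (local_le _ (@local_cword k W)); rewrite /M'; clear; lia.
      have lcK : local M' (@cword K W).
        by refine (local_le _ (@local_cword K W)); rewrite /M'; clear; lia.
      by rewrite (lck _ _ xy) (lcK _ _ xy).
    - by move=> x y xy; apply: eq_existsb => i; exact: ldi.
    - move=> x; apply: contraNT => /existsPn h; apply/eqP/eq_from_tnth => i.
      by rewrite !tnth_mktuple; apply/eqP; have := h i; rewrite negbK.
  apply: le_trans (Prob_exists freq ldi) _.
  rewrite (le_trans (ler_sum (G := fun=> eta / 2 / W%:R) _ _))//.
    move=> i _; rewrite (@Prob_suffix _ _ _ freq (m_ K + l_ K + (m_ k + l_ k)) i (fun x => coding k x != coding K x)).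
      by apply: hK2 => //; exact: leq_trans Kk.
    move=> x y xy; rewrite (@local_coding k x y); last by apply: agree_le xy; clear; lia.
    by rewrite (@local_coding K x y)//; apply: agree_le xy; clear; lia.
  by rewrite sumr_const card_ord -[leLHS]mulr_natr divfK// gt_eqF.
have hP : Prob (fun x => ~~ P (@cword K W x)) <= eta / 2.
  have -> : Prob (fun x => ~~ P (@cword K W x)) =
      Pr (law M) (fun w => pmf (law M) (fun w => @cword K W (pad a w)) (cword K W (pad a w)) < expR (- (d * W%:R))).
    rewrite /Prob (@E_law _ _ _ freq M); last by move=> x y xy; rewrite (lc _ _ xy).
    apply: eq_Ex => w; rewrite /P /= ltNge; congr (nat_of_bool (~~ (_ <= _)))%:R.
    rewrite /Prob (@E_law _ _ _ freq M)// => x y xy; by rewrite (lc _ _ xy).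
  apply: le_trans (mass_small_pmf _ _ _) _; first by rewrite mulr_gt0.
  rewrite -(Hent_law freq lc) ler_pdivrMr ?mulr_gt0//; apply: le_trans HK _.
  by rewrite /e; lra.
pose M' := (W + (m_ K + l_ K + (m_ k + l_ k)))%N.
have lck : local M' (@cword k W).
  by refine (local_le _ (@local_cword k W)); rewrite /M'; clear; lia.
have lcK : local M' (@cword K W).
  by refine (local_le _ (@local_cword K W)); rewrite /M'; clear; lia.
apply: (@le_trans _ _ (Prob (fun x => (@cword k W x != @cword K W x) || ~~ P (@cword K W x)))).
  apply: (@ler_Prob _ _ _ freq M').
  - by move=> x y xy; rewrite (lck _ _ xy).
  - by move=> x y xy; rewrite (lck _ _ xy) (lcK _ _ xy).
  - by move=> x; have [->|] := eqVneq (cword k W x) (cword K W x).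
apply: le_trans (Prob_union (M := M') freq _ _) _.
- by move=> x y xy; rewrite (lck _ _ xy) (lcK _ _ xy).
- by move=> x y xy; rewrite (lcK _ _ xy).
- by rewrite [leRHS]splitr lerD.
Qed.

End FewWords.

(** * Codings extracted from conditional expectations *)

Section Threshold.
Variables (R : realType) (A : finType) (a : nat -> A).
Hypothesis freq : has_frequencies R a.
Local Notation E := (freq_mean a).
Local Notation Prob := (@Prob R A a).

Variables (h : nat -> (nat -> A) -> R) (d : nat -> nat).
Hypothesis local_h : forall k, local (d k) (h k).
Hypothesis cauchy_h : forall e s : R, 0 < e -> 0 < s -> exists K, forall k k',
  (K <= k)%N -> (K <= k')%N -> Prob (fun x => s <= `|h k x - h k' x|) <= e.

(** At such a level t, thresholding two terms h k and h k' that are s-close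
    gives different results with probability at most e. *)
Definition thin (e : R) : set R := [set t | exists s : R, 0 < s /\ exists K, forall k,
  (K <= k)%N -> Prob (fun x => `| `|h k x| - t| < s) <= e].

Lemma local_near k t s : local (d k) (fun x => `| `|h k x| - t| < s).
Proof. by move=> x y xy; rewrite (local_h xy). Qed.

Lemma open_thin e : open (thin e).
Proof.
rewrite openE => t [s [s0 [K hK]]]; rewrite /interior /=; apply/nbhs_ballP.
exists (s / 2); first by rewrite /= divr_gt0.
move=> t'; rewrite /ball /= => tt'; exists (s / 2); split; first by rewrite divr_gt0.
exists K => k Kk; apply: le_trans (hK k Kk).
apply: (@ler_Prob _ _ _ freq (d k)); [exact: local_near|exact: local_near|].
move=> x; rewrite !ltr_norml in tt' *; lra.
Qed.

(** Among more than 2 / e disjoint intervals around equally spaced levels, one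
    has mass at most e / 2 for some `|h K|, and h k is close to h K in
    probability for large k. *)
Lemma dense_thin e : 0 < e -> dense (thin e).
Proof.
move=> e0 O [c Oc] oO.
have /nbhs_ballP[r /= r0 rO] : nbhs c O by apply: open_nbhs_nbhs.
have [n _ hn] := nbhs_infty_ger (2 / e); pose m := n.+1.
have m0 : 0 < m%:R :> R by rewrite ltr0n.
have hm : 2 / e <= m%:R by apply: hn => /=; exact: leqnSn.
pose w := r / m%:R; have w0 : 0 < w by rewrite divr_gt0.
pose t (i : 'I_m) := c + i%:R * w.
have tO i : O (t i).
  apply: rO; rewrite /ball /= /t opprD addrA subrr sub0r normrN ger0_norm; last first.
    by rewrite mulr_ge0 ?ler0n// ltW.
  by rewrite /w mulrA ltr_pdivrMr// mulrC ltr_pM2l// ltr_nat.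
pose s := w / 4; have s0 : 0 < s by rewrite divr_gt0.
have e2 : 0 < e / 2 by rewrite divr_gt0.
have [K hK] := cauchy_h e2 s0.
have sum1 : \sum_i Prob (fun x => `| `|h K x| - t i| < 2 * s) <= 1.
  rewrite -(@E_sum _ _ _ freq (d K)); last by move=> i _; apply: local_ind; exact: local_near.
  rewrite -[leRHS](E_cst freq); apply: (@ler_E _ _ _ freq (d K)) => //.
    by move=> x y xy; apply: eq_bigr => i _; rewrite (local_h xy).
  move=> x; rewrite -natr_sum lern1.
  case: (pickP (fun i : 'I_m => `| `|h K x| - t i| < 2 * s)) => [i0 hi0|none]; last first.
    by rewrite big1// => i _; rewrite none.
  rewrite (bigD1 i0)//= hi0 big1// => i ii0; apply/eqP; rewrite eqb0; apply/negP => hi.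
  move: hi0 hi; rewrite !ltr_norml /t /s => hi0 hi.
  have : `|(i0%:R - i%:R) * w| < w by rewrite ltr_norml; lra.
  rewrite normrM (gtr0_norm w0) gtr_pMl//.
  have [lt|gt|/val_inj ei] := ssrnat.ltngtP i0 i; last by rewrite ei eqxx in ii0.
    by rewrite distrC -natrB ?(ltnW lt)// ger0_norm ?ler0n// ltrn1 ltnS leqn0 subn_eq0 leqNgt lt.
  by rewrite -natrB ?(ltnW gt)// ger0_norm ?ler0n// ltrn1 ltnS leqn0 subn_eq0 leqNgt gt.
have [i hi] : exists i, Prob (fun x => `| `|h K x| - t i| < 2 * s) <= e / 2.
  apply/existsP; rewrite -[X in is_true X]negbK negb_exists; apply/negP => /forallP hall.
  have : \sum_(i < m) (e / 2) < \sum_i Prob (fun x => `| `|h K x| - t i| < 2 * s).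
    apply: ltr_sum => [|i _]; last by rewrite ltNge hall.
    by apply/hasP; exists ord0 => //; rewrite mem_index_enum.
  rewrite sumr_const card_ord -[ltLHS]mulr_natl => hlt.
  move: hm; rewrite ler_pdivrMr// => hm; lra.
exists (t i); split => //; exists s; split => //; exists K => k Kk.
pose M := (d k + d K)%N.
have lk : local M (h k) by apply: local_le (@local_h k); rewrite leq_addr.
have lK : local M (h K) by apply: local_le (@local_h K); rewrite leq_addl.
apply: (@le_trans _ _ (Prob (fun x => (`| `|h K x| - t i| < 2 * s) || (s <= `|h k x - h K x|)))).
  apply: (@ler_Prob _ _ _ freq M).
  - by move=> x y xy; rewrite (lk _ _ xy).
  - by move=> x y xy; rewrite (lk _ _ xy) (lK _ _ xy).
  - move=> x; have [//|hs] := leP s (`|h k x - h K x|); first by rewrite orbT.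
    rewrite orbF => hk.
    have := le_lt_trans (ler_dist_dist (h k x) (h K x)) hs.
    rewrite !ltr_norml in hk *; lra.
apply: le_trans (Prob_union (M := M) freq _ _) _.
- by move=> x y xy; rewrite (lK _ _ xy).
- by move=> x y xy; rewrite (lk _ _ xy) (lK _ _ xy).
- by rewrite [leRHS]splitr lerD// hK.
Qed.

(** The limit law of `|h k| has few atoms; a level that is not an atom is found
    as a common point of countably many dense open sets. *)
Lemma exists_threshold (c : R) : 0 < c ->
  exists t : R, 0 < t < c /\ forall e : R, 0 < e -> thin e t.
Proof.
move=> c0; pose F (n : nat) := thin n.+1%:R^-1.
have : dense (\bigcap_i F i).
  apply: (@Baire R R^o) => i; split; first exact: open_thin.
  by apply: dense_thin; rewrite invr_gt0.
move=> /(_ [set` `]0, c[]) [].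
- by exists (c / 2); rewrite /= in_itv/=; lra.
- exact: interval_open.
move=> t [/=]; rewrite in_itv/= => tc tF; exists t; split => // e e0.
have [n _ hn] := nbhs_infty_ger (e^-1).
have [s [s0 [K hK]]] := tF n Logic.I.
exists s; split => //; exists K => k Kk; apply: le_trans (hK k Kk) _.
by rewrite -[leRHS]invrK lef_pV2 ?posrE ?invr_gt0//; apply: hn => /=.
Qed.

End Threshold.

Section ConvergentCodings.
Variables (R : realType) (A : finType) (a : nat -> A).
Hypothesis freq : has_frequencies R a.
Local Notation E := (freq_mean a).
Local Notation Prob := (@Prob R A a).
Variables (b : A -> R) (B : R).
Hypothesis B0 : 0 < B.
Hypothesis bB : forall c, `|b c| <= B.
Local Notation energy := (@energy R A a b).
Local Notation condE := (@condE R A a b).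

Variable e0 : R.
Hypothesis e0_gt0 : 0 < e0.
Hypothesis energy_large : forall m, exists l, e0 <= energy m l.

Definition energy_sup m := sup [set energy m l | l in [set: nat]].

Lemma energy_has_sup m : has_sup [set energy m l | l in [set: nat]].
Proof.
split; first by exists (energy m 0), 0%N.
by exists (B ^+ 2) => _ [l _ <-]; exact: (energy_bound freq _ _ (ltW B0)).
Qed.

Lemma energy_le_sup m l : energy m l <= energy_sup m.
Proof. by apply: ub_le_sup; [case: (energy_has_sup m)|exists l]. Qed.

Lemma e0_le_energy_sup m : e0 <= energy_sup m.
Proof. by have [l h] := energy_large m; apply: le_trans h (energy_le_sup m l). Qed.

Lemma energy_sup_le m n : (m <= n)%N -> energy_sup n <= energy_sup m.
Proof.
move=> mn; apply: ge_sup; first by case: (energy_has_sup n).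
move=> _ [l _ <-]; apply: le_trans (energy_le_sup m (n + l)).
by apply: energy_le => //; rewrite leq_addl.
Qed.

(** Energies increase with the window, so their supremum over the windows that
    start at m decreases in m; the limit is the energy of b(x_0) given the
    tail. *)
Definition energy_lim := inf [set energy_sup m | m in [set: nat]].

Lemma energy_sup_has_inf : has_inf [set energy_sup m | m in [set: nat]].
Proof.
split; first by exists (energy_sup 0), 0%N.
by exists e0 => _ [n _ <-]; exact: e0_le_energy_sup.
Qed.

Lemma energy_lim_le m : energy_lim <= energy_sup m.
Proof. by apply: ge_inf; [case: energy_sup_has_inf|exists m]. Qed.

Lemma e0_le_energy_lim : e0 <= energy_lim.
Proof. by apply: lb_le_inf => [|_ [n _ <-]]; [case: energy_sup_has_inf|exact: e0_le_energy_sup]. Qed.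

Lemma exists_lengths : exists l_ : nat -> nat,
  forall k, energy_sup k - energy_lim / 2 / k.+1%:R < energy k (l_ k).
Proof.
have h k : exists l, energy_sup k - energy_lim / 2 / k.+1%:R < energy k l.
  have p : 0 < energy_lim / 2 / k.+1%:R.
    by rewrite !divr_gt0//; apply: lt_le_trans e0_gt0 e0_le_energy_lim.
  by have [_ [l _ <-] hl] := sup_adherent p (energy_has_sup k); exists l.
by have [f hf] := boolp.choice h; exists f.
Qed.

(** Codings use three letters: None stands for 0 and Some for a sign. *)
Definition sgn_val (v : option bool) : R :=
  if v is Some s then (if s then 1 else -1) else 0.

Definition thresh (t h : R) : option bool :=
  if t < h then Some true else if h < - t then Some false else None.

Lemma thresh_stable t s h h' : 0 < t -> s <= `| `|h| - t| -> `|h - h'| < s ->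
  thresh t h = thresh t h'.
Proof.
move=> t0; rewrite ltr_norml /thresh.
have [h0|h0] := leP 0 h.
  have [th|th] := leP t h; rewrite ?(ger0_norm h0).
    rewrite ger0_norm ?subr_ge0// => h1 /andP[h2 h3].
    have -> : t < h by lra.
    by have -> : t < h' by lra.
  rewrite ltr0_norm ?subr_lt0// => h1 /andP[h2 h3].
  have -> : (t < h) = false by lra.
  have -> : (h < - t) = false by lra.
  have -> : (t < h') = false by lra.
  by have -> : (h' < - t) = false by lra.
rewrite (ltr0_norm h0); have [th|th] := leP t (- h).
  rewrite ger0_norm ?subr_ge0// => h1 /andP[h2 h3].
  have -> : (t < h) = false by lra.
  have -> : (h < - t) = true by lra.
  have -> : (t < h') = false by lra.
  by have -> : (h' < - t) = true by lra.
rewrite ltr0_norm ?subr_lt0// => h1 /andP[h2 h3].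
have -> : (t < h) = false by lra.
have -> : (h < - t) = false by lra.
have -> : (t < h') = false by lra.
by have -> : (h' < - t) = false by lra.
Qed.

(** Above the threshold, B `|h| >= h ^ 2; below it, h ^ 2 - t ^ 2 is
    nonpositive. *)
Lemma thresh_gain t h : 0 < t -> `|h| <= B -> h ^+ 2 - t ^+ 2 <= B * (h * sgn_val (thresh t h)).
Proof.
move=> t0; rewrite ler_norml /thresh => /andP[hB1 hB2].
have [h1|h1] := ltP t h; rewrite /=; first by nra.
by have [h2|h2] := ltP h (- t); rewrite /=; nra.
Qed.

(** On windows [k, k + l_ k) of nearly maximal energy, the conditional
    expectations h k form a Cauchy sequence in L2: both h k and h k' are, by
    Pythagoras, close to the conditional expectation on one window containing
    the two. Taking signs above a threshold that is not an atom of the limit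
    keeps this property in probability, and a threshold below half the tail
    norm keeps a positive correlation with b(x_0). *)
Theorem exists_codings : exists (l_ : nat -> nat) (col : forall k, (l_ k).-tuple A -> option bool),
  (forall e : R, 0 < e -> exists K, forall k k', (K <= k)%N -> (K <= k')%N ->
     Prob (fun x => coding id col k x != coding id col k' x) <= e) /\
  exists2 g : R, 0 < g & forall k, g <= E (fun x => b (x 0%N) * sgn_val (coding id col k x)).
Proof.
have [l_ hl] := exists_lengths; exists l_.
pose h k (x : nat -> A) := condE k (win k (l_ k) x).
have energy_lim0 : 0 < energy_lim by apply: lt_le_trans e0_gt0 e0_le_energy_lim.
have local_h k : local (k + l_ k) (h k) by move=> x y xy; rewrite /h (win_agree xy).
have l2 (e : R) : 0 < e -> exists K, forall k k', (K <= k)%N -> (k <= k')%N ->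
    E (fun x => (h k x - h k' x) ^+ 2) <= e.
  move=> e_gt0.
  have [_ [K1 _ <-] hK1] := inf_adherent (divr_gt0 e_gt0 (ltr0n R 6)) energy_sup_has_inf.
  have [K2 _ hK2] := nbhs_infty_ger (energy_lim / 2 / (e / 6)).
  exists (maxn K1 K2) => k k' Kk kk'.
  have eps j : (K2 <= j)%N -> energy_lim / 2 / j.+1%:R <= e / 6.
    move=> K2j; rewrite ler_pdivrMr ?ltr0n// [leRHS]mulrC -ler_pdivrMr ?divr_gt0//.
    by apply: hK2 => /=; exact: leqW.
  have [K1k K2k] : (K1 <= k)%N /\ (K2 <= k)%N by apply/andP; rewrite -geq_max.
  have ek := eps _ K2k; have ek' := eps _ (leq_trans K2k kk').
  have qk := hl k; have qk' := hl k'.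
  have s1 : energy_sup k <= energy_lim + e / 6 by apply: le_trans (energy_sup_le K1k) (ltW hK1).
  have s2 := energy_lim_le k'.
  (* The window [k, k + l) contains the windows of h k and of h k'. *)
  pose l := (l_ k + (k' + l_ k'))%N; pose M := (k + l)%N.
  have p1 : E (fun x => (condE k (win k l x) - h k x) ^+ 2) = energy k l - energy k (l_ k).
    apply: E_condE_pythagoras => //; by rewrite /l leq_add2l leq_addr.
  have p2 : E (fun x => (condE k (win k l x) - h k' x) ^+ 2) = energy k l - energy k' (l_ k').
    by apply: E_condE_pythagoras => //; rewrite /l; clear; lia.
  have s3 := energy_le_sup k l.
  have lk : local M (h k) by apply: local_le (local_h k); rewrite /M /l; clear; lia.
  have lk' : local M (h k') by apply: local_le (local_h k'); rewrite /M /l; clear; lia.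
  have lf : local M (fun x => condE k (win k l x)) by move=> x y xy; rewrite (win_agree xy).
  have : E (fun x => (h k x - h k' x) ^+ 2) <=
     2 * E (fun x => (condE k (win k l x) - h k x) ^+ 2) +
     2 * E (fun x => (condE k (win k l x) - h k' x) ^+ 2).
    have l1 : local M (fun x => (condE k (win k l x) - h k x) ^+ 2).
      by move=> x y xy; rewrite (lk _ _ xy) (lf _ _ xy).
    have l2 : local M (fun x => (condE k (win k l x) - h k' x) ^+ 2).
      by move=> x y xy; rewrite (lk' _ _ xy) (lf _ _ xy).
    rewrite -!(@EZ _ _ _ freq M)// -(@ED _ _ _ freq M).
    - apply: (@ler_E _ _ _ freq M).
      + by move=> x y xy; rewrite (lk' _ _ xy) (lk _ _ xy).
      + by move=> x y xy; rewrite (l1 _ _ xy) (l2 _ _ xy).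
      + move=> x; rewrite -subr_ge0; set f := condE _ _.
        rewrite (_ : _ - _ = (2 * f - h k x - h k' x) ^+ 2) ?sqr_ge0//; ring.
    - by move=> x y xy; rewrite (l1 _ _ xy).
    - by move=> x y xy; rewrite (l2 _ _ xy).
  move: ek ek' qk qk' s1 s2 s3; rewrite p1 p2.
  move: (E _) (energy k l) (energy k (l_ k)) (energy k' (l_ k')) (energy_sup k) (energy_sup k').
  move: energy_lim (energy_lim / 2 / k.+1%:R) (energy_lim / 2 / k'.+1%:R); clear => *;  lra.
have cauchy_h (e s : R) : 0 < e -> 0 < s -> exists K, forall k k',
  (K <= k)%N -> (K <= k')%N -> Prob (fun x => s <= `|h k x - h k' x|) <= e.
  move=> e_gt0 s0; have [K hK] := l2 (e * s ^+ 2) (mulr_gt0 e_gt0 (exprn_gt0 _ s0)).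
  have main k k' : (K <= k)%N -> (k <= k')%N -> Prob (fun x => s <= `|h k x - h k' x|) <= e.
    move=> Kk kk'; rewrite -(ler_pM2r (exprn_gt0 2 s0)); apply: le_trans (hK k k' Kk kk').
    pose M := (k + l_ k + (k' + l_ k'))%N.
    have lk : local M (h k) by apply: local_le (local_h k); rewrite leq_addr.
    have lk' : local M (h k') by apply: local_le (local_h k'); rewrite leq_addl.
    rewrite mulrC -(@EZ _ _ _ freq M); last by move=> x y xy; rewrite (lk' _ _ xy) (lk _ _ xy).
    apply: (@ler_E _ _ _ freq M).
    - by move=> x y xy; rewrite (lk' _ _ xy) (lk _ _ xy).
    - by move=> x y xy; rewrite (lk' _ _ xy) (lk _ _ xy).
    - move=> x; case: (leP s `|h k x - h k' x|) => [hs|_]; last by rewrite mulr0 sqr_ge0.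
      by rewrite mulr1 -[leRHS]real_normK ?num_real// ler_sqr ?nnegrE ?normr_ge0 ?(ltW s0).
  exists K => k k' Kk Kk'; have [kk'|/ltnW k'k] := leqP k k'; first exact: main.
  have -> : (fun x => s <= `|h k x - h k' x|) = (fun x => s <= `|h k' x - h k x|).
    by apply/funext => x; rewrite distrC.
  exact: main.
have c0 : 0 < Num.sqrt energy_lim / 2 by rewrite divr_gt0// sqrtr_gt0.
have [t [/andP[t0 tc] ht]] := exists_threshold freq local_h cauchy_h c0.
pose col k (v : (l_ k).-tuple A) := thresh t (condE k v).
exists col.
have codingE k x : coding id col k x = thresh t (h k x) by [].
split.
  move=> e e_gt0; have e2 : 0 < e / 2 by rewrite divr_gt0.
  have [s [s0 [K1 hK1]]] := ht _ e2; have [K2 hK2] := cauchy_h _ _ e2 s0.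
  exists (maxn K1 K2) => k k'; rewrite !geq_max => /andP[K1k K2k] /andP[_ K2k'].
  pose M := (k + l_ k + (k' + l_ k'))%N.
  have lk : local M (h k) by apply: local_le (local_h k); rewrite leq_addr.
  have lk' : local M (h k') by apply: local_le (local_h k'); rewrite leq_addl.
  apply: (@le_trans _ _ (Prob (fun x => (`| `|h k x| - t| < s) || (s <= `|h k x - h k' x|)))).
    apply: (@ler_Prob _ _ _ freq M).
    - by move=> x y xy; rewrite !codingE (lk' _ _ xy) (lk _ _ xy).
    - by move=> x y xy; rewrite (lk' _ _ xy) (lk _ _ xy).
    - move=> x; rewrite !codingE; apply: contraR; rewrite negb_or -leNgt -ltNge => /andP[h1 h2].
      by apply/eqP; apply: thresh_stable h1 h2.
  apply: le_trans (Prob_union (M := M) freq _ _) _.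
  - by move=> x y xy; rewrite (lk _ _ xy).
  - by move=> x y xy; rewrite (lk _ _ xy) (lk' _ _ xy).
  - by rewrite [leRHS]splitr; apply: lerD; [exact: hK1|exact: hK2].
exists (energy_lim / (4 * B)) => [|k]; first by rewrite divr_gt0// mulr_gt0.
rewrite (E_tower freq b k (fun v => sgn_val (col k v))).
rewrite ler_pdivrMr ?mulr_gt0//.
have lh : local (k + l_ k) (fun x => h k x * sgn_val (col k (win k (l_ k) x))).
  exact: (@local_win _ _ _ _ _ (fun v => condE k v * sgn_val (col k v))).
have lh2 : local (k + l_ k) (fun x => h k x ^+ 2).
  exact: (@local_win _ _ _ _ _ (fun v => condE k v ^+ 2)).
have : E (fun x => h k x ^+ 2) - t ^+ 2 <= B * E (fun x => h k x * sgn_val (col k (win k (l_ k) x))).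
  rewrite -[X in _ - X](E_cst freq) -(@EB _ _ _ freq (k + l_ k))// -(@EZ _ _ _ freq (k + l_ k))//.
  apply: (@ler_E _ _ _ freq (k + l_ k)).
  - by move=> x y xy; rewrite (lh2 _ _ xy).
  - by move=> x y xy; rewrite (lh _ _ xy).
  - move=> x; rewrite /col -/(h k x).
    have : `|h k x| <= B by exact: (condE_le freq _ _ (ltW B0)).
    exact: thresh_gain.
have qk := hl k.
have -> : E (fun x => h k x ^+ 2) = energy k (l_ k) by [].
have : energy_lim / 2 / k.+1%:R <= energy_lim / 2.
  by rewrite ler_pdivrMr ?ltr0n// ler_peMr ?divr_ge0 ?(ltW energy_lim0)// ler1n.
have := energy_lim_le k.
have : t ^+ 2 <= energy_lim / 4.
  have : t ^+ 2 <= (Num.sqrt energy_lim / 2) ^+ 2 by rewrite ler_sqr ?nnegrE ?ltW.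
  by rewrite expr_div_n sqr_sqrtr ?(ltW energy_lim0)//; lra.
rewrite -/(h k); move: qk; move: (energy_lim / 2 / k.+1%:R).
move: (E _) (energy k (l_ k)) (energy_sup k) (energy_lim) (t ^+ 2); clear => *; lra.
Qed.

End ConvergentCodings.

(** * Words cleaned at every scale *)

Section Hierarchy.
Variables (V : eqType) (z0 : V).
Variables (W r : nat -> nat) (L : nat -> seq (seq V)).
Hypothesis W_gt0 : forall i, (0 < W i)%N.
Hypothesis WS : forall i, W i.+1 = (r i * W i)%N.
Hypothesis size_L : forall i s, s \in L i -> size s = W i.

Definition block w (s : seq V) q := take w (drop (q * w) s).

(** A word that is not listed at its scale is erased; in a listed word, the
    aligned blocks of the scale below are cleaned in turn. Hence a cleaned word
    is a concatenation of cleaned words of each lower scale, and a bound on the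
    lists bounds its complexity at all scales. *)
Fixpoint clean i (s : seq V) : seq V :=
  if s \in L i then
    if i is i'.+1 then flatten (mkseq (fun q => clean i' (block (W i') s q)) (r i')) else s
  else nseq (W i) z0.

Lemma size_clean i s : size (clean i s) = W i.
Proof.
elim: i s => [|i IH] s /=; first by case: ifP => [/size_L//|_]; rewrite size_nseq.
case: ifP => _; last by rewrite size_nseq.
rewrite size_flatten /shape -map_comp (eq_map (g := fun=> W i)); last by move=> q /=; exact: IH.
by rewrite WS; elim: (r i) 0%N => //= n IHn m; rewrite IHn mulSn.
Qed.

(** The single zeros account for the phases at which segments start and for the
    words erased at higher scales. *)
Inductive good i : seq V -> Prop :=
| good_nil : good i [::]
| good_zero s : good i s -> good i (z0 :: s)
| good_block u s : good i s -> good i (clean i u ++ s).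

Lemma good_cat i s t : good i s -> good i t -> good i (s ++ t).
Proof.
move=> gs gt; elim: gs => [//|{}s _ IH|u {}s _ IH] /=; first exact: good_zero.
by rewrite -catA; exact: good_block.
Qed.

Lemma good_nseq i n : good i (nseq n z0).
Proof. by elim: n => [|n IH] /=; [exact: good_nil|exact: good_zero]. Qed.

Lemma good_flatten i ss : (forall s, s \in ss -> good i s) -> good i (flatten ss).
Proof.
elim: ss => [|s ss IH] h /=; first exact: good_nil.
apply: good_cat; first by apply: h; rewrite mem_head.
by apply: IH => t tss; apply: h; rewrite in_cons tss orbT.
Qed.

Lemma good_clean i j s : (i <= j)%N -> good i (clean j s).
Proof.
elim: j s => [|j IH] s.
  by rewrite leqn0 => /eqP ->; rewrite -[clean 0 s]cats0; apply: good_block; exact: good_nil.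
rewrite leq_eqVlt => /predU1P[->|ij].
  by rewrite -[clean _ s]cats0; apply: good_block; exact: good_nil.
rewrite /=; case: ifP => _; last exact: good_nseq.
by apply: good_flatten => _ /mapP[q _ ->]; exact: IH.
Qed.

Lemma clean_mem i s : clean i s \in nseq (W i) z0 :: map (clean i) (L i).
Proof.
rewrite in_cons; case: (boolP (s \in L i)) => sL; first by rewrite (map_f (clean i) sL) orbT.
by rewrite (_ : clean i s = nseq (W i) z0) ?eqxx//; case: i sL => /= [|i] /negbTE ->.
Qed.

(** The hypothesis says that the pieces of a good word, weighted by exp (- s *
    length), have total weight at most 1. The bound follows by induction,
    according to the first piece. *)
Lemma good_count (R : realType) i (s : R) :
  expR (- s) + (size (L i)).+1%:R * expR (- (s * (W i)%:R)) <= 1 ->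
  forall n, exists l : seq (seq V), (forall t, good i t -> size t = n -> t \in l) /\
    (size l)%:R <= expR (s * n%:R).
Proof.
move=> hs; elim/ltn_ind => -[_|n IH].
  exists [:: [::]]; split; last by rewrite mulr0 expR0.
  by move=> t _ /size0nil ->; rewrite mem_head.
have [l1 [h1 c1]] := IH n (ltnSn n).
have [lt|le] := ltnP n.+1 (W i).
  exists (map (cons z0) l1); split.
    move=> t; case=> [//|t' gt' /= [st']|u t' gt']; first by apply/map_f/h1.
    by rewrite size_cat size_clean => st; rewrite -st ltnNge leq_addr in lt.
  rewrite size_map (le_trans c1)// ler_expR ler_wpM2l ?ler_nat//.
  rewrite leNgt; apply/negP => s0.
  have : 1 < expR (- s) by rewrite expR_gt1 oppr_gt0.
  have : 0 <= (size (L i)).+1%:R * expR (- (s * (W i)%:R)) by rewrite mulr_ge0 ?expR_ge0.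
  lra.
have [|l2 [h2 c2]] := IH (n.+1 - W i)%N; first by have := W_gt0 i; lia.
exists (map (cons z0) l1 ++ allpairs cat (nseq (W i) z0 :: map (clean i) (L i)) l2); split.
  move=> t; rewrite mem_cat; case=> [//|t' gt' /= [st']|u t' gt'].
    by apply/orP; left; apply/map_f/h1.
  rewrite size_cat size_clean => st; apply/orP; right; apply: allpairs_f; first exact: clean_mem.
  by apply: h2 => //; rewrite -st addKn.
rewrite size_cat size_allpairs !size_map/= size_map natrD natrM.
have -> : expR (s * n.+1%:R) = expR (s * n.+1%:R) * 1 :> R by rewrite mulr1.
apply: le_trans (ler_wpM2l (expR_ge0 _) hs); rewrite mulrDr lerD//.
  apply: le_trans c1 _; rewrite -expRD ler_expR -natr1; lra.
rewrite mulrCA ler_wpM2l//; apply: le_trans c2 _; rewrite -expRD ler_expR natrB//; lra.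
Qed.

(** Dropping whole pieces leaves an offset shorter than one piece. *)
Lemma good_suffix i t p : good i t -> exists2 t', good i t' & exists2 p', (p' < W i)%N &
  drop p t = drop p' t' /\ (p' <= size t')%N.
Proof.
move=> gt; elim: gt p => [|{}t gt IH|u {}t gt IH] p.
- by exists [::]; [exact: good_nil|exists 0%N].
- case: p => [|p]; first by exists (z0 :: t); [exact: good_zero|exists 0%N].
  by have [t' gt' h] := IH p; exists t'.
- have [pW|Wp] := ltnP p (W i).
    exists (clean i u ++ t); first exact: good_block.
    by exists p => //; split=> //; rewrite size_cat size_clean ltnW// ltn_addr.
  have [t' gt' h] := IH (p - W i)%N; exists t' => //.
  by rewrite drop_cat size_clean ltnNge Wp.
Qed.

Lemma good_prefix i t n : good i t -> (n <= size t)%N -> exists2 t', good i t' &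
  [/\ (n <= size t' < n + W i)%N & take n t' = take n t].
Proof.
move=> gt; elim: gt n => [|{}t gt IH|u {}t gt IH] n /=.
- by rewrite leqn0 => /eqP ->; exists [::]; [exact: good_nil|split; rewrite /= ?add0n ?W_gt0 ?take0].
- case: n => [|n] nt; first by exists [::]; [exact: good_nil|split; rewrite /= ?add0n ?W_gt0 ?take0].
  have [t' gt' [s' e]] := IH n nt; exists (z0 :: t'); first exact: good_zero.
  by rewrite /= e; split=> //; lia.
- rewrite size_cat size_clean => nt; have [nW|Wn] := leqP n (W i).
    case: n nW {nt} => [|n] nW; first by exists [::]; [exact: good_nil|by rewrite !take0 /= add0n W_gt0].
    exists (clean i u ++ [::]); first by apply: good_block; exact: good_nil.
    rewrite cats0 take_cat size_clean; split; first by lia.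
    case: (ltnP n.+1 (W i)) => // h; have -> : n.+1 = W i by lia.
    by rewrite subnn take0 cats0 take_oversize ?size_clean.
  have [|t' gt' [s' e]] := IH (n - W i)%N; first by lia.
  exists (clean i u ++ t'); first exact: good_block.
  rewrite !take_cat !size_cat !size_clean (_ : (n < W i)%N = false); last by lia.
  rewrite e; split => //; lia.
Qed.

(** An infix of length n sits in a good word of length n + 2 W i at an offset
    below W i: the pieces before and after it are dropped, and zeros complete
    the length. *)
Lemma good_infix_count (R : realType) i (s : R) :
  expR (- s) + (size (L i)).+1%:R * expR (- (s * (W i)%:R)) <= 1 ->
  forall n, exists l : seq (seq V),
    (forall t p, good i t -> (p + n <= size t)%N -> take n (drop p t) \in l) /\
    (size l)%:R <= (W i)%:R * expR (s * (n + (W i).*2)%:R).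
Proof.
move=> hs n; have [l [hl cl]] := good_count hs (n + (W i).*2).
exists [seq take n (drop p t) | p <- iota 0 (W i), t <- l]; split; last first.
  by rewrite size_allpairs size_iota natrM ler_wpM2l.
move=> t p gt le; have [t1 gt1 [p' p'W [e1 p't1]]] := good_suffix p gt.
have st1 : (p' + n <= size t1)%N.
  have := congr1 size e1; rewrite !size_drop; clear -p't1 le; lia.
have [t2 gt2 [s2 e2]] := good_prefix gt1 st1.
pose t3 := t2 ++ nseq (n + (W i).*2 - size t2) z0.
have e3 : take n (drop p t) = take n (drop p' t3).
  rewrite e1 !take_drop addnC -e2 /t3 take_cat; case: ltnP => // h.
  have -> : size t2 = (p' + n)%N by apply/eqP; rewrite eqn_leq h; case/andP: s2.
  by rewrite subnn take0 cats0 take_oversize//; case/andP: s2 => ->; rewrite h.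
rewrite e3; apply: allpairs_f; first by rewrite mem_iota add0n p'W.
apply: hl; first by apply: good_cat => //; exact: good_nseq.
by rewrite size_cat size_nseq subnKC//; clear -s2 p'W; lia.
Qed.

End Hierarchy.

(** * A sequence of low complexity that correlates with the data *)

Lemma sum_nat_split (R : nmodType) m n (F : nat -> R) :
  \sum_(i < m + n) F i = \sum_(i < m) F i + \sum_(i < n) F (m + i)%N.
Proof. by rewrite big_split_ord. Qed.

Lemma sum_residues (R : nmodType) w T (F : nat -> R) :
  \sum_(i < T * w) F i = \sum_(s < w) \sum_(t < T) F (s + t * w)%N.
Proof.
elim: T => [|T IH].
  by rewrite mul0n big_ord0 big1// => s _; rewrite big_ord0.
rewrite mulSn addnC sum_nat_split IH -big_split/=; apply: eq_bigr => s _.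
by rewrite big_ord_recr addnC.
Qed.

Section Comparison.
Variables (R : realType) (A V : finType) (z0 : V) (val : V -> R) (b : A -> R) (B : R).
Hypothesis B0 : 0 < B.
Hypothesis bB : forall c, `|b c| <= B.
Hypothesis val_le : forall v, `|val v| <= 1.

Definition mism (f : nat -> V) (s : seq V) : nat := \sum_(i < size s) (nth z0 s i != f i).

Definition corr (x : nat -> A) (s : seq V) : R := \sum_(i < size s) b (x i) * val (nth z0 s i).

Lemma mism_cat f s t : mism f (s ++ t) = (mism f s + mism (fun i => f (size s + i)%N) t)%N.
Proof.
rewrite /mism size_cat (sum_nat_split _ _ (fun i => (nth z0 (s ++ t) i != f i) : nat)).
congr (_ + _)%N; apply: eq_bigr => i _; rewrite nth_cat ?ltn_ord//.
by rewrite ltnNge leq_addr/= addKn.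
Qed.

Lemma corr_cat x s t : corr x (s ++ t) = corr x s + corr (suffix_from (size s) x) t.
Proof.
rewrite /corr size_cat (sum_nat_split _ _ (fun i => b (x i) * val (nth z0 (s ++ t) i))).
congr (_ + _); apply: eq_bigr => i _; rewrite nth_cat ?ltn_ord//.
by rewrite ltnNge leq_addr/= addKn.
Qed.

Lemma mism_flatten f w (u : nat -> seq V) r : (forall q, size (u q) = w) ->
  mism f (flatten (mkseq u r)) = \sum_(q < r) mism (fun i => f (q * w + i)%N) (u q).
Proof.
move=> su; have sf n : size (flatten (mkseq u n)) = (n * w)%N.
  elim: n => // n IH; rewrite mkseqS flatten_rcons size_cat IH su mulSn addnC//.
elim: r => [|n IH]; first by rewrite big_ord0 /mism big_ord0.
by rewrite mkseqS flatten_rcons mism_cat IH big_ord_recr/= sf.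
Qed.

Lemma corr_flatten x w (u : nat -> seq V) r : (forall q, size (u q) = w) ->
  corr x (flatten (mkseq u r)) = \sum_(q < r) corr (suffix_from (q * w) x) (u q).
Proof.
move=> su; have sf n : size (flatten (mkseq u n)) = (n * w)%N.
  elim: n => // n IH; rewrite mkseqS flatten_rcons size_cat IH su mulSn addnC//.
elim: r => [|n IH]; first by rewrite big_ord0 /corr big_ord0.
by rewrite mkseqS flatten_rcons corr_cat IH big_ord_recr/= sf.
Qed.

Lemma mism_le f s : (mism f s <= size s)%N.
Proof.
rewrite /mism -[leqRHS]card_ord -sum1_card; apply: leq_sum => i _; exact: leq_b1.
Qed.

Lemma corr_ge (x : nat -> A) (f : nat -> V) s :
  \sum_(i < size s) b (x i) * val (f i) - 2 * B * (mism f s)%:R <= corr x s.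
Proof.
rewrite lerBlDr /corr /mism natr_sum mulr_sumr -big_split/=; apply: ler_sum => i _.
have [->|_] := eqVneq (nth z0 s i) (f i); first by rewrite mulr0 addr0.
rewrite mulr1.
have h v : `|b (x i) * val v| <= B.
  by rewrite normrM -[leRHS]mulr1 ler_pM.
have := h (nth z0 s i); have := h (f i).
rewrite !ler_norml => /andP[_ h1] /andP[h2 _]; lra.
Qed.

End Comparison.

Section Segments.
Variables (R : realType) (A : finType) (a : nat -> A).
Hypothesis freq : has_frequencies R a.
Local Notation E := (freq_mean a).
Local Notation Prob := (@Prob R A a).
Variables (b : A -> R) (B : R).
Hypothesis B0 : 0 < B.
Hypothesis bB : forall c, `|b c| <= B.
Variables (V : finType) (z0 : V) (val : V -> R).
Hypothesis val_le : forall v, `|val v| <= 1.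
Hypothesis val0 : val z0 = 0.
Variables (c : nat -> (nat -> A) -> V) (d : nat -> nat).
Hypothesis local_c : forall k, local (d k) (c k).
Variables (W r : nat -> nat) (L : nat -> seq (seq V)).
Hypothesis W_gt0 : forall i, (0 < W i)%N.
Hypothesis WS : forall i, W i.+1 = (r i * W i)%N.
Hypothesis size_L : forall i s, s \in L i -> size s = W i.

Local Notation mism := (mism z0).
Local Notation corr := (corr z0 val b).
Local Notation clean := (clean z0 W r L).
Local Notation good := (good z0 W r L).

Definition cw k w (x : nat -> A) : seq V := mkseq (fun i => c k (suffix_from i x)) w.

Lemma size_cw k w x : size (cw k w x) = w.
Proof. exact: size_mkseq. Qed.

Lemma local_cw k w : local (w + d k) (cw k w).
Proof.
move=> x y xy; apply: (@eq_from_nth _ z0); rewrite !size_cw// => i iw.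
rewrite !nth_mkseq//; apply: local_c => j jd; apply: xy; lia.
Qed.

Lemma block_cw k w n q x : (q < n)%N ->
  block w (cw k (n * w) x) q = cw k w (suffix_from (q * w) x).
Proof.
move=> qn; have le : (q * w + w <= n * w)%N by rewrite addnC -mulSn leq_mul2r qn orbT.
have sb : size (block w (cw k (n * w) x) q) = w.
  by rewrite /block size_take size_drop size_cw; case: ltnP; lia.
apply: (@eq_from_nth _ z0); rewrite sb ?size_cw// => i iw.
rewrite /block nth_take// nth_drop !nth_mkseq//; last by lia.
by congr (c k); apply/funext => j; rewrite /suffix_from addnA.
Qed.

Lemma ltn_clean j s (i : 'I_(size (clean j s))) : (i < W j)%N.
Proof. by rewrite -(size_clean z0 WS size_L j s) ltn_ord. Qed.

Definition loss k j x := mism (fun i => c k (suffix_from i x)) (clean j (cw k (W j) x)).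

Lemma local_loss k j : local (W j + d k) (loss k j).
Proof.
move=> x y xy; rewrite /loss (local_cw xy) /mism; apply: eq_bigr => i _.
have iW := ltn_clean i.
congr (nat_of_bool (_ != _)); apply: local_c => l ld; apply: xy; by rewrite -addnS; exact: leq_add (ltnW iW) ld.
Qed.

Lemma mism_cw k w x : mism (fun i => c k (suffix_from i x)) (cw k w x) = 0%N.
Proof.
apply: big1 => i _; have iw : (i < w)%N by apply: leq_trans (ltn_ord i) _; rewrite size_cw.
by rewrite nth_mkseq ?eqxx.
Qed.

Lemma loss_bad k j x : (loss k j x <= W j)%N.
Proof. by apply: leq_trans (mism_le _ _ _) _; rewrite (size_clean z0 WS size_L). Qed.

Lemma loss0 k x : (loss k 0 x <= W 0 * (cw k (W 0) x \notin L 0%N))%N.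
Proof.
case: (boolP (_ \in L 0%N)) => /= h; last by rewrite muln1 loss_bad.
by rewrite muln0 /loss /= h mism_cw.
Qed.

(** A word that is not listed is lost entirely; otherwise the losses are those
    of its blocks. *)
Lemma lossS k j x : (loss k j.+1 x <= W j.+1 * (cw k (W j.+1) x \notin L j.+1) +
  \sum_(q < r j) loss k j (suffix_from (q * W j) x))%N.
Proof.
case: (boolP (_ \in L j.+1)) => /= h; last by rewrite muln1 (leq_trans (loss_bad _ _ _))// leq_addr.
rewrite muln0 add0n /loss /= h (mism_flatten z0 _ _ (w := W j)); last first.
  by move=> q; rewrite (size_clean z0 WS size_L).
apply: leq_sum => q _; rewrite WS block_cw ?ltn_ord//.
apply/eq_leq/eq_bigr => i _; congr (nat_of_bool (_ != c k _)).
by apply/funext => l; rewrite /suffix_from addnA.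
Qed.

Variable eta : nat -> R.

(** By stationarity, a given letter is erased at scale i with probability at
    most eta i; the probabilities add up over the scales. *)
Lemma E_loss k j : (forall i, (i <= j)%N -> Prob (fun x => cw k (W i) x \notin L i) <= eta i) ->
  E (fun x => (loss k j x)%:R) <= (W j)%:R * \sum_(i < j.+1) eta i.
Proof.
have lbad i M : (W i + d k <= M)%N -> local M (fun x => (cw k (W i) x \notin L i)%:R : R).
  by move=> le x y /(agree_le le) xy; rewrite (local_cw xy).
elim: j => [|j IH] h.
  rewrite big_ord_recl big_ord0 addr0; apply: le_trans (ler_wpM2l (ler0n _ _) (h 0%N (leqnn _))).
  rewrite /Prob -(@EZ _ _ _ freq (W 0 + d k)); last exact: lbad.
  apply: (@ler_E _ _ _ freq (W 0 + d k)).
  - by move=> x y xy; rewrite (local_loss xy).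
  - by move=> x y xy; rewrite (@lbad 0%N (W 0 + d k)%N (leqnn _) _ _ xy).
  - by move=> x; rewrite -natrM ler_nat loss0.
rewrite big_ord_recr/= mulrDr addrC.
pose M := (W j.+1 + d k)%N.
have lq (q : 'I_(r j)) : local M (fun x => (loss k j (suffix_from (q * W j) x))%:R : R).
  move=> x y xy; congr _%:R; apply: local_loss => i iM; apply: xy.
  have := ltn_ord q; rewrite /M WS => qr.
  have : (q * W j + W j <= r j * W j)%N by rewrite addnC -mulSn leq_mul2r qr orbT.
  by clear -iM; lia.
apply: (@le_trans _ _ (E (fun x => (W j.+1)%:R * (cw k (W j.+1) x \notin L j.+1)%:R +
    \sum_(q < r j) (loss k j (suffix_from (q * W j) x))%:R))).
  apply: (@ler_E _ _ _ freq M).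
  - by move=> x y xy; rewrite (local_loss xy).
  - move=> x y xy; rewrite (@lbad j.+1 M (leqnn _) _ _ xy); congr (_ + _).
    by apply: eq_bigr => q _; rewrite (lq q _ _ xy).
  - by move=> x; rewrite -natrM -natr_sum -natrD ler_nat lossS.
rewrite (@ED _ _ _ freq M).
- rewrite lerD//.
    rewrite (@EZ _ _ _ freq M); last exact: lbad.
    by rewrite ler_wpM2l ?h.
  rewrite (@E_sum _ _ _ freq M); last by move=> q _; exact: lq.
  rewrite [leLHS](eq_bigr (fun=> E (fun x => (loss k j x)%:R))); last first.
    move=> q _; rewrite (@E_shift _ _ _ freq (W j + d k)%N (fun x => (loss k j x)%:R) (q * W j)%N)//.
    by move=> x y xy; rewrite (local_loss xy).
  rewrite sumr_const card_ord -[leLHS]mulr_natl WS natrM -mulrA ler_wpM2l//.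
  by apply: IH => i ij; apply: h; exact: leqW.
- by move=> x y xy; rewrite (@lbad j.+1 M (leqnn _) _ _ xy).
- by move=> x y xy; apply: eq_bigr => q _; rewrite (lq q _ _ xy).
Qed.

Variable g : R.
Hypothesis g0 : 0 < g.
Hypothesis c_corr : forall k, g <= E (fun x => b (x 0%N) * val (c k x)).
Hypothesis eta_sum : forall n, \sum_(i < n) eta i <= g / (4 * B).
Hypothesis L_typical : forall i, exists K, forall k, (K <= k)%N ->
  Prob (fun x => cw k (W i) x \notin L i) <= eta i.

Definition gain k j x := corr x (clean j (cw k (W j) x)).

Lemma local_gain k j : local (W j + d k) (gain k j).
Proof.
move=> x y xy; rewrite /gain (local_cw xy) /corr; apply: eq_bigr => i _.
by rewrite xy//; apply: leq_trans (ltn_clean i) (leq_addr _ _).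
Qed.

(** The coding has correlation g per letter and the cleaning loses at most 2 B
    * (g / (4 B)) of it, which is half. *)
Lemma E_gain k j : (forall i, (i <= j)%N -> Prob (fun x => cw k (W i) x \notin L i) <= eta i) ->
  (W j)%:R * (g / 2) <= E (gain k j).
Proof.
move=> h; have hl := E_loss h; pose M := (W j + d k).+1.
have ll : local M (fun x => (loss k j x)%:R : R).
  by move=> x y xy; rewrite (@local_loss k j x y)//; apply: agree_le xy; rewrite /M.
have lc i : (i < W j)%N -> local M (fun x => b (x i) * val (c k (suffix_from i x))).
  move=> iW x y xy; rewrite xy; last by rewrite /M; clear -iW; lia.
  congr (_ * val _); apply: local_c => l ld; apply: xy; rewrite /M; clear -iW ld; lia.
apply: (@le_trans _ _ (E (fun x => \sum_(i < W j) b (x i) * val (c k (suffix_from i x)) -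
    2 * B * (loss k j x)%:R))); last first.
  apply: (@ler_E _ _ _ freq M).
  - move=> x y xy; rewrite (ll _ _ xy); congr (_ - _).
    by apply: eq_bigr => i _; rewrite (lc i (ltn_ord i) _ _ xy).
  - by apply: local_le (local_gain (k := k) (j := j)); rewrite /M.
  - move=> x; have := corr_ge z0 bB val_le x (fun i => c k (suffix_from i x)) (clean j (cw k (W j) x)).
    by rewrite (size_clean z0 WS size_L).
rewrite (@EB _ _ _ freq M).
- rewrite (@EZ _ _ _ freq M)// (@E_sum _ _ _ freq M); last by move=> i _; exact: lc.
  have : (W j)%:R * g <= \sum_(i < W j) E (fun x => b (x i) * val (c k (suffix_from i x))).
    rewrite (le_trans _ (ler_sum (F := fun=> g) _ _))//.
      by rewrite sumr_const card_ord mulr_natl.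
    move=> i _; apply: le_trans (c_corr k) _.
    rewrite -(@E_shift _ _ _ freq (d k).+1 (fun x => b (x 0%N) * val (c k x)) i).
      apply: (@ler_E _ _ _ freq M) => [x y xy||x].
      - rewrite /suffix_from addn0 xy; last by rewrite /M; have := ltn_ord i; clear; lia.
        congr (_ * val _); apply: local_c => l ld; apply: xy; rewrite /M; have := ltn_ord i.
        by clear -ld; lia.
      - exact: lc.
      - by rewrite /suffix_from addn0.
    move=> x y xy; rewrite xy//; congr (_ * val _); apply: local_c => l ld; apply: xy.
    exact: ltnW.
  have : 2 * B * E (fun x => (loss k j x)%:R) <= (W j)%:R * (g / 2).
    apply: (@le_trans _ _ (2 * B * ((W j)%:R * (g / (4 * B))))).
      rewrite ler_pM2l ?mulr_gt0//; apply: le_trans hl _.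
      by rewrite ler_wpM2l.
    by rewrite le_eqVlt; apply/orP; left; apply/eqP; field; rewrite gt_eqF.
  lra.
- by move=> x y xy; apply: eq_bigr => i _; rewrite (lc i (ltn_ord i) _ _ xy).
- by move=> x y xy; rewrite (ll _ _ xy).
Qed.

Lemma common_index j : exists k, forall i, (i <= j)%N ->
  Prob (fun x => cw k (W i) x \notin L i) <= eta i.
Proof.
have [K hK] := boolp.choice L_typical.
exists (\max_(i < j.+1) K i) => i ij; apply: hK.
exact: (leq_bigmax (Ordinal (ij : (i < j.+1)%N))).
Qed.

(** The gains of cleaned words starting at all times have mean at least g / 2
    per letter, so for some phase s modulo W j the words tiling s + W j * nat
    gain at least g / 3 per letter. Taking sufficiently many of them lets the
    segment outweigh the N terms that precede it. *)
Lemma segment j N : (0 < N)%N -> exists s : seq V,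
  [/\ (0 < size s)%N, forall i, (i <= j)%N -> good i s &
    g / 4 * (N + size s)%:R + B * N%:R <= corr (suffix_from N a) s].
Proof.
move=> N0; have [k hk] := common_index j.
pose w := W j; have hg : w%:R * (g / 2) <= E (gain k j) := E_gain hk.
pose w0 : (0 < w)%N := W_gt0 j.
have wR : 0 < w%:R :> R by rewrite ltr0n.
pose G x := gain k j (suffix_from N.-1 x).
have lG : local (N.-1 + (w + d k)) G by apply: local_suffix; exact: local_gain.
have := E_cvg freq lG; rewrite (E_shift freq N.-1 (@local_gain k j)).
have gap : 0 < w%:R * (g / 2 - g / 3).
  by rewrite mulr_gt0// subr_gt0 ltr_pM2l// ltf_pV2 ?posrE// ltr_nat.
move=> /cvgrPdist_lt/(_ _ gap)[M0 _ hM0].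
have [T1 _ hT1] := nbhs_infty_ger ((g / 4 * (N + w)%:R + B * N%:R) / (g / 12 * w%:R)).
pose T := (maxn T1 M0).+1.
pose F n := gain k j (suffix_from (N + n) a).
have Tw : (T <= T * w)%N by rewrite leq_pmulr.
have TwR : 0 < (T * w)%:R :> R by rewrite ltr0n; apply: leq_trans Tw.
have big : (T * w)%:R * (w%:R * (g / 3)) <= \sum_(i < T * w) F i.
  have : `|E (gain k j) - avg a G (T * w)| < w%:R * (g / 2 - g / 3).
    by apply: hM0 => /=; apply: leq_trans Tw; rewrite /T ltnW// ltnS leq_maxr.
  rewrite ltr_norml => /andP[_ h1].
  have h2 : w%:R * (g / 3) <= avg a G (T * w) by move: hg h1; move: (E _) (avg a G _) (w%:R : R) => e' a' w' hg h1; lra.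
  have -> : \sum_(i < T * w) F i = (T * w)%:R * avg a G (T * w).
    rewrite /avg mulVKf ?gt_eqF// big_add1 big_mkord; apply: eq_bigr => i _.
    by rewrite /G suffix_fromD /F; rewrite addSnnS prednK// addnC.
  by rewrite ler_pM2l.
rewrite sum_residues in big.
have [s hs] : exists s : 'I_w, T%:R * (w%:R * (g / 3)) <= \sum_(t < T) F (s + t * w)%N.
  apply/existsP; rewrite -[X in is_true X]negbK negb_exists; apply/negP => /forallP hall.
  have : \sum_(s < w) \sum_(t < T) F (s + t * w)%N < \sum_(s < w) T%:R * (w%:R * (g / 3)).
    apply: ltr_sum => [|i _]; last by rewrite ltNge hall.
    by apply/hasP; exists (Ordinal w0) => //; rewrite mem_index_enum.
  rewrite sumr_const card_ord -[ltRHS]mulr_natl mulrA -natrM mulnC => /(le_lt_trans big).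
  by rewrite ltxx.
pose u t := clean j (cw k w (suffix_from (N + (s + t * w)) a)).
have su t : size (u t) = w by exact: (size_clean z0 WS size_L).
have sf n : size (flatten (mkseq u n)) = (n * w)%N.
  by elim: n => // n IH; rewrite mkseqS flatten_rcons size_cat IH su mulSn addnC.
exists (nseq s z0 ++ flatten (mkseq u T)); split.
- rewrite size_cat sf; apply: leq_trans (leq_addl _ _); apply: leq_trans Tw; exact: ltn0Sn.
- move=> i ij; apply: good_cat; first exact: good_nseq.
  by apply: good_flatten => _ /mapP[q _ ->]; exact: good_clean.
rewrite corr_cat (corr_flatten z0 val b _ _ su) size_nseq.
rewrite (_ : corr _ (nseq s z0) = 0) ?add0r; last first.
  apply: big1 => i _; rewrite nth_nseq; case: ifP => _; by rewrite val0 mulr0.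
rewrite (eq_bigr (fun t : 'I_T => F (s + t * w)%N)); last first.
  by move=> t _; rewrite /F /gain /u !suffix_fromD addnA.
apply: le_trans hs; rewrite size_cat size_nseq sf.
have h12 : 0 < g / 12 * w%:R by rewrite mulr_gt0// divr_gt0.
have hT : g / 4 * (N + w)%:R + B * N%:R <= T%:R * (g / 12 * w%:R).
  by rewrite -ler_pdivrMr//; apply: hT1 => /=; rewrite /T ltnW// ltnS leq_maxl.
have sw : (s%:R : R) <= w%:R by rewrite ler_nat ltnW.
move: hT; rewrite (natrD _ N w) (natrD _ N (s + T * w)) (natrD _ s) (natrM _ T).
have : g / 4 * s%:R <= g / 4 * w%:R by rewrite ler_pM2l// divr_gt0.
move: (s%:R : R) (w%:R : R) (T%:R : R) (N%:R : R) => s' w' T' N' h1 h2; lra.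
Qed.

(** The sequence concatenates segments of growing scale. After the segment
    number i, it consists of segments that are good at scale i; at the end of
    each segment, its correlation with b o a is large. *)
Theorem exists_correlated_sequence : exists (y : nat -> V),
  (forall i, exists p0, forall n, exists s, good i s /\ (forall p, (p < n)%N ->
      (p < size s)%N /\ y (p0 + p)%N = nth z0 s p)) /\
  (forall N0, exists2 N, (N0 <= N)%N &
     g / 4 * N.+1%:R <= \sum_(1 <= n < N.+1) val (y n) * b (a n)).
Proof.
have hF0 (jN : nat * nat) : exists s : seq V, (0 < jN.2)%N ->
    [/\ (0 < size s)%N, forall i, (i <= jN.1)%N -> good i s &
    g / 4 * (jN.2 + size s)%:R + B * jN.2%:R <= corr (suffix_from jN.2 a) s].
  case: jN => j N; case: (posnP N) => [->|N0]; first by exists [::].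
  by have [s hs] := segment j N0; exists s.
have [F hF] := boolp.choice hF0.
(* The segment of scale j starts where the first j segments end, with an
   initial letter that makes that time positive. *)
pose pre := fix pre j := if j is j'.+1 then pre j' ++ F (j', size (pre j')) else [:: z0].
have preS j : pre j.+1 = pre j ++ F (j, size (pre j)) by [].
have pre_gt0 j : (0 < size (pre j))%N.
  by elim: j => // j IH; rewrite preS size_cat ltn_addr.
have hseg j := hF (j, size (pre j)) (pre_gt0 j).
have size_pre j : (j < size (pre j))%N.
  elim: j => // j IH; rewrite preS size_cat -addn1; have [h _ _] := hseg j.
  exact: (leq_add IH h).
have nth_pre i j n : (i <= j)%N -> (n < size (pre i))%N -> nth z0 (pre j) n = nth z0 (pre i) n.
  move=> ij ni; rewrite -(subnKC ij); elim: (j - i)%N => [|m IH]; first by rewrite addn0.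
  have hm : (n < size (pre (i + m)))%N.
    apply: leq_trans ni _; elim: (m) => [|l IHl]; first by rewrite addn0.
    by rewrite addnS preS size_cat (leq_trans IHl)// leq_addr.
  by rewrite addnS preS nth_cat hm.
pose y n := nth z0 (pre n) n.
have yE j n : (n < size (pre j))%N -> y n = nth z0 (pre j) n.
  move=> nj; have [nj'|jn] := leqP n j; first by rewrite (nth_pre n j).
  by rewrite /y (nth_pre j n)// ltnW.
exists y; split.
  move=> i; exists (size (pre i)) => n.
  have [s [gs es]] : exists s, good i s /\ pre (i + n)%N = pre i ++ s.
    elim: n => [|n [s [gs es]]]; first by exists [::]; rewrite addn0 cats0; split=> //; exact: good_nil.
    exists (s ++ F ((i + n)%N, size (pre (i + n)))); split; last by rewrite addnS preS {1}es catA.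
    apply: good_cat => //; have [_ h _] := hseg (i + n)%N; apply: h; exact: leq_addr.
  exists s; split => // p pn.
  have ps : (size (pre i) + p < size (pre (i + n)))%N.
    apply: (@leq_trans (size (pre i) + n)); first by rewrite ltn_add2l.
    elim: (n) => [|m IH]; first by rewrite !addn0.
    rewrite !addnS preS size_cat -addn1; have [h _ _] := hseg (i + m)%N; exact: (leq_add IH h).
  rewrite (yE _ _ ps); split; last by rewrite es nth_cat ltnNge leq_addr/= addKn.
  by move: ps; rewrite es size_cat ltn_add2l.
move=> N0; pose j := N0; pose N := (size (pre j)).
have [h1 _ h3] := hseg j; pose s := F (j, N).
have szj : size (pre j.+1) = (N + size s)%N by rewrite preS size_cat.
exists (N + size s).-1.
  have := size_pre j; rewrite -/N /j; move: h1; rewrite -/N -/s; clear; lia.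
rewrite prednK ?addn_gt0 ?pre_gt0//.
have N1 : (1 <= N)%N := pre_gt0 j.
rewrite (big_cat_nat N1 (leq_addr _ _))/=.
have e2 : \sum_(N <= n < N + size s) val (y n) * b (a n) = corr (suffix_from N a) s.
  rewrite -{1}[N]add0n big_addn addKn big_mkord; apply: eq_bigr => i _.
  rewrite mulrC /suffix_from addnC; congr (b (a _) * val _).
  by rewrite (yE j.+1) ?szj ?ltn_add2l// preS nth_cat ltnNge leq_addr/= addKn.
have e1 : - (B * N%:R) <= \sum_(1 <= n < N) val (y n) * b (a n).
  have : `|\sum_(1 <= n < N) val (y n) * b (a n)| <= B * N%:R.
    rewrite (le_trans (ler_norm_sum _ _ _))// (le_trans (ler_sum (G := fun=> B) _ _))//.
      by move=> i _; rewrite normrM -[leRHS]mul1r ler_pM.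
    rewrite sumr_const_nat -[leLHS]mulr_natr ler_wpM2l ?(ltW B0)// ler_nat leq_subr//.
  by rewrite ler_norml => /andP[].
rewrite e2; move: h3 e1; rewrite /= -/N -/s.
move: (\sum_(1 <= n < N) _) (corr _ _) (g / 4 * _) (B * _); move=> u1 u2 u3 u4 h2 h4; lra.
Qed.

End Segments.

(** * Subshifts of zero entropy *)

Section Subshift.
Variables (R : realType) (V : finType) (yy : int -> V).

(** The orbit closure of yy, described through the words of its points. *)
Definition in_language (x : int -> V) := forall (i : int) (n : nat), exists p : int,
  forall j : nat, (j < n)%N -> x (i + j%:Z) = yy (p + j%:Z).

Record subshift := Subshift { point_of :> int -> V; point_lang : in_language point_of }.

HB.instance Definition _ := gen_eqMixin subshift.
HB.instance Definition _ := gen_choiceMixin subshift.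

Lemma subshift_eq (x y : subshift) : (forall i, x i = y i) -> x = y.
Proof.
case: x y => x lx [y ly] /= xy; have e : x = y by apply/funext.
by rewrite e in lx *; congr Subshift; exact: Prop_irrelevance.
Qed.

Definition agreeZ n (x y : subshift) := forall i : int, (`|i| < n)%N -> x i = y i.

Lemma agreeZ_sym n x y : agreeZ n x y -> agreeZ n y x.
Proof. by move=> h i /h. Qed.

Definition gaps (x y : subshift) : set R :=
  [set s | s = 0 \/ exists n, ~ agreeZ n.+1 x y /\ s = n.+1%:R^-1].

(** The points at distance at least 1 / (n + 1) are those that differ somewhere
    on ]-(n + 1), n + 1[. The element 0 of gaps covers the case of equal
    points. *)
Definition dist x y : R := sup (gaps x y).

Lemma gaps_has_sup x y : has_sup (gaps x y).
Proof.
split; first by exists 0; left.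
exists 1 => s [->//|[n [_ ->]]]; by rewrite invf_le1 ?ltr0n// ler1n.
Qed.

Lemma dist_ge0 x y : 0 <= dist x y.
Proof. by apply: ub_le_sup; [case: (gaps_has_sup x y)|left]. Qed.

Lemma dist_ge n x y : ~ agreeZ n.+1 x y -> n.+1%:R^-1 <= dist x y.
Proof. by move=> h; apply: ub_le_sup; [case: (gaps_has_sup x y)|right; exists n]. Qed.

Lemma dist_le n x y : agreeZ n x y -> dist x y <= n.+1%:R^-1.
Proof.
move=> h; apply: ge_sup; first by case: (gaps_has_sup x y).
move=> s [->|[m [hm ->]]]; first by rewrite invr_ge0.
rewrite lef_pV2 ?posrE// ler_nat ltnS leqNgt; apply/negP => mn; apply: hm => i im.
by apply: h; apply: leq_trans im mn.
Qed.

Lemma dist_lt n x y : dist x y < n.+1%:R^-1 -> agreeZ n.+1 x y.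
Proof. by move=> h; apply: contrapT => /dist_ge; rewrite leNgt h. Qed.

Lemma distxx x : dist x x = 0.
Proof.
apply/eqP; rewrite eq_le dist_ge0 andbT; apply: ge_sup; first by case: (gaps_has_sup x x).
by move=> s [->//|[n [[]]]].
Qed.

Lemma dist_positivity x y : dist x y = 0 -> x = y.
Proof.
move=> h; apply: subshift_eq => i; apply: (@dist_lt `|i|%N) => //.
by rewrite h invr_gt0.
Qed.

Lemma dist_sym x y : dist x y = dist y x.
Proof.
rewrite /dist; congr sup; apply/seteqP; split => s [->|[n [h ->]]]; try by left.
- by right; exists n; split => // /agreeZ_sym.
- by right; exists n; split => // /agreeZ_sym.
Qed.

Lemma dist_triangle y x z : dist x z <= dist x y + dist y z.
Proof.
apply: ge_sup; first by case: (gaps_has_sup x z).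
move=> s [->|[n [h ->]]]; first by rewrite addr_ge0 ?dist_ge0.
have [hxy|/dist_ge hxy] := pselect (agreeZ n.+1 x y); last first.
  by apply: le_trans hxy _; rewrite lerDl dist_ge0.
have [hyz|/dist_ge hyz] := pselect (agreeZ n.+1 y z); last first.
  by apply: le_trans hyz _; rewrite lerDr dist_ge0.
by exfalso; apply: h => i ii; rewrite hxy// hyz.
Qed.

HB.instance Definition _ := @isMetric.Build R subshift dist distxx dist_positivity
  dist_sym dist_triangle.

Lemma mdistE (x y : subshift) : mdist x y = dist x y.
Proof. by []. Qed.

Lemma nbhs_agreeZ (x : subshift) (A : set subshift) :
  nbhs x A <-> exists n, forall y, agreeZ n x y -> A y.
Proof.
split=> [/nbhs_ballP[e /= e0 h]|[n h]].
  have [n _ hn] := nbhs_infty_ger e^-1; exists n => y xy; apply: h.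
  rewrite ballEmdist /= mdistE; apply: le_lt_trans (dist_le xy) _.
  rewrite invf_plt ?posrE//; apply: le_lt_trans (hn n (leqnn n)) _; by rewrite ltr_nat.
apply/nbhs_ballP; exists n.+1%:R^-1; first by rewrite /= invr_gt0.
move=> y; rewrite ballEmdist /= mdistE => /dist_lt xy; apply: h => i ii.
by apply: xy; apply: leqW.
Qed.

Lemma continuous_agreeZ (U : topologicalType) (F : subshift -> U) n :
  (forall x y, agreeZ n x y -> F x = F y) -> continuous F.
Proof.
move=> h x A /nbhs_singleton Ax; rewrite /nbhs /=; apply/nbhs_agreeZ; exists n => y /h e.
by rewrite /preimage /= -e.
Qed.

Lemma shift_lang (d : int) (x : subshift) : in_language (fun k => x (k + d)).
Proof.
move=> i n; have [p hp] := point_lang x (i + d) n; exists p => j jn.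
by rewrite -hp// addrAC.
Qed.

Definition translate d (x : subshift) : subshift := Subshift (shift_lang d x).

Lemma continuous_translate d : continuous (translate d).
Proof.
move=> x A /nbhs_agreeZ[n hn]; rewrite /nbhs /=; apply/nbhs_agreeZ.
exists (n + `|d|)%N => y xy; apply: hn => i ii /=; apply: xy; lia.
Qed.

Definition shiftmap := translate 1.

Lemma iter_shiftmap n x i : iter n shiftmap x i = x (i + n%:Z).
Proof.
elim: n i => [|n IH] i; first by rewrite addr0.
by rewrite iterS /= IH -addrA; congr (point_of x _); rewrite -natr1 /= ; lia.
Qed.

Lemma homeo_shiftmap : homeomorphism shiftmap.
Proof.
split; first exact: continuous_translate.
exists (translate (-1)); first exact: continuous_translate.
by split=> x; apply: subshift_eq => i /=; rewrite ?subrK ?addrK.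
Qed.

(** An ultrafilter chooses one letter at each position; it converges to the
    sequence of these letters. *)
Lemma compact_subshift : compact [set: subshift].
Proof.
rewrite compact_ultra => F UF _.
have letter (i : int) : exists v, F [set x : subshift | x i = v].
  apply: contrapT => none.
  have : F [set x : subshift | forall v, ~ x i = v].
    apply: filter_forall => v.
    have [Fv|Fv] := in_ultra_setVsetC [set x : subshift | x i = v] UF; last exact: Fv.
    by exfalso; apply: none; exists v.
  by move=> /filter_ex[x /(_ (x i))]; apply.
have [z hz] := boolp.choice letter.
have window n : F [set x : subshift | forall i : int, (`|i| < n)%N -> x i = z i].
  elim: n => [|n IH]; first by apply: filterS filterT => x _ i.
  apply: filterS (filterI IH (filterI (hz n%:Z) (hz (- n%:Z)))) => x [h [/= h1 h2]] i.
  rewrite ltnS leq_eqVlt => /predU1P[e|]; last exact: h.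
  by have [->|->] : i = n%:Z \/ i = - n%:Z by lia.
have zl : in_language z.
  move=> i n; have [x hx] := filter_ex (window (`|i| + n).+1).
  have [p hp] := point_lang x i n; exists p => j jn; rewrite -hp//; apply/esym/hx; lia.
exists (Subshift zl); split => // A /nbhs_agreeZ[n hn].
by apply: filterS (window n) => x hx; apply: hn => i ii /=; rewrite hx.
Qed.

Hypothesis few_factors : forall d : R, 0 < d -> exists2 C : R, 0 < C &
  forall n, exists l : seq (seq V),
    (forall p : int, mkseq (fun j => yy (p + j%:Z)) n \in l) /\
    (size l)%:R <= C * expR (d * n%:R).

(** Points that are e-separated under n iterates have different words on [- q,
    n + q), where 1 / (q + 1) <= e. *)
Lemma separated_le (d e : R) : 0 < d -> 0 < e -> exists2 C : R, 0 < C & forall n,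
  (separated_card shiftmap n e <= (C * expR (d * n%:R))%:E)%E.
Proof.
move=> d0 e0; have [C C0 hC] := few_factors d0.
have [q _ hq] := nbhs_infty_ger e^-1.
have qe : q.+1%:R^-1 <= e.
  rewrite -(invrK e) lef_pV2 ?posrE ?invr_gt0//; apply: le_trans (hq q (leqnn q)) _.
  by rewrite ler_nat.
exists (C * expR (d * (q + q)%:R)); first by rewrite mulr_gt0// expR_gt0.
move=> n; apply: ge_ereal_sup => _ [E Esep <-]; rewrite lee_fin.
have [l [hl cl]] := hC (n + (q + q))%N.
apply: (@le_trans _ _ ((size l)%:R)); last first.
  by apply: le_trans cl _; rewrite natrD mulrDr expRD -mulrA [expR _ * expR _]mulrC mulrA.
rewrite ler_nat.
pose code (x : subshift) := mkseq (fun j => x (- q%:Z + j%:Z)) (n + (q + q)).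
have code_l x : code x \in l.
  have [p hp] := point_lang x (- q%:Z) (n + (q + q)).
  rewrite (_ : code x = mkseq (fun j => yy (p + j%:Z)) (n + (q + q))) ?hl//.
  apply: (@eq_from_nth _ (yy 0)); rewrite !size_mkseq// => j jn.
  by rewrite !nth_mkseq// hp.
have inj x y : x \in E -> y \in E -> code x = code y -> x = y.
  move=> xE yE xy; apply/eqP; apply: contraT => /(Esep x y xE yE)[i i_n].
  rewrite mdistE => /(le_lt_trans qe); rewrite ltNge => /negP[]; apply: dist_le => k kq.
  rewrite !iter_shiftmap.
  have [j jE] : exists j : nat, k + i%:Z = - q%:Z + j%:Z.
    by exists (absz (k + i%:Z + q%:Z)); lia.
  have jn : (j < n + (q + q))%N by lia.
  by have := congr1 (fun s => nth (yy 0) s j) xy; rewrite !nth_mkseq// jE.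
rewrite -(size_map code (enum_fset E)).
apply: uniq_leq_size; last by move=> _ /mapP[x _ ->].
by rewrite map_inj_in_uniq ?fset_uniq// => x y; exact: inj.
Qed.

Lemma entropy_at_le (d e : R) : 0 < d -> 0 < e -> (entropy_at shiftmap e <= (d + d)%:E)%E.
Proof.
move=> d0 e0; have [C C0 hC] := separated_le d0 e0.
have [N _ hN] := nbhs_infty_ger (ln C / d).
rewrite /entropy_at /limn_esup; apply: (@le_trans _ _ (ereal_sup ((fun n =>
   ((n%:R^-1)%:E * lne (separated_card shiftmap n e))%E) @` [set n | (N < n)%N]))).
  by apply: ereal_inf_lbound; exists [set n | (N < n)%N] => //; exists N.+1.
apply: ge_ereal_sup => _ [n /= Nn <-].
have n0 : 0 < n%:R :> R by rewrite ltr0n; apply: leq_trans Nn.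
apply: (@le_trans _ _ ((n%:R^-1)%:E * (ln C + d * n%:R)%:E)%E); last first.
  rewrite -EFinM lee_fin mulrC ler_pdivrMr// mulrDl lerD2r -ler_pdivrMl// mulrC.
  by apply: hN; exact: ltnW.
apply: lee_wpmul2l; first by rewrite lee_fin invr_ge0 ltW.
have CE : 0 < C * expR (d * n%:R) by rewrite mulr_gt0// expR_gt0.
have := hC n; case: (separated_card _ _ _) => [s|//|_]; rewrite ?leNye//.
rewrite lee_fin /=; case: ifPn => [_|]; first by rewrite leNye.
rewrite -ltNge => s0 sC; rewrite lee_fin.
by rewrite -[X in _ <= _ + X]expRK -lnM ?posrE ?expR_gt0// ler_ln.
Qed.

Lemma generator_lang : in_language yy.
Proof. by move=> i n; exists i. Qed.

Definition generator : subshift := Subshift generator_lang.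

Lemma zero_entropy_subshift : zero_entropy_system shiftmap.
Proof.
split; [exact: compact_subshift|exact: homeo_shiftmap|].
apply/eqP; rewrite eq_le; apply/andP; split.
  apply: ge_ereal_sup => _ [e /= e0 <-]; apply/lee_addgt0Pr => d d0; rewrite add0e.
  by rewrite [d]splitr; apply: entropy_at_le => //; rewrite divr_gt0.
apply: (@le_trans _ _ (entropy_at shiftmap 1)); last first.
  by apply: ereal_sup_ubound; exists 1 => //=; exact: ltr01.
rewrite /entropy_at /limn_esup; apply: le_ereal_inf_tmp => _ [S [N _ hN] <-].
apply: (@le_trans _ _ ((N.+1%:R^-1)%:E * lne (separated_card shiftmap N.+1 1))%E); last first.
  by apply: ereal_sup_ubound; exists N.+1 => //; apply: hN => /=; exact: leqnSn.
apply: mule_ge0; first by rewrite lee_fin.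
have : (1 <= separated_card shiftmap N.+1 1)%E.
  apply: ereal_sup_ubound; exists [fset generator]%fset; last by rewrite cardfs1.
  by move=> x y /fset1P -> /fset1P ->; rewrite eqxx.
case: (separated_card _ _ _) => [s||]; [|move=> _; by rewrite leey|by []].
rewrite lee_fin => s1; have s0 : 0 < s by apply: lt_le_trans s1.
by rewrite lne_EFin// lee_fin ln_ge0.
Qed.

Theorem zero_entropy_realization :
  exists (X : metricType R) (T : X -> X), zero_entropy_system T /\
  forall (U : topologicalType) (g : V -> U), exists (f : X -> U) (x : X),
    continuous f /\ forall n : nat, f (iter n T x) = g (yy n%:Z).
Proof.
exists subshift, shiftmap; split; first exact: zero_entropy_subshift.
move=> U g; exists (fun x : subshift => g (x 0)), generator; split=> [|n].
  by apply: (@continuous_agreeZ _ _ 1) => x y ->.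
by rewrite iter_shiftmap add0r.
Qed.

End Subshift.

(** * Decoupling by exponential martingales *)

Lemma expR_le_quadratic (R : realType) (t : R) : t <= 1 / 2 -> expR t <= 1 + t + 2 * t ^+ 2.
Proof.
move=> t2; have h := expR_ge1Dx (- t).
have p : 0 < 1 - t by lra.
have : expR t <= (1 - t)^-1.
  by rewrite -[expR t]invrK -expRN lef_pV2 ?posrE ?expR_gt0.
move=> /le_trans; apply; rewrite -[leLHS]mul1r ler_pdivrMr//; nra.
Qed.

Section Martingale.
Variables (R : realType) (A : finType) (a : nat -> A).
Hypothesis freq : has_frequencies R a.
Local Notation E := (freq_mean a).
Variables (b : A -> R) (B : R).
Hypothesis B0 : 0 < B.
Hypothesis bB : forall c, `|b c| <= B.
Local Notation condE := (@condE R A a b).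

Variables (m : nat).
Hypothesis m0 : (0 < m)%N.

(** With X_i = b(x_(i m)), this is the sum of w_i (X_i - E (X_i | x_((i + 1)
    m), ..., x_(n m - 1))). Each difference is centered given the later part of
    the sequence, so the terms are the differences of a martingale in reverse
    time, and the recursion removes the last one revealed. *)
Fixpoint mart n (w : nat -> R) (x : nat -> A) : R :=
  if n is n'.+1 then
    w 0%N * (b (x 0%N) - condE m (win m (n' * m) x)) + mart n' (fun i => w i.+1) (suffix_from m x)
  else 0.

Fixpoint drift n (x : nat -> A) : R :=
  if n is n'.+1 then `|condE m (win m (n' * m) x)| + drift n' (suffix_from m x) else 0.

Lemma local_mart n w : local (n * m) (mart n w).
Proof.
elim: n w => [//|n IH] w x y xy /=.
rewrite (xy 0%N) ?muln_gt0// (win_agree xy) ?mulSn//; congr (_ + _).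
by apply: IH => i im; apply: xy; rewrite mulSn ltn_add2l.
Qed.

Lemma local_drift n : local (n * m) (drift n).
Proof.
elim: n => [//|n IH] x y xy /=.
rewrite (win_agree xy) ?mulSn//; congr (_ + _).
by apply: IH => i im; apply: xy; rewrite mulSn ltn_add2l.
Qed.

Lemma martN n w x : mart n (fun i => - w i) x = - mart n w x.
Proof. by elim: n w x => [|n IH] w x /=; rewrite ?oppr0// IH mulNr opprD. Qed.

(** What mart leaves out of the sum is the predictable part. *)
Lemma mart_drift (F : R) n (w : nat -> R) x : (forall i, `|w i| <= F) ->
  `|\sum_(i < n) w i * b (x (i * m)%N) - mart n w x| <= F * drift n x.
Proof.
elim: n w x => [|n IH] w x wF /=; first by rewrite big_ord0 subrr normr0 mulr0.
have F0 : 0 <= F by apply: le_trans (wF 0%N).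
rewrite big_ord_recl/= mul0n [leRHS]mulrDr.
have := IH (fun i => w i.+1) (suffix_from m x) (fun i => wF i.+1).
rewrite (eq_bigr (fun i : 'I_n => w i.+1 * b (x (i.+1 * m)%N))); last first.
  by move=> i _; rewrite /suffix_from mulSn.
set S := \sum_(i < n) _; set Mn := mart _ _ _ => h.
rewrite (_ : _ - _ = w 0%N * condE m (win m (n * m) x) + (S - Mn)); last by ring.
apply: le_trans (ler_normD _ _) _; rewrite lerD// normrM ler_wpM2r//.
Qed.

(** Given the window that starts at m, the first difference is centered, so
    that exp t <= 1 + t + 2 t ^ 2 makes it contribute a factor 1 + c <= exp c;
    stationarity and induction bound the other factors. *)
Lemma E_exp_mart (F lam : R) n (w : nat -> R) : 0 < F -> 0 < lam -> 2 * lam * F * B <= 1 / 2 ->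
  (forall i, `|w i| <= F) ->
  E (fun x => expR (lam * mart n w x)) <= expR (8 * lam ^+ 2 * F ^+ 2 * B ^+ 2 * n%:R).
Proof.
move=> F0 lam0 small; set c := 8 * _ * _ * _.
have c0 : 0 <= c by rewrite /c !mulr_ge0 ?exprn_ge0// ltW.
elim: n w => [|n IH] w wF; first by rewrite /= mulr0 E_cst// mulr0.
pose w' i := w i.+1; pose M := (n.+1 * m)%N.
pose D x := b (x 0%N) - condE m (win m (n * m) x).
pose psi (v : (n * m).-tuple A) := expR (lam * mart n w' (pad a v)).
have psiE x : expR (lam * mart n w' (suffix_from m x)) = psi (win m (n * m) x).
  rewrite /psi; congr (expR (_ * _)); apply: local_mart => i im.
  by rewrite /pad nth_win.
have lM (g : (n * m).-tuple A -> R) : local M (fun x => g (win m (n * m) x)).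
  by move=> x y xy; rewrite (win_agree xy)// /M mulSn.
have lD : local M D.
  by move=> x y xy; rewrite /D (xy 0%N) ?muln_gt0// (win_agree xy)// /M mulSn.
have DB x : `|D x| <= 2 * B.
  apply: le_trans (ler_normB _ _) _; rewrite mulr2n mulrDl mul1r lerD//.
  exact: (condE_le freq _ _ (ltW B0)).
have ED0 : E (fun x => D x * psi (win m (n * m) x)) = 0.
  rewrite (_ : (fun x => _) = (fun x => b (x 0%N) * psi (win m (n * m) x) -
      condE m (win m (n * m) x) * psi (win m (n * m) x))); last first.
    by apply/funext => x; rewrite /D mulrBl.
  rewrite (@EB _ _ _ freq M).
  - by rewrite (E_tower freq b m) subrr.
  - by move=> x y xy; rewrite (lM psi _ _ xy) (xy 0%N) ?muln_gt0.
  - exact: (lM (fun v => condE m v * psi v)).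
apply: (@le_trans _ _ (E (fun x => (1 + c) * psi (win m (n * m) x) +
    lam * w 0%N * (D x * psi (win m (n * m) x))))).
  apply: (@ler_E _ _ _ freq M).
  - by move=> x y xy; rewrite (local_mart _ xy).
  - by move=> x y xy; rewrite (lM psi _ _ xy) (lD _ _ xy).
  - move=> x /=; rewrite -/(D x) mulrDr expRD psiE.
    set p := psi _; have p0 : 0 <= p by exact: expR_ge0.
    have tE : `|lam * (w 0%N * D x)| <= 2 * lam * F * B.
      rewrite !normrM (gtr0_norm lam0).
      have : `|w 0%N| * `|D x| <= F * (2 * B) by rewrite ler_pM.
      move=> h; have := ler_wpM2l (ltW lam0) h.
      by move=> /le_trans; apply; rewrite le_eqVlt; apply/orP; left; apply/eqP; ring.
    have t2 : lam * (w 0%N * D x) <= 1 / 2.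
      by apply: le_trans small; apply: le_trans tE; exact: ler_norm.
    have tt : 2 * (lam * (w 0%N * D x)) ^+ 2 <= c.
      rewrite -(real_normK (num_real (lam * (w 0%N * D x)))).
      apply: (@le_trans _ _ (2 * (2 * lam * F * B) ^+ 2)); last first.
        by rewrite le_eqVlt; apply/orP; left; apply/eqP; rewrite /c; ring.
      by rewrite ler_pM2l// ler_sqr ?nnegrE// !mulr_ge0// ltW.
    have h2 := ler_wpM2r p0 (expR_le_quadratic t2).
    have h1 := ler_wpM2r p0 tt.
    apply: le_trans h2 _.
    rewrite (_ : lam * w 0%N * (D x * p) = lam * (w 0%N * D x) * p); last by ring.
    rewrite [leLHS]mulrDl; apply: le_trans (lerD (lexx _) h1) _.
    by rewrite le_eqVlt; apply/orP; left; apply/eqP; ring.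
rewrite (@ED _ _ _ freq M).
- rewrite (@EZ _ _ _ freq M); last exact: (lM psi).
  rewrite (@EZ _ _ _ freq M); last by move=> x y xy; rewrite (lM psi _ _ xy) (lD _ _ xy).
  rewrite ED0 mulr0 addr0 -natr1 mulrDr mulr1 [X in expR X]addrC expRD.
  rewrite ler_pM ?expR_ge1Dx//.
  + by rewrite addr_ge0.
  + by apply: (@E_ge0 _ _ _ freq M) => [|x]; [exact: (lM psi)|exact: expR_ge0].
  have := IH w' (fun i => wF i.+1).
  rewrite -(@E_shift _ _ _ freq (n * m) (fun x => expR (lam * mart n w' x)) m); last first.
    by move=> x y xy; rewrite (local_mart _ xy).
  have -> : (fun x => psi (win m (n * m) x)) =
      (fun x => expR (lam * mart n w' (suffix_from m x))).
    by apply/funext => x; rewrite psiE.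
  by [].
- by move=> x y xy; rewrite (lM psi _ _ xy).
- by move=> x y xy; rewrite (lM psi _ _ xy) (lD _ _ xy).
Qed.

End Martingale.

Section Decoupling.
Variables (R : realType) (A : finType) (a : nat -> A).
Hypothesis freq : has_frequencies R a.
Local Notation E := (freq_mean a).
Variables (b : A -> R) (B : R).
Hypothesis B0 : 0 < B.
Hypothesis bB : forall c, `|b c| <= B.
Local Notation condE := (@condE R A a b).

Lemma E_drift m n (tau : R) : (0 < m)%N ->
  (forall l, E (fun x => `|condE m (win m l x)|) <= tau) -> E (drift a b m n) <= tau * n%:R.
Proof.
move=> m0 h; elim: n => [|n IH]; first by rewrite mulr0 /= E_cst.
pose M := (n.+1 * m)%N.
have l1 : local M (fun x => `|condE m (win m (n * m) x)|).
  by move=> x y xy; rewrite (win_agree xy)// /M mulSn.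
have l2 : local M (fun x => drift a b m n (suffix_from m x)).
  by rewrite /M mulSn; apply: local_suffix; exact: local_drift.
have -> : drift a b m n.+1 = (fun x => `|condE m (win m (n * m) x)| +
    drift a b m n (suffix_from m x)) by [].
rewrite (@ED _ _ _ freq M)// -natr1 mulrDr mulr1 addrC lerD//.
by rewrite (@E_shift _ _ _ freq (n * m))//; exact: local_drift.
Qed.

(** A single local function Phi dominates the sums for all S patterns. The
    inequality 1 + t <= exp t, at t = lam `|M p| - K, bounds every martingale
    by the sum Q of all exponentials; the choice of K as a bound for ln (E Q)
    makes the mean of this bound at most K / lam, where S enters through its
    logarithm. *)
Lemma union_bound m n S (wt : 'I_S -> nat -> R) (F lam tau : R) :
  (0 < m)%N -> (0 < S)%N -> 0 < F -> 0 < lam -> 2 * lam * F * B <= 1 / 2 ->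
  (forall p i, `|wt p i| <= F) ->
  (forall l, E (fun x => `|condE m (win m l x)|) <= tau) ->
  exists Phi : (nat -> A) -> R, [/\ local (n * m) Phi,
    forall p x, `|\sum_(i < n) wt p i * b (x (i * m)%N)| <= Phi x &
    E Phi <= (ln (2 * S%:R) + 8 * lam ^+ 2 * F ^+ 2 * B ^+ 2 * n%:R) / lam + F * (tau * n%:R)].
Proof.
move=> m0 S0 F0 lam0 small wtF htau.
set c := 8 * _ * _ * _; pose K := ln (2 * S%:R) + c * n%:R.
pose M p := mart a b m n (wt p).
have lM p : local (n * m) (M p) by exact: local_mart.
pose Q x := \sum_(p < S) (expR (lam * M p x) + expR (lam * - M p x)).
have lQ : local (n * m) Q.
  by move=> x y xy; apply: eq_bigr => p _; rewrite (lM p _ _ xy).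
have EQ : E Q <= expR K.
  rewrite /Q (@E_sum _ _ _ freq (n * m)); last first.
    by move=> p _ x y xy; rewrite (lM p _ _ xy).
  rewrite (le_trans (ler_sum (G := fun=> 2 * expR (c * n%:R)) _ _))//.
    move=> p _; rewrite (@ED _ _ _ freq (n * m)).
    - rewrite mulr2n mulrDl mul1r lerD//.
        exact: (E_exp_mart freq B0 bB m0 n F0 lam0 small (wtF p)).
      have -> : (fun x => expR (lam * - M p x)) =
          (fun x => expR (lam * mart a b m n (fun i => - wt p i) x)).
        by apply/funext => x; rewrite martN.
      apply: (E_exp_mart freq B0 bB m0 n F0 lam0 small) => i; by rewrite normrN.
    - by move=> x y xy; rewrite (lM p _ _ xy).
    - by move=> x y xy; rewrite (lM p _ _ xy).
  rewrite sumr_const card_ord -[leLHS]mulr_natr /K expRD lnK ?posrE ?mulr_gt0 ?ltr0n//.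
  by rewrite mulrAC.
pose G x := (K - 1 + expR (- K) * Q x) / lam.
have lG : local (n * m) G by move=> x y xy; rewrite /G (lQ _ _ xy).
exists (fun x => G x + F * drift a b m n x).
split.
- by move=> x y xy; rewrite (lG _ _ xy) (local_drift _ _ xy).
- move=> p x; have := mart_drift a b m n x (wtF p).
  rewrite -/(M p) => h1.
  have h2 : `|M p x| <= G x.
    have h0 := expR_ge1Dx (lam * `|M p x| - K); rewrite expRB in h0.
    have hQ : expR (lam * `|M p x|) <= Q x.
      rewrite /Q (bigD1 p)//=.
      have : 0 <= \sum_(i < S | i != p) (expR (lam * M i x) + expR (lam * - M i x)).
        by apply: sumr_ge0 => i _; rewrite addr_ge0 ?expR_ge0.
      have := expR_ge0 (lam * M p x); have := expR_ge0 (lam * - M p x).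
      by case: (leP 0 (M p x)) => h; rewrite ?(ger0_norm h) ?(ltr0_norm h); lra.
    have hK : expR (lam * `|M p x|) / expR K <= Q x / expR K.
      by rewrite ler_pM2r ?invr_gt0 ?expR_gt0.
    rewrite /G ler_pdivlMr// expRN [(expR K)^-1 * _]mulrC [_ * lam]mulrC.
    have := le_trans h0 hK; move: (Q x / expR K) (lam * _) => u v; lra.
  have := ler_normD (\sum_(i < n) wt p i * b (x (i * m)%N) - M p x) (M p x).
  rewrite subrK => h3; apply: le_trans h3 _; rewrite /= [leLHS]addrC; exact: lerD.
- rewrite (@ED _ _ _ freq (n * m))//; last by move=> x y xy; rewrite (local_drift _ _ xy).
  rewrite (@EZ _ _ _ freq (n * m) F (drift a b m n)); last exact: local_drift.
  rewrite lerD//; last first.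
    by rewrite ler_pM2l//; exact: E_drift.
  have -> : G = (fun x => (K - 1) / lam + (expR (- K) / lam) * Q x).
    by apply/funext => x; rewrite /G mulrDl mulrAC.
  rewrite (@ED _ _ _ freq (n * m))//; last by move=> x y xy; rewrite (lQ _ _ xy).
  rewrite E_cst// (@EZ _ _ _ freq (n * m))// -/K mulrAC -mulrDl ler_pM2r ?invr_gt0//.
  have : expR (- K) * E Q <= 1.
    by rewrite expRN mulrC ler_pdivrMr ?expR_gt0// mul1r.
  lra.
Qed.

Lemma shifted_sum (g : nat -> R) (G : R) d N : (forall k, `|g k| <= G) ->
  `|\sum_(1 <= k < N.+1) g (k + d)%N - \sum_(1 <= k < N.+1) g k| <= 2 * d%:R * G.
Proof.
move=> gG; elim: d => [|d IH].
  rewrite mulr0 mul0r (eq_bigr g) ?subrr ?normr0// => k _; by rewrite addn0.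
have e : \sum_(1 <= k < N.+1) g (k + d.+1)%N - \sum_(1 <= k < N.+1) g (k + d)%N =
    g (N.+1 + d)%N - g (1 + d)%N.
  rewrite -sumrB (eq_bigr (fun k => g (k.+1 + d)%N - g (k + d)%N)); last first.
    by move=> k _; rewrite addnS addSn.
  by rewrite (telescope_sumr (fun k => g (k + d)%N)).
rewrite -[X in X - _](subrK (\sum_(1 <= k < N.+1) g (k + d)%N)) e -addrA.
apply: le_trans (ler_normD _ _) _.
have h : `|g (N.+1 + d)%N - g (1 + d)%N| <= 2 * G.
  by apply: le_trans (ler_normB _ _) _; rewrite mulr2n mulrDl mul1r lerD.
rewrite -natr1; move: h IH; set u := `|_|; set v := `|_|; lra.
Qed.

(** Summing over translates by multiples of m changes a sum over [1, N] by
    boundary terms, which are negligible for large N. *)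
Lemma spaced_sum (g : nat -> R) (G : R) m n N : (forall k, `|g k| <= G) ->
  `|n%:R * \sum_(1 <= k < N.+1) g k| <=
  \sum_(1 <= k < N.+1) `|\sum_(i < n) g (k + i * m)%N| + 2 * (n * (n * m))%:R * G.
Proof.
move=> gG; have G0 : 0 <= G by apply: le_trans (gG 0%N).
have -> : n%:R * \sum_(1 <= k < N.+1) g k =
  \sum_(1 <= k < N.+1) \sum_(i < n) g (k + i * m)%N -
  \sum_(i < n) (\sum_(1 <= k < N.+1) g (k + i * m)%N - \sum_(1 <= k < N.+1) g k).
  rewrite sumrB exchange_big/= opprB addrC subrK sumr_const card_ord mulr_natl//.
apply: le_trans (ler_normB _ _) _; rewrite lerD ?ler_norm_sum//.
rewrite (le_trans (ler_norm_sum _ _ _))// (le_trans (ler_sum (G := fun=> 2 * (n * m)%:R * G) _ _))//.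
  move=> i _; apply: le_trans (shifted_sum _ _ gG) _.
  by rewrite ler_wpM2r// ler_pM2l// ler_nat leq_mul2r ltnW ?orbT.
by rewrite sumr_const card_ord -[leLHS]mulr_natl (natrM _ n (n * m)) le_eqVlt; apply/orP; left; apply/eqP; ring.
Qed.

(** The future is uninformative about b(x_0), and phi has few patterns on long
    windows. *)
Hypothesis condE_small : forall tau : R, 0 < tau -> exists2 m, (0 < m)%N &
  forall l, E (fun x => `|condE m (win m l x)|) <= tau.

Variables (phi : nat -> R) (F : R).
Hypothesis F0 : 0 < F.
Hypothesis phiF : forall k, `|phi k| <= F.
Hypothesis cover : forall e d : R, 0 < e -> 0 < d -> exists W0, forall W, (W0 <= W)%N ->
  exists (S : nat) (wt : 'I_S -> nat -> R),
    [/\ S%:R <= expR (d * W%:R), forall p i, `|wt p i| <= F &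
    forall k, exists p, forall i, (i < W)%N -> `|phi (k + i)%N - wt p i| <= e].

(** At each time k, the values of phi at k, k + m, k + 2 m, ... are close to
    one of few patterns, so the corresponding sum of products is dominated by
    the function Phi of union_bound at the suffix of a from k. The frequency of
    Phi along a is small compared with the number of samples. *)
Theorem decoupling : (fun N => N%:R^-1 * \sum_(1 <= k < N.+1) phi k * b (a k)) @ \oo --> (0 : R).
Proof.
apply/cvgrPdist_le => rho rho0.
have [m m0 htau] := condE_small (tau := rho / 12 / F) (divr_gt0 (divr_gt0 rho0 (ltr0n _ 12)) F0).
pose lam := Num.min (1 / (4 * F * B)) (rho / 12 / (8 * F ^+ 2 * B ^+ 2)).
have FB0 : 0 < F * B by rewrite mulr_gt0.
have lam0 : 0 < lam.
  by rewrite lt_min !divr_gt0// ?mulr_gt0// ?exprn_gt0.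
have small : 2 * lam * F * B <= 1 / 2.
  have : lam <= 1 / (4 * F * B) by rewrite ge_min lexx.
  rewrite ler_pdivlMr ?mulr_gt0//; lra.
have small2 : 8 * lam * F ^+ 2 * B ^+ 2 <= rho / 12.
  have : lam <= rho / 12 / (8 * F ^+ 2 * B ^+ 2) by rewrite ge_min lexx orbT.
  rewrite ler_pdivlMr ?mulr_gt0// ?exprn_gt0//; lra.
pose e := rho / 12 / B; have e0 : 0 < e by rewrite !divr_gt0.
have mR : 0 < m%:R :> R by rewrite ltr0n.
pose d := lam * (rho / 12) / m%:R; have d0 : 0 < d by rewrite divr_gt0// mulr_gt0// divr_gt0.
have [W0 hW0] := cover e0 d0.
have [n1 _ hn1] := nbhs_infty_ger (ln 2 / (lam * (rho / 12))).
pose n := (maxn W0 n1).+1; have n0 : (0 < n)%N by [].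
have nR : 0 < n%:R :> R by rewrite ltr0n.
have [|S [wt [cS wtF hwt]]] := hW0 (n * m)%N.
  by apply: (@leq_trans n); [rewrite /n ltnW// ltnS leq_maxl|rewrite leq_pmulr].
have S0 : (0 < S)%N by have [p _] := hwt 0%N; apply: leq_ltn_trans (ltn_ord p).
have [Phi [lPhi hPhi EPhi]] := @union_bound m n S (fun p i => wt p (i * m)%N) F lam _
  m0 S0 F0 lam0 small (fun p i => wtF p (i * m)%N) htau.
have EPhi2 : E Phi <= n%:R * (rho / 3).
  apply: le_trans EPhi _.
  have h1 : ln (2 * S%:R) / lam <= n%:R * (rho / 6).
    rewrite ler_pdivrMr// lnM ?posrE ?ltr0n//.
    have : ln 2 <= n%:R * (lam * (rho / 12)).
      rewrite -ler_pdivrMr ?mulr_gt0 ?divr_gt0//; apply: hn1 => /=.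
      by rewrite /n ltnW// ltnS leq_maxr.
    have : ln S%:R <= n%:R * (lam * (rho / 12)).
      rewrite -[leRHS]expRK ler_ln ?posrE ?expR_gt0 ?ltr0n//; apply: le_trans cS _.
      by rewrite ler_expR /d natrM le_eqVlt; apply/orP; left; apply/eqP; field; rewrite gt_eqF.
    lra.
  have h2 : 8 * lam ^+ 2 * F ^+ 2 * B ^+ 2 * n%:R / lam <= n%:R * (rho / 12).
    rewrite (_ : _ / lam = n%:R * (8 * lam * F ^+ 2 * B ^+ 2)) ?ler_pM2l//.
    by field; rewrite gt_eqF.
  have h3 : F * (rho / 12 / F * n%:R) = n%:R * (rho / 12) by field; rewrite gt_eqF.
  rewrite mulrDl h3; apply: le_trans (lerD (lerD h1 h2) (lexx _)) _.
  by rewrite le_eqVlt; apply/orP; left; apply/eqP; field.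
have := E_cvg freq lPhi => /cvgrPdist_lt/(_ (n%:R * (rho / 6))).
rewrite mulr_gt0 ?divr_gt0// => /(_ isT)[N1 _ hN1].
pose G := F * B.
have gG k : `|phi k * b (a k)| <= G by rewrite normrM /G ler_pM.
near=> N.
have N0 : (0 < N)%N by near: N; exists 1%N.
have NR : 0 < N%:R :> R by rewrite ltr0n.
rewrite sub0r normrN normrM normfV (ger0_norm (ler0n _ N)) mulrC ler_pdivrMr//.
rewrite -(ler_pM2l nR) -[X in X * _ <= _](ger0_norm (ler0n _ n)) -normrM.
apply: le_trans (@spaced_sum _ G m n N gG) _.
have hk : \sum_(1 <= k < N.+1) `|\sum_(i < n) phi (k + i * m)%N * b (a (k + i * m)%N)| <=
    N%:R * (n%:R * (rho / 2) + n%:R * (e * B)).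
  apply: (@le_trans _ _ (\sum_(1 <= k < N.+1) (Phi (suffix_from k a) + n%:R * (e * B)))).
    apply: ler_sum => k _; have [p hp] := hwt k.
    have := hPhi p (suffix_from k a); rewrite /suffix_from => h1.
    have h2 : `|\sum_(i < n) (phi (k + i * m)%N - wt p (i * m)%N) * b (a (k + i * m)%N)| <= n%:R * (e * B).
      rewrite (le_trans (ler_norm_sum _ _ _))// (le_trans (ler_sum (G := fun=> e * B) _ _))//.
        by move=> i _; rewrite normrM ler_pM// hp// ltn_mul2r m0 ltn_ord.
      by rewrite sumr_const card_ord mulr_natl.
    have -> : \sum_(i < n) phi (k + i * m)%N * b (a (k + i * m)%N) =
      \sum_(i < n) wt p (i * m)%N * b (a (k + i * m)%N) +
      \sum_(i < n) (phi (k + i * m)%N - wt p (i * m)%N) * b (a (k + i * m)%N).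
      by rewrite -big_split/=; apply: eq_bigr => i _; ring.
    by apply: le_trans (ler_normD _ _) _; rewrite lerD.
  rewrite big_split/= sumr_const_nat subSS subn0 mulrDr -[_ *+ N]mulr_natl lerD2r.
  have avgle : avg a Phi N <= n%:R * (rho / 2).
    have : `|E Phi - avg a Phi N| < n%:R * (rho / 6).
      by apply: hN1 => /=; near: N; exact: nbhs_infty_ge.
    rewrite ltr_norml => /andP[h1 _]; move: h1 EPhi2.
    move: (E Phi) (avg _ _ _) => u v; lra.
  by rewrite mulrC -ler_pdivrMr// mulrC.
apply: le_trans (lerD hk (lexx _)) _.
have hbig : 2 * (n * (n * m))%:R * G <= N%:R * (n%:R * (rho / 12)).
  rewrite -ler_pdivrMr ?mulr_gt0 ?divr_gt0//; near: N; exact: nbhs_infty_ger.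
have eB : e * B = rho / 12 by rewrite /e divfK// gt_eqF.
have nn0 : 0 <= N%:R * (n%:R * rho) by rewrite !mulr_ge0 ?ler0n ?ltW.
rewrite eB; move: hbig nn0; move: (2 * _ * G) (N%:R : R) (n%:R : R) => u v w h1 h2; lra.
Unshelve. all: by end_near. Qed.

End Decoupling.

(** * Orbits of a system of zero entropy *)

Section Covers.
Variables (R : realType) (X : metricType R) (T : X -> X).
Hypothesis zeT : zero_entropy_system T.
Variable f : X -> R.
Hypothesis cf : continuous f.

Lemma uniformly_continuous (e : R) : 0 < e -> exists2 d : R, 0 < d &
  forall x y, mdist x y <= d -> `|f x - f y| <= e.
Proof.
move=> e0; have [cX _ _] := zeT; move: cX; rewrite compact_near_coveringP => ncX.
have : \forall d \near 0^'+, [set: X] `<=` (fun x => forall y, mdist x y <= d -> `|f x - f y| <= e).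
  apply: ncX => x _.
  have /cvgrPdist_le/(_ (e / 2)) := cf (x := x); rewrite divr_gt0// => /(_ isT).
  move=> /nbhs_ballP[r /= r0 hr].
  have xr : nbhs x (ball x (r / 2)) by apply: nbhsx_ballx; rewrite divr_gt0.
  have dr : \forall d \near (0:R)^'+, d < r / 2 by apply: nbhs_right_lt; rewrite divr_gt0.
  exists (ball x (r / 2), [set d : R | d < r / 2]) => //= -[z d] /= [xz dr2] y zy.
  have xz' : ball x r z by apply: le_ball xz; lra.
  have xy : ball x r y.
    rewrite ballEmdist /=; rewrite ballEmdist /= in xz.
    apply: le_lt_trans (metric_triangle x z y) _; lra.
  have := hr _ xz'; have := hr _ xy; rewrite /= !ler_norml; lra.
move=> h; have [d [d0 hd]] : exists d : R, 0 < d /\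
    [set: X] `<=` (fun x => forall y, mdist x y <= d -> `|f x - f y| <= e).
  have hpos : \forall d \near (0:R)^'+, 0 < d by exact: nbhs_right_gt.
  by have [d [h1 h2]] := filter_ex (filterI hpos h); exists d.
by exists d => // x y xy; apply: (hd x Logic.I).
Qed.

Lemma bounded_compact : exists2 F : R, 0 < F & forall x, `|f x| <= F.
Proof.
have [cX _ _] := zeT.
have cfX : {within [set: X], continuous f} by apply: continuous_subspaceT.
have /compact_bounded[M [_ hM]] := continuous_compact cfX cX.
exists (`|M| + 1) => [|x]; first by rewrite ltr_wpDl.
apply: hM; last by exists x.
by apply: le_lt_trans (ler_norm M) _; rewrite ltrDl.
Qed.

Lemma separated_subexp (e d : R) : 0 < e -> 0 < d -> exists W0, forall W, (W0 <= W)%N ->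
  (separated_card T W e <= (expR (d * W%:R))%:E)%E.
Proof.
move=> e0 d0; have [_ _ h0] := zeT.
have : (entropy_at T e < d%:E)%E.
  apply: (@le_lt_trans _ _ (topological_entropy T)); last by rewrite h0 lte_fin.
  by apply: ereal_sup_ubound; exists e.
rewrite /entropy_at /limn_esup /limf_esup => /ereal_inf_lt[_ [S [N _ hN] <-]] hS.
exists N.+1 => W NW; have WS : S W by apply: hN; exact: ltnW.
have W0 : 0 < W%:R :> R by rewrite ltr0n; apply: leq_trans NW.
have : (W%:R^-1%:E * lne (separated_card T W e) <= d%:E)%E.
  by apply: le_trans (ltW hS); apply: ereal_sup_ubound; exists W.
case: (separated_card T W e) => [s| |].
- have [s0|s0] := leP s 0; first by rewrite lee_fin (le_trans s0)// expR_ge0.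
  rewrite lne_EFin// -EFinM !lee_fin mulrC ler_pdivrMr// => h.
  by rewrite -[leLHS]lnK ?posrE// ler_expR.
- rewrite /= mulry gtr0_sg ?invr_gt0// mul1e => h; by have := lt_le_trans (ltry d) h; rewrite ltxx.
- by rewrite leNye.
Qed.

(** A separated set of maximal cardinality is a net, and zero entropy bounds
    its cardinality. *)
Lemma exists_net (e d : R) : 0 < e -> 0 < d -> exists W0, forall W, (W0 <= W)%N ->
  exists Y : {fset X}, #|` Y|%fset%:R <= expR (d * W%:R) /\
    forall q, exists2 p, p \in Y & forall i, (i < W)%N -> mdist (iter i T p) (iter i T q) <= e.
Proof.
move=> e0 d0; have [W0 hW0] := separated_subexp e0 d0; exists W0 => W /hW0 hW.
have sepE (Y : {fset X}) : separated T W e Y -> #|` Y|%fset%:R <= expR (d * W%:R).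
  move=> sY; rewrite -lee_fin; apply: le_trans hW; by apply: ereal_sup_ubound; exists Y.
pose P k := `[< exists2 Y : {fset X}, separated T W e Y & #|` Y|%fset = k >].
have P0 : exists k, P k.
  by exists 0%N; apply/asboolP; exists fset0; [move=> x y; rewrite inE|rewrite cardfs0].
have [n _ hn] := nbhs_infty_ger (expR (d * W%:R)).
have Pub k : P k -> (k <= n)%N.
  move=> /asboolP[Y sY <-]; rewrite -(ler_nat R); apply: le_trans (sepE Y sY) _; exact: hn (leqnn n).
have [k /asboolP[Y sY Yk] maxk] := ex_maxnP P0 Pub.
exists Y; split; first exact: sepE.
move=> q; apply: contrapT => noq.
have far p : p \in Y -> exists2 i, (i < W)%N & e < mdist (iter i T p) (iter i T q).
  move=> pY; apply: contrapT => h; apply: noq; exists p => // i iW.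
  by rewrite leNgt; apply/negP => hlt; apply: h; exists i.
have qY : q \notin Y.
  by apply/negP => /far[i _]; rewrite mdistxx ltNge (ltW e0).
suff : (#|` q |` Y|%fset <= k)%N by rewrite cardfsU1 qY Yk ltnn.
apply: maxk; apply/asboolP; exists (q |` Y)%fset => // x y.
rewrite !in_fset1U => /orP[/eqP ->|xY] /orP[/eqP ->|yY] xy.
- by rewrite eqxx in xy.
- by have [i iW h] := far _ yY; exists i => //; rewrite metric_sym.
- exact: far.
- exact: sY.
Qed.

Lemma orbit_cover (x : X) (F e d : R) : (forall z, `|f z| <= F) -> 0 < e -> 0 < d ->
  exists W0, forall W, (W0 <= W)%N ->
  exists (S : nat) (wt : 'I_S -> nat -> R),
    [/\ S%:R <= expR (d * W%:R), forall p i, `|wt p i| <= F &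
    forall k, exists p, forall i, (i < W)%N -> `|f (iter (k + i) T x) - wt p i| <= e].
Proof.
move=> fF e0 d0; have [r r0 hr] := uniformly_continuous e0.
have [W0 hW0] := exists_net r0 d0; exists W0 => W /hW0[Y [cY hY]].
exists #|` Y|%fset, (fun p i => f (iter i T (nth x (enum_fset Y) p))); split => //.
move=> k; have [p pY hp] := hY (iter k T x).
have ip : (index p (enum_fset Y) < #|` Y|%fset)%N by rewrite index_mem.
exists (Ordinal ip) => i iW /=; rewrite nth_index// addnC iterD distrC.
exact: hr (hp i iW).
Qed.

End Covers.

(** * Complex values and generic points *)

Section ComplexTopology.
Variable R : realType.

Lemma normC_normc (x : R[i]) : `|x| = (normc x)%:C%C.
Proof. by []. Qed.

Lemma lipschitz_continuous_complex (K : R) (g : R[i] -> R) : 0 < K ->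
  (forall x y, `|g x - g y| <= K * normc (x - y)) -> continuous g.
Proof.
move=> K0 hg x U /nbhs_ballP[e /= e0 eU]; apply/nbhs_ballP.
exists (e / K)%:C%C; first by rewrite /= ltcR divr_gt0.
move=> y; rewrite /ball /= normC_normc ltcR => xy; apply: eU.
by apply: le_lt_trans (hg _ _) _; rewrite mulrC -ltr_pdivlMr.
Qed.

Lemma normc_ge0 (x : R[i]) : 0 <= normc x.
Proof. by case: x => a b; exact: sqrtr_ge0. Qed.

Lemma Re_le_normc (x : R[i]) : `|Re x| <= normc x.
Proof. by rewrite -lecR -normC_normc; exact: normc_ge_Re. Qed.

Lemma Im_le_normc (x : R[i]) : `|Im x| <= normc x.
Proof.
case: x => a b /=; rewrite -(sqrtr_sqr b) ler_wsqrtr// lerDr; exact: sqr_ge0.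
Qed.

Lemma normc_le_ReIm (x : R[i]) : normc x <= `|Re x| + `|Im x|.
Proof.
case: x => a b /=; rewrite -[leRHS]ger0_norm ?addr_ge0// -sqrtr_sqr ler_wsqrtr//.
rewrite sqrrD !real_normK ?num_real//.
have := mulr_ge0 (normr_ge0 a) (normr_ge0 b); rewrite mulr2n; lra.
Qed.

Lemma continuous_Re : continuous (@Re R).
Proof.
apply: (@lipschitz_continuous_complex 1) => // x y; rewrite mul1r.
apply: le_trans (Re_le_normc (x - y)).
by case: x => a b; case: y => c d.
Qed.

Lemma continuous_Im : continuous (@Im R).
Proof.
apply: (@lipschitz_continuous_complex 1) => // x y; rewrite mul1r.
apply: le_trans (Im_le_normc (x - y)).
by case: x => a b; case: y => c d.
Qed.

Lemma normcB_lipschitz (c x y : R[i]) : `|normc (x - c) - normc (y - c)| <= normc (x - y).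
Proof.
have h (u w : R[i]) : normc (u - c) <= normc (u - w) + normc (w - c).
  by have := le_normcD (u - w) (w - c); rewrite addrA subrK.
have e : normc (y - x) = normc (x - y) by rewrite -opprB normcN.
have := h x y; have := h y x; rewrite e ler_norml; lra.
Qed.

Lemma cvg_complex0 (s : nat -> R[i]) :
  s @ \oo --> (0 : R[i]) <->
  (fun n => Re (s n)) @ \oo --> (0 : R) /\ (fun n => Im (s n)) @ \oo --> (0 : R).
Proof.
split=> [h|[hr hi]].
  by split; [have := cvg_comp _ _ h (continuous_Re (x := 0))
            |have := cvg_comp _ _ h (continuous_Im (x := 0))].
move=> U /nbhs_ballP[e /= e0 eU].
have eE : e = (Re e)%:C%C by move: e0; case: (e) => a b; rewrite ltcE /= => /andP[/eqP -> _].
have re0 : 0 < Re e by rewrite -ltcR -eE.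
have r2 : 0 < Re e / 2 by rewrite divr_gt0.
move/cvgrPdist_lt: hr => /(_ _ r2) hr; move/cvgrPdist_lt: hi => /(_ _ r2) hi.
suff : \forall n \near \oo, ball (0 : R[i]) e (s n) by apply: filterS => n; exact: eU.
near=> n; rewrite /ball /= sub0r normrN normC_normc eE ltcR.
apply: le_lt_trans (normc_le_ReIm _) _; rewrite [ltRHS]splitr ltrD//.
- by have := near hr n; rewrite /= sub0r normrN; apply.
- by have := near hi n; rewrite /= sub0r normrN; apply.
Unshelve. all: by end_near. Qed.

End ComplexTopology.

Section EmpiricalIntegrals.
Variables (R : realType) (L : {nonneg R}).
Variable f : shift_space L -> R.
Hypothesis cf : continuous f.
Hypothesis f0 : forall x, 0 <= f x.

Lemma measurable_cont : measurable_fun [set: borel (shift_space L)] f.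
Proof.
move=> mD; apply: (measurability _ (RGenOInfty.measurableE R)) => //.
move=> _ [_ [x ->] <-]; rewrite setTI; apply: sub_sigma_algebra.
by move/continuousP: cf; apply; exact: interval_open.
Qed.

Lemma integral_empirical z N :
  (\int[empirical_measure z N]_x (f x)%:E =
   (N%:R^-1 * \sum_(n < N) f (iter n.+1 (@shift R L) z))%:E)%E.
Proof.
have mf : measurable_fun [set: borel (shift_space L)] (EFin \o f).
  by apply/measurable_EFinP; exact: measurable_cont.
rewrite /empirical_measure ge0_integral_mscale//; last by move=> x _; rewrite lee_fin.
rewrite ge0_integral_measure_sum//; last by move=> x _; rewrite lee_fin.
under eq_bigr => n _ do rewrite integral_dirac// diracT mul1e.
by rewrite sumEFin -EFinM.
Qed.

Lemma generic_cvg z : generic z -> (forall x, f x <= 1) ->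
  cvgn (fun N => N%:R^-1 * \sum_(n < N) f (iter n.+1 (@shift R L) z)).
Proof.
move=> [nu hnu] f1; have := hnu f cf.
under eq_fun do rewrite integral_empirical.
set l := (\int[nu]_x _)%E => hl.
have l0 : (0 <= l)%E by apply: integral_ge0 => x _; rewrite lee_fin.
have l1 : (l <= 1)%E.
  apply: (@le_trans _ _ (\int[nu]_x (cst 1%E x))%E).
    apply: ge0_le_integral => //.
    - by move=> x _; rewrite lee_fin.
    - by apply/measurable_EFinP; exact: measurable_cont.
    - by move=> x _; rewrite lee_fin.
  by rewrite integral_cst// mul1e; exact: probability_le1.
have lfin : l \is a fin_num by rewrite ge0_fin_numE// (le_lt_trans l1)// ltry.
apply/cvg_ex; exists (fine l).
by move: hl; rewrite -(fineK lfin) => /fine_cvgP[_ h]; exact: h.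
Qed.

End EmpiricalIntegrals.

Section GenericFrequencies.
Variables (R : realType) (L : {nonneg R}) (A : finType) (v : A -> R[i]) (a : nat -> A).
Variable z : shift_space L.
Hypothesis v_inj : injective v.
Hypothesis za : forall n, (0 < n)%N -> set_val (z n%:Z) = v (a n).
Hypothesis generic_z : generic z.

Lemma separation : exists2 r : R, 0 < r & forall c c', c != c' -> r <= normc (v c - v c').
Proof.
pose r := \big[Num.min/1]_(p : A * A | p.1 != p.2) normc (v p.1 - v p.2).
exists r; last first.
  by move=> c c' cc'; rewrite /r (bigD1 (c, c'))//= ge_min lexx.
rewrite /r; elim/big_ind : _ => // [x y x0 y0|[c c'] /= cc']; first by rewrite lt_min x0.
rewrite lt_def normc_ge0 andbT; apply: contraNneq cc' => /ComplexField.Normc.eq0_normc/eqP.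
by rewrite subr_eq0 => /eqP/v_inj ->.
Qed.

(** The indicator of a cylinder is not continuous on the space of sequences in
    a disc. Since the values are finitely many, it agrees, along the orbit,
    with a product of continuous bumps that are 1 at one value and 0 at the
    others. *)
Lemma frequencies_of_generic : has_frequencies R a.
Proof.
have [r r0 hr] := separation; move=> M w.
pose bump (c : A) (x : R[i]) : R := Num.max 0 (1 - normc (x - v c) / r).
have bumpE c c' : bump c (v c') = (c' == c)%:R.
  rewrite /bump; have [->|ne] := eqVneq c' c.
    by rewrite subrr ComplexField.Normc.normc0 mul0r subr0; apply/max_idPr.
  by apply/max_idPl; rewrite subr_le0 ler_pdivlMr// mul1r hr.
have cbump c : continuous (bump c).
  apply: (@lipschitz_continuous_complex _ r^-1); first by rewrite invr_gt0.
  move=> x y; rewrite /bump.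
  have := normcB_lipschitz (v c) x y; move: (normc (x - v c)) (normc (y - v c)) => s t.
  move=> /(ler_wpM2l (ltW (_ : 0 < r^-1))); rewrite invr_gt0 => /(_ r0).
  rewrite -[X in X * `|_|]gtr0_norm ?invr_gt0// -normrM mulrBr ![r^-1 * _]mulrC.
  move: (s / r) (t / r) (normc _ / r) => s' t' u; rewrite !ler_norml /Num.max.
  by case: ltP => h1; case: ltP => h2 /andP[h3 h4]; apply/andP; split; lra.
pose f (x : shift_space L) : R := \prod_(j < M) bump (tnth w j) (set_val (x j%:Z)).
have cf : continuous f.
  apply: continuous_big => [|j _]; first exact: mul_continuous.
  have cs : continuous (fun x : shift_space L => x j%:Z).
    exact: (@proj_continuous int (fun=> disc L) (j%:Z)).
  have cv : continuous (fun d : disc L => set_val d : R[i]) by exact: initial_continuous.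
  move=> x; have cx := @continuous_comp _ _ _ (fun x : shift_space L => x j%:Z)
    (fun d : disc L => set_val d : R[i]) x (cs x) (cv _).
  exact: (@continuous_comp _ _ _ _ (bump (tnth w j)) x cx (cbump _ _)).
have b0 c x : 0 <= bump c x by rewrite /bump le_max lexx.
have b1 c x : bump c x <= 1.
  by rewrite /bump ge_max ler01/= lerBlDr lerDl divr_ge0 ?normc_ge0// ltW.
have f0 x : 0 <= f x by apply: prodr_ge0.
have f1 x : f x <= 1.
  by rewrite /f; apply: prodr_ile1 => j _; rewrite b0 b1.
have shiftE n x k : iter n (@shift R L) x k = x (k + n%:Z).
  elim: n k => [|n IH] k; first by rewrite addr0.
  by rewrite iterS /shift IH; congr x; lia.
have hcv := generic_cvg cf f0 generic_z f1.
suff -> : avg a (fun x => (win 0 M x == w)%:R) =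
    (fun N => N%:R^-1 * \sum_(n < N) f (iter n.+1 (@shift R L) z)) by [].
apply/funext => N; rewrite /avg; congr (_ * _); symmetry.
rewrite big_add1 big_mkord; apply: eq_bigr => n _.
rewrite /f (eq_bigr (fun j : 'I_M => (a (n.+1 + j)%N == tnth w j)%:R)); last first.
  move=> j _; rewrite shiftE -PoszD za ?addnS// bumpE; congr (_ == _)%:R.
  by rewrite addnC.
case: eqP => [e|ne].
  rewrite big1// => j _; rewrite -e tnth_mktuple /suffix_from eqxx//.
apply/eqP/prodf_eq0; have [j hj] : exists j : 'I_M, a (n.+1 + j)%N != tnth w j.
  apply: contrapT => h; apply: ne; apply: eq_from_tnth => j; rewrite tnth_mktuple.
  by apply/eqP; apply: contrapT => hj; apply: h; exists j; apply/negP.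
by exists j => //; rewrite (negbTE hj).
Qed.

End GenericFrequencies.

(** * Orthogonality makes conditional expectations vanish *)

Definition low_complexity (R : realType) (V : eqType) (y : nat -> V) :=
  forall d : R, 0 < d -> exists2 C : R, 0 < C & forall n, exists l : seq (seq V),
    (forall p, mkseq (fun j => y (p + j)%N) n \in l) /\ (size l)%:R <= C * expR (d * n%:R).

Definition two_sided (V : Type) (z0 : V) (y : nat -> V) (k : int) : V :=
  if k is Posz n then y n else z0.

(** A window that meets the negative times is a block of letters z0 followed by
    a prefix of y, which adds at most n + 1 words of length n. *)
Lemma two_sided_complexity (R : realType) (V : eqType) (z0 : V) (y : nat -> V) :
  low_complexity R y -> forall d : R, 0 < d -> exists2 C : R, 0 < C & forall n,
  exists l : seq (seq V),
    (forall p : int, mkseq (fun j => two_sided z0 y (p + j%:Z)) n \in l) /\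
    (size l)%:R <= C * expR (d * n%:R).
Proof.
move=> hy d d0; have [C C0 hC] := hy d d0.
(* n + 1 <= (1 + 1 / d) exp (d n). *)
exists (C + (1 + d^-1)); first by rewrite addr_gt0// addr_gt0// invr_gt0.
move=> n; have [l [hl cl]] := hC n.
exists (l ++ [seq take n (nseq s z0 ++ mkseq y n) | s <- iota 0 n.+1]); split.
  move=> p; rewrite mem_cat; case: p => p; first by rewrite hl.
  apply/orP; right; apply/mapP; exists (minn p.+1 n).
    by rewrite mem_iota add0n ltnS geq_minr.
  apply: (@eq_from_nth _ z0) => [|j].
    rewrite size_mkseq size_take size_cat size_nseq size_mkseq.
    by case: ltnP => // h; apply/eqP; rewrite eqn_leq h leq_addl.
  rewrite size_mkseq => jn; rewrite nth_mkseq// nth_take// nth_cat size_nseq.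
  have [jp|pj] := ltnP j p.+1.
    rewrite leq_min jp jn nth_nseq leq_min jp jn.
    have -> : Negz p + j%:Z = Negz (p - j)%N by lia.
    by [].
  rewrite (_ : (j < minn p.+1 n)%N = false); last by rewrite leq_min ltnNge pj.
  have -> : Negz p + j%:Z = (j - p.+1)%N by lia.
  have pn : (p.+1 <= n)%N by apply: leq_trans pj (ltnW jn).
  by rewrite /= (minn_idPl pn) nth_mkseq// (leq_ltn_trans (leq_subr _ _)).
rewrite size_cat size_map size_iota natrD mulrDl lerD//.
have := expR_ge1Dx (d * n%:R); have dn : 0 <= d * n%:R by rewrite mulr_ge0 ?ler0n// ltW.
move: (expR _) => ex h; rewrite mulrDl mul1r -natr1 addrC lerD//; first by lra.
rewrite mulrC ler_pdivlMr// mulrC; lra.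
Qed.

Section Concatenation.
Variables (R : realType) (V : eqType) (z0 : V) (W r : nat -> nat) (L : nat -> seq (seq V)).
Hypothesis W_gt0 : forall i, (0 < W i)%N.
Hypothesis WS : forall i, W i.+1 = (r i * W i)%N.
Hypothesis size_L : forall i s, s \in L i -> size s = W i.
Variable y : nat -> V.
Hypothesis y_good : forall i, exists p0, forall n, exists s, good z0 W r L i s /\
  (forall p, (p < n)%N -> (p < size s)%N /\ y (p0 + p)%N = nth z0 s p).
Variable rate : nat -> R.
Hypothesis rate_small : forall d : R, 0 < d -> exists i, 0 <= rate i <= d.
Hypothesis L_few : forall i,
  expR (- rate i) + (size (L i)).+1%:R * expR (- (rate i * (W i)%:R)) <= 1.

(** For each scale i, all windows of y but those starting before p0 are infixes
    of good words, and their number grows at rate at most rate i. *)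
Lemma low_complexity_good : low_complexity R y.
Proof.
move=> d d0; have [i /andP[r0 rd]] := rate_small d0; have [p0 hp0] := y_good i.
pose C := p0%:R + (W i)%:R * expR (rate i * (W i).*2%:R).
have C0 : 0 < C by rewrite ltr_wpDl// mulr_gt0 ?expR_gt0 ?ltr0n.
exists C => // n.
have [l [hl cl]] := good_infix_count z0 W_gt0 WS size_L (L_few i) n.
exists (mkseq (fun p => mkseq (fun j => y (p + j)%N) n) p0 ++ l); split.
  move=> p; rewrite mem_cat; have [pp0|p0p] := ltnP p p0.
    by apply/orP; left; apply/mapP; exists p => //; rewrite mem_iota add0n.
  apply/orP; right; have [s [gs hs]] := hp0 (p - p0 + n)%N.
  have sz : (p - p0 + n <= size s)%N.
    rewrite leqNgt; apply/negP => lt; have [] := hs _ lt; by rewrite ltnn.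
  suff -> : mkseq (fun j => y (p + j)%N) n = take n (drop (p - p0) s) by exact: hl.
  apply: (@eq_from_nth _ z0); rewrite size_mkseq.
    by rewrite size_take size_drop; case: ltnP => //; lia.
  move=> j jn; rewrite nth_mkseq// nth_take// nth_drop.
  have [|_ <-] := hs (p - p0 + j)%N; first by rewrite ltn_add2l.
  by congr y; lia.
rewrite size_cat size_mkseq natrD /C mulrDl lerD//.
  rewrite ler_peMr ?ler0n// -expR0 ler_expR mulr_ge0 ?ler0n// ltW//.
apply: le_trans cl _; rewrite natrD mulrDr expRD -mulrA ler_wpM2l//.
by rewrite mulrC ler_wpM2l ?expR_ge0// ler_expR ler_wpM2r.
Qed.

End Concatenation.

Section TailTrivial.
Variables (R : realType) (A : finType) (a : nat -> A).
Hypothesis freq : has_frequencies R a.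
Local Notation E := (freq_mean a).
Variables (b : A -> R).
Local Notation energy := (@energy R A a b).

Hypothesis orth : forall y : nat -> option bool, low_complexity R y ->
  (fun N => N%:R^-1 * \sum_(1 <= n < N.+1) sgn_val R (y n) * b (a n)) @ \oo --> (0 : R).

Lemma geometric_le n : \sum_(i < n) (2^-1 ^+ i.+1 : R) <= 1.
Proof.
have -> : \sum_(i < n) (2^-1 ^+ i.+1 : R) = 1 - 2^-1 ^+ n.
  elim: n => [|n IH]; first by rewrite big_ord0 expr0 subrr.
  by rewrite big_ord_recr/= IH exprS; lra.
by rewrite lerBlDr lerDl exprn_ge0// invr_ge0.
Qed.

(** If the energies stay large, exists_codings provides codings that correlate
    with b(x_0), few_words provides at each scale a short list containing most
    of their words, and exists_correlated_sequence a sequence of low complexity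
    that correlates with b o a along infinitely many N, against the hypothesis.
    *)
Theorem energy_vanishes (e : R) : 0 < e -> exists M, forall m l, (M <= m)%N -> energy m l <= e.
Proof.
move=> e0; apply: contrapT => hnot.
have energy_large m : exists l, e <= energy m l.
  apply: contrapT => h; apply: hnot; exists m => m' l mm'.
  rewrite leNgt; apply/negP => lt; apply: h; exists (m' - m + l)%N.
  apply: le_trans (ltW lt) _; apply: energy_le => //; by rewrite addnA subnKC.
pose B : R := 1 + \sum_(c : A) `|b c|.
have B0 : 0 < B by rewrite ltr_pwDl// sumr_ge0.
have bB c : `|b c| <= B.
  by rewrite /B (bigD1 c)//= addrCA lerDl addr_ge0// sumr_ge0.
have [l_ [col [cauchy [g g0 c_corr]]]] := exists_codings freq B0 bB e0 energy_large.
have far W : exists K, forall k, (K <= k)%N -> (W <= id k)%N by exists W.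
pose d i : R := i.+1%:R^-1; have d0 i : 0 < d i by rewrite invr_gt0 ltr0n.
(* The errors at all scales add up to at most the loss that E_gain allows. *)
pose eta i : R := g / (4 * B) * 2^-1 ^+ i.+1.
have gB0 : 0 < g / (4 * B) by rewrite divr_gt0// mulr_gt0.
have eta0 i : 0 < eta i by rewrite mulr_gt0// exprn_gt0// invr_gt0.
have eta_sum n : \sum_(i < n) eta i <= g / (4 * B).
  by rewrite -mulr_sumr ger_pMr// geometric_le.
have [W1 hW1] := boolp.choice (fun i => few_words freq far cauchy (d0 i) (eta0 i)).
(* For W i beyond this bound, the listed words satisfy the counting condition
   L_few at rate 2 d i: their number is at most exp (d i * W i), half of the
   rate. *)
have hW2' i : exists n : nat, 2 / (d i * (1 - expR (- (2 * d i)))) <= n%:R.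
  by have [n _ hn] := nbhs_infty_ger (2 / (d i * (1 - expR (- (2 * d i))))); exists n; exact: hn (leqnn n).
have [W2 hW2] := boolp.choice hW2'.
pose w i := (maxn (W1 i) (W2 i)).+1.
pose W := fix W i := if i is i'.+1 then (w i * W i')%N else w 0%N.
pose r i := w i.+1.
have WS i : W i.+1 = (r i * W i)%N by [].
have W_gt0 i : (0 < W i)%N by elim: i => // i IH; rewrite WS muln_gt0.
have wW i : (w i <= W i)%N by case: i => // i; rewrite WS leq_pmulr.
have hP i : exists P : pred ((W i).-tuple (option bool)),
    #|P|%:R <= expR (d i * (W i)%:R) /\
    exists K, forall k, (K <= k)%N -> Prob R a (fun x => ~~ P (cword id col k (W i) x)) <= eta i.
  by apply: hW1; apply: leq_trans (wW i); rewrite /w ltnW// ltnS leq_maxl.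
pose P i := projT1 (cid (hP i)).
have [PC PK] : (forall i, #|P i|%:R <= expR (d i * (W i)%:R)) /\
   (forall i, exists K, forall k, (K <= k)%N ->
      Prob R a (fun x => ~~ P i (cword id col k (W i) x)) <= eta i).
  by split=> i; rewrite /P; case: (cid _) => /= p [].
pose L i : seq (seq (option bool)) := map val (enum (P i)).
have size_L i s : s \in L i -> size s = W i by case/mapP => t _ ->; rewrite size_tuple.
have typical i : exists K, forall k, (K <= k)%N ->
    Prob R a (fun x => cw (coding id col) k (W i) x \notin L i) <= eta i.
  have [K hK] := PK i; exists K => k /hK; congr (_ <= _); congr Prob; apply/funext => x.
  have -> : cw (coding id col) k (W i) x = val (cword id col k (W i) x).
    apply: (@eq_from_nth _ None); rewrite size_mkseq ?size_tuple// => j jW.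
    by rewrite nth_mkseq// -(tnth_nth _ _ (Ordinal jW)) tnth_mktuple.
  by rewrite /L mem_map ?mem_enum//; exact: val_inj.
have local_c k : local (id k + l_ k) (coding id col k) by exact: local_coding.
have val_le (s : option bool) : `|sgn_val R s| <= 1.
  by case: s => [[]|] /=; rewrite ?normrN ?normr1 ?normr0.
have [y [y_good y_corr]] := exists_correlated_sequence freq B0 bB val_le (erefl : sgn_val R None = 0)
   local_c W_gt0 WS size_L g0 c_corr eta_sum typical.
have rate_small (c : R) : 0 < c -> exists i, 0 <= 2 * d i <= c.
  move=> c0; have [n _ hn] := nbhs_infty_ger (2 / c); exists n.
  rewrite mulr_ge0 ?(ltW (d0 n))//= /d ler_pdivrMr ?ltr0n// mulrC -ler_pdivrMr//.
  by apply: le_trans (hn n (leqnn n)) _; rewrite ler_nat.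
have L_few i : expR (- (2 * d i)) + (size (L i)).+1%:R * expR (- (2 * d i * (W i)%:R)) <= 1.
  have t0 : 0 < 1 - expR (- (2 * d i)).
    by rewrite subr_gt0 expR_lt1 oppr_lt0 mulr_gt0.
  have W0 : 0 < (W i)%:R :> R by rewrite ltr0n.
  suff : (size (L i)).+1%:R * expR (- (2 * d i * (W i)%:R)) <= 1 - expR (- (2 * d i)) by lra.
  set ex := expR (d i * (W i)%:R).
  have ex0 : 0 < ex by exact: expR_gt0.
  have ex1 : 1 <= ex by rewrite /ex -expR0 ler_expR mulr_ge0// ltW.
  have -> : expR (- (2 * d i * (W i)%:R)) = ex^-1 * ex^-1.
    by rewrite /ex -expRN -expRD; congr expR; ring.
  have sL : (size (L i)).+1%:R <= 2 * ex.
    rewrite size_map -cardE -natr1; apply: le_trans (lerD (PC i) (lexx 1)) _.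
    by rewrite -/ex; lra.
  apply: (@le_trans _ _ (2 * ex * (ex^-1 * ex^-1))).
    by rewrite ler_wpM2r// mulr_ge0// invr_ge0 ltW.
  rewrite mulrA mulfK ?gt_eqF// ler_pdivrMr//.
  have : d i * (W i)%:R <= ex by apply: le_trans (expR_ge1Dx _); lra.
  move=> /(ler_wpM2l (ltW t0)); apply: le_trans; rewrite mulrCA mulrA -ler_pdivrMl ?mulr_gt0//.
  rewrite mulrC; apply: le_trans (hW2 i) _; rewrite ler_nat; apply: leq_trans (wW i).
  by rewrite /w ltnW// ltnS leq_maxr.
have hy : low_complexity R y by exact: (low_complexity_good W_gt0 WS size_L y_good rate_small L_few).
have := orth hy => /cvgrPdist_lt/(_ (g / 4)); rewrite divr_gt0// => /(_ isT)[N0 _ hN0].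
have [N NN0 hN] := y_corr (maxn N0 1).
have := hN0 N (leq_trans (leq_maxl _ _) NN0); rewrite /= sub0r normrN.
have N1 : (0 < N)%N by apply: leq_trans (leq_maxr N0 1) NN0.
have NR : 0 < N%:R :> R by rewrite ltr0n.
move=> /(le_lt_trans (ler_norm _)); rewrite mulrC ltr_pdivrMr// => /(le_lt_trans hN).
by rewrite ltr_pM2l ?divr_gt0// ltr_nat ltnNge leqnSn.
Qed.

End TailTrivial.

(** * The two implications *)

Section ComplexMeans.
Variable R : realType.
Implicit Types s t : nat -> R[i].

Lemma ReD (x y : R[i]) : Re (x + y) = Re x + Re y.
Proof. by case: x; case: y. Qed.

Lemma ImD (x y : R[i]) : Im (x + y) = Im x + Im y.
Proof. by case: x; case: y. Qed.

Lemma ReM (x y : R[i]) : Re (x * y) = Re x * Re y - Im x * Im y.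
Proof. by case: x; case: y. Qed.

Lemma ImM (x y : R[i]) : Im (x * y) = Re x * Im y + Im x * Re y.
Proof. by case: x; case: y. Qed.

Lemma natrC_inv N : (N%:R^-1 : R[i]) = ((N%:R^-1 : R)%:C)%C.
Proof. by rewrite -(rmorph_nat (real_complex R)) -fmorphV. Qed.

Lemma Re_mean s N : Re (mean s N) = N%:R^-1 * \sum_(1 <= n < N.+1) Re (s n).
Proof.
by rewrite /mean natrC_inv ReM /= mul0r subr0 (big_morph (@Re R) ReD (erefl : Re 0 = 0)).
Qed.

Lemma Im_mean s N : Im (mean s N) = N%:R^-1 * \sum_(1 <= n < N.+1) Im (s n).
Proof.
by rewrite /mean natrC_inv ImM /= mul0r addr0 (big_morph (@Im R) ImD (erefl : Im 0 = 0)).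
Qed.

Lemma normcE (x : R[i]) : normc x = Num.sqrt (Re x ^+ 2 + Im x ^+ 2).
Proof. by case: x. Qed.

Lemma ReMr (x : R[i]) (k : bool) : Re (x * k%:R) = Re x * k%:R.
Proof. by case: k; rewrite ?mulr1// !mulr0. Qed.

Lemma ImMr (x : R[i]) (k : bool) : Im (x * k%:R) = Im x * k%:R.
Proof. by case: k; rewrite ?mulr1// !mulr0. Qed.

End ComplexMeans.

Section Glue.
Variables (R : realType) (u : nat -> R[i]) (A : finType) (v : A -> R[i]) (a : nat -> A).
Hypothesis v_inj : injective v.
Hypothesis uv : forall n, (0 < n)%N -> u n = v (a n).
Hypothesis freq : has_frequencies R a.
Local Notation E := (freq_mean a).

Let br c := Re (v c).
Let bi c := Im (v c).

(** The value of the inner limit for a set of blocks that the predicate D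
    describes through the letters. *)
Definition event_limit m l (D : pred (l.-tuple A)) : R :=
  Num.sqrt (E (fun x => br (x 0%N) * (D (win m l x))%:R) ^+ 2 +
            E (fun x => bi (x 0%N) * (D (win m l x))%:R) ^+ 2).

Lemma block_mean_cvg m l (C : set (l.-tuple R[i])) (D : pred (l.-tuple A)) :
  (forall n, (0 < n)%N ->
     ([tuple u (m + n + i)%N | i < l] \in C) = D (win m l (suffix_from n a))) ->
  block_mean u m C @ \oo --> event_limit m D.
Proof.
move=> CD.
have lD (b : A -> R) : local (m + l).+1 (fun x => b (x 0%N) * (D (win m l x))%:R).
  by move=> x y xy; rewrite (xy 0%N)// (win_agree xy).
have := E_cvg freq (lD br); have := E_cvg freq (lD bi) => hi hr.
have -> : block_mean u m C = (fun N => Num.sqrt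
    (avg a (fun x => br (x 0%N) * (D (win m l x))%:R) N ^+ 2 +
     avg a (fun x => bi (x 0%N) * (D (win m l x))%:R) N ^+ 2)).
  apply/funext => N; rewrite /block_mean normcE Re_mean Im_mean /avg.
  congr (Num.sqrt ((_ * _) ^+ 2 + (_ * _) ^+ 2)); apply: eq_big_nat => n /andP[n0 _].
    by rewrite indicE CD// ReMr uv// /suffix_from addn0.
  by rewrite indicE CD// ImMr uv// /suffix_from addn0.
have sq (s : nat -> R) (t : R) : s @ \oo --> t -> (fun N => s N ^+ 2) @ \oo --> t ^+ 2.
  by move=> st; rewrite expr2; under eq_fun do rewrite expr2; apply: cvgM.
exact: (cvg_comp _ _ (cvgD (sq _ _ hr) (sq _ _ hi)) (@sqrt_continuous R _)).
Qed.

Lemma window_values m l n : (0 < n)%N ->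
  [tuple u (m + n + i)%N | i < l] = map_tuple v (win m l (suffix_from n a)).
Proof.
move=> n0; apply: eq_from_tnth => i; rewrite tnth_mktuple tnth_map tnth_mktuple.
by rewrite /suffix_from uv ?addn_gt0 ?n0 ?orbT//; congr (v (a _)); lia.
Qed.

Lemma block_mean_cvg_event m l (C : set (l.-tuple R[i])) :
  block_mean u m C @ \oo --> event_limit m (fun w : l.-tuple A => map_tuple v w \in C).
Proof. by apply: block_mean_cvg => n n0; rewrite window_values. Qed.

(** The two energies control the inner limits for all lengths and all sets of
    blocks at once, which is the source of uniformity. *)
Lemma event_limit_le m l (D : pred (l.-tuple A)) (e : R) : 0 <= e ->
  energy a br m l <= e ^+ 2 -> energy a bi m l <= e ^+ 2 -> event_limit m D <= e + e.
Proof.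
move=> e0 hr hi; rewrite /event_limit.
have -> : e + e = Num.sqrt ((e + e) ^+ 2) by rewrite sqrtr_sqr ger0_norm// addr_ge0.
rewrite ler_wsqrtr//; have := sqr_E_event freq br m D; have := sqr_E_event freq bi m D.
have : 0 <= e ^+ 2 by exact: sqr_ge0.
rewrite sqrrD mulr2n; move: (E _ ^+ 2) (E _ ^+ 2) hr hi => h1 h2 h3 h4 h5 h6 h7.
have : 0 <= e * e by rewrite mulr_ge0.
lra.
Qed.

Lemma abs_E_le_event m l (D : pred (l.-tuple A)) :
  `|E (fun x => br (x 0%N) * (D (win m l x))%:R)| <= event_limit m D /\
  `|E (fun x => bi (x 0%N) * (D (win m l x))%:R)| <= event_limit m D.
Proof.
by split; rewrite -sqrtr_sqr ler_wsqrtr// ?lerDl ?lerDr sqr_ge0.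
Qed.

(** A sequence of low complexity with values in {-1, 0, 1} is read along an
    orbit of a subshift of zero entropy, so orthogonality applies to it. The
    real and imaginary parts of u are treated separately by energy_vanishes. *)
Theorem orthogonal_imp_vanish :
  orthogonal_to_zero_entropy u -> block_means_vanish_uniformly u.
Proof.
move=> orth.
have orth2 (y : nat -> option bool) : low_complexity R y ->
    mean (fun n => (sgn_val R (y n))%:C%C * u n) @ \oo --> (0 : R[i]).
  move=> hy; have hyy := two_sided_complexity None hy.
  have [X [T [ze real]]] := zero_entropy_realization hyy.
  have [f [x [cf fx]]] := real R[i] (fun c => (sgn_val R c)%:C%C).
  have <- : (fun n => f (iter n T x) * u n) = (fun n => (sgn_val R (y n))%:C%C * u n).
    by apply/funext => n; rewrite fx.
  exact: orth.
have part (g : R[i] -> R) (b : A -> R) :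
    (forall s N, g (mean s N) = N%:R^-1 * \sum_(1 <= n < N.+1) g (s n)) ->
    (forall (r : R) x, g (r%:C%C * x) = r * g x) -> (forall c, b c = g (v c)) ->
    (forall s : nat -> R[i], s @ \oo --> (0 : R[i]) -> (fun n => g (s n)) @ \oo --> (0 : R)) ->
    forall e : R, 0 < e -> exists M, forall m l, (M <= m)%N -> energy a b m l <= e.
  move=> gmean gr bg g0; apply: (energy_vanishes freq) => y /orth2/g0 h.
  have <- : (fun N => g (mean (fun n => (sgn_val R (y n))%:C%C * u n) N)) =
      (fun N => N%:R^-1 * \sum_(1 <= n < N.+1) sgn_val R (y n) * b (a n)).
    apply/funext => N; rewrite gmean; congr (_ * _); apply: eq_big_nat => n /andP[n0 _].
    by rewrite gr uv// bg.
  exact: h.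
have qr : forall e : R, 0 < e -> exists M, forall m l, (M <= m)%N -> energy a br m l <= e.
  apply: (part _ br (@Re_mean R)) => [r x|//|s h]; first by rewrite ReM /= mul0r subr0.
  exact: ((cvg_complex0 s).1 h).1.
have qi : forall e : R, 0 < e -> exists M, forall m l, (M <= m)%N -> energy a bi m l <= e.
  apply: (part _ bi (@Im_mean R)) => [r x|//|s h]; first by rewrite ImM /= mul0r addr0.
  exact: ((cvg_complex0 s).1 h).2.
split.
  move=> m l C _ _; apply/cvg_ex; eexists; exact: block_mean_cvg_event.
set S := fun m => _.
have Sle (e : R) : 0 < e -> exists M, forall m, (M <= m)%N -> (S m <= (e + e)%:E)%E.
  move=> e0; have e2 := exprn_gt0 2 e0.
  have [M1 h1] := qr _ e2; have [M2 h2] := qi _ e2; exists (maxn M1 M2) => m.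
  rewrite geq_max => /andP[M1m M2m].
  apply: ge_ereal_sup => _ [l [C [_ _ ->]]]; rewrite lee_fin.
  rewrite (cvg_lim _ (@block_mean_cvg_event m _ C))//.
  by apply: event_limit_le (ltW e0) (h1 _ _ M1m) (h2 _ _ M2m).
have S0 m : (0 <= S m)%E.
  apply: (@le_trans _ _ (limn (block_mean u m (set0 : set (1.-tuple R[i]))))%:E).
    rewrite lee_fin (cvg_lim _ (@block_mean_cvg_event m _ set0))//; exact: sqrtr_ge0.
  by apply: ereal_sup_ubound; exists 1%N, set0; split.
have Sfin m : (S m <= (1 + 1)%:E)%E -> S m \is a fin_num.
  by move=> h; rewrite ge0_fin_numE// (le_lt_trans h)// ltry.
apply/fine_cvgP; split.
  by have [M hM] := Sle 1 ltr01; exists M => // m /= Mm; apply/Sfin/hM.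
apply/cvgrPdist_le => e e0; have e2 : 0 < e / 2 by rewrite divr_gt0.
have [M1 hM1] := Sle 1 ltr01; have [M2 hM2] := Sle _ e2.
exists (maxn M1 M2) => // m /=; rewrite geq_max => /andP[M1m M2m].
rewrite sub0r normrN /comp -lee_fin ger0_norm ?fine_ge0// fineK ?Sfin ?hM1//.
by rewrite [e]splitr hM2.
Qed.

(** The correlation of f with u splits into four real ones. For each of them,
    small inner limits make the conditional expectations small in L1, and zero
    entropy provides the few patterns that decoupling requires. *)
Theorem vanish_imp_orthogonal :
  block_means_vanish_uniformly u -> orthogonal_to_zero_entropy u.
Proof.
move=> [_ /fine_cvgP[Sfin S0]] X T ze f x cf.
have limit_small (t : R) : 0 < t -> exists2 m, (0 < m)%N &
    forall l (D : pred (l.-tuple A)), event_limit m D <= t.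
  move=> t0; move/cvgrPdist_lt: S0 => /(_ _ t0)[M1 _ h1].
  have [M2 _ h2] := Sfin; pose m := (maxn M1 M2).+1; exists m => // l D.
  have [M1m M2m] : (M1 <= m)%N /\ (M2 <= m)%N.
    by split; rewrite /m ltnW// ltnS ?leq_maxl ?leq_maxr.
  (* An event of the empty window is also an event of a window of length 1. *)
  wlog l0 : l D / (0 < l)%N.
    move=> h; case: l D => [|l] D; last exact: h.
    have := h 1%N (fun=> D [tuple]) isT; congr (_ <= _); rewrite /event_limit.
    by congr (Num.sqrt (E _ ^+ 2 + E _ ^+ 2)); apply/funext => z; rewrite [win m 0 z]tuple0.
  (* The set of blocks must consist of blocks of values of u; restricting to
     them changes no mean. *)
  pose C : set (l.-tuple R[i]) := [set s | blocks u s /\ exists2 w, D w & s = map_tuple v w].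
  have CD n : (0 < n)%N -> ([tuple u (m + n + i)%N | i < l] \in C) = D (win m l (suffix_from n a)).
    move=> n0; apply/idP/idP => [|Dw].
      rewrite inE => -[_ [w Dw]]; rewrite window_values// => e.
      suff -> : win m l (suffix_from n a) = w by [].
      by apply: val_inj; apply: (inj_map v_inj); exact: (congr1 val e).
    rewrite inE; split; last by exists (win m l (suffix_from n a)) => //; exact: window_values.
    by move=> i; rewrite tnth_mktuple; exists (m + n + i)%N => //=; rewrite addn_gt0 addn_gt0 n0 orbT.
  have hl := block_mean_cvg CD.
  rewrite -(cvg_lim _ hl)// -lee_fin.
  have := h1 m M1m; have := h2 m M2m; rewrite /= sub0r normrN => fin lt.
  apply: (@le_trans _ _ (ereal_sup [set v | exists l (C : set (l.-tuple R[i])),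
        [/\ (0 < l)%N, C `<=` @blocks R u l & v = (limn (block_mean u m C))%:E]])).
    by apply: ereal_sup_ubound; exists l, C; split => // s [].
  rewrite -(fineK fin) lee_fin; apply: le_trans (ltW lt); exact: ler_norm.
have condE_small (b : A -> R) : (forall m l (D : pred (l.-tuple A)),
     `|E (fun x => b (x 0%N) * (D (win m l x))%:R)| <= event_limit m D) ->
   forall tau : R, 0 < tau -> exists2 m, (0 < m)%N &
     forall l, E (fun x => `|condE a b m (win m l x)|) <= tau.
  move=> hb tau tau0; have [m m0 hm] := limit_small (tau / 2) (divr_gt0 tau0 (ltr0n _ 2)).
  exists m => // l; have -> : tau = 2 * (tau / 2) by rewrite mulrC divfK.
  by apply: (E_abs_condE freq) => D; apply: le_trans (hb m l D) (hm l D).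
have parts (g : X -> R) (b : A -> R) : continuous g ->
   (forall m l (D : pred (l.-tuple A)),
     `|E (fun x => b (x 0%N) * (D (win m l x))%:R)| <= event_limit m D) ->
   (fun N => N%:R^-1 * \sum_(1 <= k < N.+1) g (iter k T x) * b (a k)) @ \oo --> (0 : R).
  move=> cg hb; have [F F0 gF] := bounded_compact ze cg.
  pose B : R := 1 + \sum_(c : A) `|b c|.
  have B0 : 0 < B by rewrite ltr_pwDl// sumr_ge0.
  have bB c : `|b c| <= B.
    by rewrite /B (bigD1 c)//= addrCA lerDl addr_ge0// sumr_ge0.
  apply: (decoupling freq B0 bB (condE_small b hb) F0 (fun k => gF (iter k T x))).
  move=> e d e0 d0; exact: orbit_cover.
have cfr : continuous (fun z => Re (f z)).
  by move=> z; apply: (@continuous_comp _ _ _ f (@Re R)); [exact: cf|exact: continuous_Re].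
have cfi : continuous (fun z => Im (f z)).
  by move=> z; apply: (@continuous_comp _ _ _ f (@Im R)); [exact: cf|exact: continuous_Im].
have hr m l (D : pred (l.-tuple A)) := (abs_E_le_event m D).1.
have hi m l (D : pred (l.-tuple A)) := (abs_E_le_event m D).2.
pose corr (g : X -> R) (b : A -> R) N :=
  N%:R^-1 * \sum_(1 <= k < N.+1) g (iter k T x) * b (a k).
apply/cvg_complex0; split.
  have -> : (fun N => Re (mean (fun n => f (iter n T x) * u n) N)) =
      corr (fun z => Re (f z)) br \- corr (fun z => Im (f z)) bi.
    apply/funext => N; rewrite Re_mean /= /corr -mulrBr -sumrB; congr (_ * _).
    by apply: eq_big_nat => n /andP[n0 _]; rewrite ReM uv.
  by have := cvgB (parts _ _ cfr hr) (parts _ _ cfi hi); rewrite subr0; apply.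
have -> : (fun N => Im (mean (fun n => f (iter n T x) * u n) N)) =
    corr (fun z => Re (f z)) bi \+ corr (fun z => Im (f z)) br.
  apply/funext => N; rewrite Im_mean /= /corr -mulrDr -big_split; congr (_ * _).
  by apply: eq_big_nat => n /andP[n0 _]; rewrite ImM uv.
by have := cvgD (parts _ _ cfr hi) (parts _ _ cfi hr); rewrite addr0; apply.
Qed.

End Glue.

Theorem corollary3 (R : realType) (u : nat -> R[i])
    (finite_u : finite_set (values u))
    (L : {nonneg R})
    (bounded_u : forall n, (0 < n)%N -> ComplexField.Normc.normc (u n) <= L%:num)
    (z : shift_space L) (extension_z : symmetric_extension u z)
    (generic_z : generic z) :
  orthogonal_to_zero_entropy u <-> block_means_vanish_uniformly u.
Proof.
have [X uX] := finite_fsetP.1 finite_u.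
have memX n : (0 < n)%N -> u n \in X.
  by move=> n0; have h : values u (u n) by [exists n]; rewrite uX in h.
pose a n : X := insubd (FSetSub (memX 1%N isT)) (u n).
have uv n : (0 < n)%N -> u n = val (a n).
  by move=> n0; rewrite /a val_insubd memX.
have freq : has_frequencies R a.
  apply: (@frequencies_of_generic R L _ (val : X -> R[i]) a z val_inj) => // n n0.
  by rewrite -uv//; have [] := extension_z n n0.
split; [exact: orthogonal_imp_vanish uv freq|exact: vanish_imp_orthogonal val_inj uv freq].
Qed.
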